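(* Let $Q$ be a Dynkin quiver and $v\in kQ_0$ a regular weight. Then there is an isomorphism of $kQ$-modules $${}^v\Lambda(Q)\cong\bigoplus_{N\in\operatorname{ind}Q}N^{\oplus\dim N}.$$
   Context: $k$ is a field. A Dynkin quiver is a quiver $Q=(Q_0,Q_1,h,t)$ whose underlying graph is Dynkin of type $A_n,D_n,E_6,E_7,E_8$; an arrow $\alpha$ goes from its tail $t(\alpha)$ to its head $h(\alpha)$. Paths are composed from left to right, $e_i$ is the trivial path at $i$; modules are left modules. $\operatorname{ind}Q$ is a set of representatives of isomorphism classes of indecomposable finite-dimensional $kQ$-modules. A weight $v=(v_i)\in kQ_0=k^{Q_0}$ is regular if $\sum_{i\in Q_0}v_i\dim(e_iN)\ne0$ in $k$ for every indecomposable $kQ$-module $N$ (in particular all $v_i\neq0$). $\overline Q$ is the double of $Q$: add for each $\alpha\in Q_1$ an arrow $\alpha^*:h(\alpha)\to t(\alpha)$. Put $\rho_i=\sum_{t(\alpha)=i}\alpha\alpha^*-\sum_{h(\alpha)=i}\alpha^*\alpha$ ($\alpha\in Q_1$), ${}^v\varrho=\sum_iv_i^{-1}\rho_i$, ${}^v\eta_a=a\,{}^v\varrho-{}^v\varrho\,a$ for every arrow $a$ of $\overline Q$, and ${}^v\Lambda(Q)=k\overline Q/({}^v\eta_a\mid a\in\overline Q_1)$ (the quiver Heisenberg algebra), a left $kQ$-module through $kQ\to{}^v\Lambda(Q)$. *)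

(* Defs.v *)
From HB Require Import structures.
From mathcomp Require Import all_boot all_algebra ring_quotient finmap.
From mathcomp Require Import boolp classical_sets cardinality.
From mathcomp Require Import monalg.

Set Implicit Arguments.
Unset Strict Implicit.
Unset Printing Implicit Defensive.

Import GRing.Theory.
Local Open Scope ring_scope.

Record quiver := Quiver {
  vert : finType;
  arrow : finType;
  qhead : arrow -> vert;
  qtail : arrow -> vert }.

Inductive dynkin_type := TypeA of nat | TypeD of nat | TypeE of nat.

Definition dynkin_rank (T : dynkin_type) : nat :=
  match T with TypeA n => n | TypeD n => n | TypeE n => n end.

Definition dynkin_valid (T : dynkin_type) : bool :=
  match T with
  | TypeA n => 1 <= n
  | TypeD n => 4 <= n
  | TypeE n => 6 <= n <= 8
  end%N.

(* The diagrams on the vertices 0, ..., n-1, listed by edges {x, y} with x < y: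
   A_n is the chain 0 - 1 - ... - (n-1);
   D_n is the chain 0 - ... - (n-2) with n-1 attached to n-3;
   E_n is the chain 0 - ... - (n-2) with n-1 attached to 2. *)
Definition dynkin_edge (T : dynkin_type) (x y : nat) : bool :=
  match T with
  | TypeA n => y == x.+1
  | TypeD n => if y == n.-1 then x == n - 3 else y == x.+1
  | TypeE n => if y == n.-1 then x == 2 else y == x.+1
  end%N.

Definition dynkin_adj (T : dynkin_type) (x y : nat) : bool :=
  ((x < y) && dynkin_edge T x y || (y < x) && dynkin_edge T y x)%N.

(* The number of arrows between two vertices, in either direction, is the number
   (0 or 1) of edges of the diagram; in particular there are neither loops nor
   multiple edges. *)
Definition has_dynkin_type (Q : quiver) (T : dynkin_type) : Prop :=
  dynkin_valid T /\
  exists2 phi : vert Q -> 'I_(dynkin_rank T), bijective phi &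
    forall i j : vert Q,
      #|[set a : arrow Q | ((qtail a == i) && (qhead a == j))
                           || ((qtail a == j) && (qhead a == i))]|
      = dynkin_adj T (phi i) (phi j).

Definition dynkin (Q : quiver) : Prop :=
  exists T : dynkin_type, has_dynkin_type Q T.

(* [inl a] is the arrow a of Q and [inr a] is the reversed arrow a^*. *)
Definition qdouble (Q : quiver) : quiver :=
  @Quiver (vert Q) (arrow Q + arrow Q)%type
    (fun b => match b with inl a => qhead a | inr a => qtail a end)
    (fun b => match b with inl a => qtail a | inr a => qhead a end).

Section Paths.
Variable Q : quiver.

Fixpoint walk (i : vert Q) (s : seq (arrow Q)) : bool :=
  if s is a :: s' then (qtail a == i) && walk (qhead a) s' else true.

Definition qpath := {p : vert Q * seq (arrow Q) | walk p.1 p.2}.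
HB.instance Definition _ := Choice.on qpath.

Definition psrc (p : qpath) : vert Q := (val p).1.
Definition parrows (p : qpath) : seq (arrow Q) := (val p).2.
Definition ptgt (p : qpath) : vert Q := last (psrc p) (map (@qhead Q) (parrows p)).

Lemma walk_cat i s1 s2 :
  walk i (s1 ++ s2) = walk i s1 && walk (last i (map (@qhead Q) s1)) s2.
Proof. by elim: s1 i => [|a s IH] i //=; rewrite IH andbA. Qed.

Lemma pcat_subproof (p q : qpath) :
  ptgt p = psrc q -> walk (psrc p) (parrows p ++ parrows q).
Proof. by move=> e; rewrite walk_cat (valP p) -/(ptgt p) e (valP q). Qed.

(* Left-to-right composition: first p, then q. *)
Definition pcat (p q : qpath) (e : ptgt p = psrc q) : qpath :=
  Sub (psrc p, parrows p ++ parrows q) (pcat_subproof e).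

Definition pid (i : vert Q) : qpath := Sub (i, [::]) isT.

Lemma parr_subproof (a : arrow Q) : walk (qtail a) [:: a].
Proof. by rewrite /= eqxx. Qed.

Definition parr (a : arrow Q) : qpath := Sub (qtail a, [:: a]) (parr_subproof a).

(* [None] stands for the zero product of non-composable paths. *)
Definition pmul (p q : qpath) : option qpath :=
  match ptgt p =P psrc q with
  | ReflectT e => Some (pcat e)
  | ReflectF _ => None
  end.

Lemma qpathP (p q : qpath) : psrc p = psrc q -> parrows p = parrows q -> p = q.
Proof.
by case: p q => [[i s] hp] [[j r] hq]; rewrite /psrc /parrows /= => ei es;
  apply: val_inj; rewrite /= ei es.
Qed.

Lemma ptgt_cat p q (e : ptgt p = psrc q) : ptgt (pcat e) = ptgt q.
Proof. by rewrite /ptgt /= map_cat last_cat -/(ptgt p) e. Qed.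

Lemma pmulA p q r :
  obind (pmul p) (pmul q r) = obind (pmul^~ r) (pmul p q).
Proof.
rewrite /pmul; case: eqP => [eqr|nqr]; case: eqP => [epq|npq] //=.
- case: eqP => [e1|[]]; last by rewrite epq.
  case: eqP => [e2|[]]; last by rewrite ptgt_cat.
  by congr Some; apply: qpathP; rewrite //= /parrows /= catA.
- by case: eqP => // e; case: npq; rewrite e.
- by case: eqP => // e; case: nqr; rewrite -e ptgt_cat.
Qed.

Lemma pmul_idl i p : pmul (pid i) p = if i == psrc p then Some p else None.
Proof.
rewrite /pmul; case: eqP => [e|//].
by congr Some; exact: qpathP.
Qed.

Lemma pmul_idr i p : pmul p (pid i) = if ptgt p == i then Some p else None.
Proof.
rewrite /pmul; case: eqP => [e|//].
by congr Some; apply: qpathP; rewrite //= /parrows /= cats0.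
Qed.

End Paths.

Section FreeModule.
Variables (k : fieldType) (K : choiceType).

(* The k-vector space with basis K. This is {malg k[K]} with locked operations:
   unfolding those of {malg k[K]} makes unification diverge. *)
Definition freemod : Type := {malg k[K]}.
HB.instance Definition _ := Choice.on freemod.

Fact freemod_key : unit. Proof. by []. Qed.
Definition fm_zero : freemod := locked_with freemod_key (0 : {malg k[K]}).
Definition fm_opp : freemod -> freemod :=
  locked_with freemod_key (fun f : {malg k[K]} => - f).
Definition fm_add : freemod -> freemod -> freemod :=
  locked_with freemod_key (fun f g : {malg k[K]} => f + g).
Definition fm_scale : k -> freemod -> freemod :=
  locked_with freemod_key (fun c (f : {malg k[K]}) => c *: f).
Definition fm_base : K -> freemod :=
  locked_with freemod_key (fun p => << p >> : {malg k[K]}).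

Lemma fm_zeroE : fm_zero = (0 : {malg k[K]}).
Proof. by rewrite /fm_zero unlock. Qed.
Lemma fm_oppE f : fm_opp f = - (f : {malg k[K]}).
Proof. by rewrite /fm_opp unlock. Qed.
Lemma fm_addE f g : fm_add f g = (f : {malg k[K]}) + (g : {malg k[K]}).
Proof. by rewrite /fm_add unlock. Qed.
Lemma fm_scaleE c f : fm_scale c f = c *: (f : {malg k[K]}).
Proof. by rewrite /fm_scale unlock. Qed.
Lemma fm_baseE p : fm_base p = << p >> :> {malg k[K]}.
Proof. by rewrite /fm_base unlock. Qed.

Lemma fm_addA : associative fm_add.
Proof. by move=> f g h; rewrite !fm_addE addrA. Qed.
Lemma fm_addC : commutative fm_add.
Proof. by move=> f g; rewrite !fm_addE addrC. Qed.
Lemma fm_add0 : left_id fm_zero fm_add.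
Proof. by move=> f; rewrite fm_addE fm_zeroE add0r. Qed.
Lemma fm_addN : left_inverse fm_zero fm_opp fm_add.
Proof. by move=> f; rewrite fm_addE fm_zeroE fm_oppE addNr. Qed.
HB.instance Definition _ :=
  GRing.isZmodule.Build freemod fm_addA fm_addC fm_add0 fm_addN.

Lemma fm_scaleA a b f : fm_scale a (fm_scale b f) = fm_scale (a * b) f.
Proof. by rewrite !fm_scaleE scalerA. Qed.
Lemma fm_scale1 : left_id 1 fm_scale.
Proof. by move=> f; rewrite fm_scaleE scale1r. Qed.
Lemma fm_scaleDr : right_distributive fm_scale fm_add.
Proof. by move=> a f g; rewrite !fm_addE !fm_scaleE scalerDr. Qed.
Lemma fm_scaleDl f : {morph fm_scale^~ f : a b / a + b >-> fm_add a b}.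
Proof. by move=> a b; rewrite fm_addE !fm_scaleE scalerDl. Qed.
HB.instance Definition _ := GRing.Zmodule_isLmodule.Build k freemod
  fm_scaleA fm_scale1 fm_scaleDr fm_scaleDl.

Definition fm_coef (p : K) (f : freemod) : k := mcoeff p f.

Lemma fm_coefP (f g : freemod) : (forall p, fm_coef p f = fm_coef p g) <-> f = g.
Proof. exact: malgP. Qed.

Lemma fm_coef_linear p : linear_for *%R (fm_coef p).
Proof.
move=> c f g; rewrite /fm_coef -[X in mcoeff _ X]/(fm_add (fm_scale c f) g).
by rewrite fm_addE fm_scaleE mcoeffD mcoeffZ.
Qed.
HB.instance Definition _ p :=
  GRing.isLinear.Build k freemod k _ (fm_coef p) (fm_coef_linear p).

Lemma fm_coefU p q : fm_coef q (fm_base p) = (p == q)%:R.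
Proof. by rewrite /fm_coef fm_baseE mcoeffU. Qed.

Lemma fm_sum (d : {fset K}) (f : freemod) : (msupp f `<=` d)%fset ->
  f = \sum_(p <- d) fm_coef p f *: fm_base p.
Proof.
move=> le; apply/fm_coefP => q; rewrite linear_sum /=.
transitivity (\sum_(p <- d) fm_coef p f * (p == q)%:R); last first.
  by apply: eq_bigr => p _; rewrite linearZ /= fm_coefU.
have [qd|qd] := boolP (q \in d); last first.
  rewrite /fm_coef mcoeff_outdom; last by apply: contra qd; move/fsubsetP: le; apply.
  rewrite big_seq big1 // => p pd; case: eqP => [e|_]; last by rewrite mulr0.
  by rewrite e (negPf qd) in pd.
rewrite (big_fsetD1 q) //= eqxx mulr1 big_seq big1 ?addr0 // => p.
by rewrite in_fsetD1 => /andP[/negPf -> _]; rewrite mulr0.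
Qed.

Section LinExt.
Variable V : lmodType k.

(* The linear map that extends h : K -> V. *)
Definition linext (h : K -> V) (f : freemod) : V :=
  \sum_(p <- msupp f) fm_coef p f *: h p.

Lemma linextEw h f (d : {fset K}) : (msupp f `<=` d)%fset ->
  linext h f = \sum_(p <- d) fm_coef p f *: h p.
Proof.
move=> le; rewrite /linext (big_fset_incl _ le) // => p _ np.
by rewrite /fm_coef (mcoeff_outdom np) scale0r.
Qed.

Lemma linext_linear h : linear (linext h).
Proof.
move=> c f g; set cfg := c *: f + g.
pose d := (msupp f `|` msupp g `|` msupp cfg)%fset.
rewrite (@linextEw h cfg d); last exact: fsubsetUr.
rewrite (@linextEw h f d); last by rewrite /d -fsetUA fsubsetUl.
rewrite (@linextEw h g d); last by rewrite /d fsetUAC fsubsetUr.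
rewrite scaler_sumr -big_split /=; apply: eq_bigr => p _.
by rewrite /cfg linearP scalerDl scalerA.
Qed.
HB.instance Definition _ h :=
  GRing.isLinear.Build k freemod V _ (linext h) (linext_linear h).

Lemma linextU h p : linext h (fm_base p) = h p.
Proof.
rewrite (@linextEw _ _ [fset p]%fset); last by rewrite fm_baseE msuppU_le.
by rewrite big_seq_fset1 fm_coefU eqxx scale1r.
Qed.

Lemma lin_ext (u w : freemod -> V) : linear u -> linear w ->
  (forall p, u (fm_base p) = w (fm_base p)) -> u =1 w.
Proof.
move=> lu lw e.
pose lu' := GRing.isLinear.Build k freemod V _ u lu.
pose lw' := GRing.isLinear.Build k freemod V _ w lw.
pose u' : {linear freemod -> V} := HB.pack u lu'.
pose w' : {linear freemod -> V} := HB.pack w lw'.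
suff: u' =1 w' by [].
move=> f; rewrite (fm_sum (fsubset_refl (msupp f))) !linear_sum.
by apply: eq_bigr => p _; rewrite !linearZ; congr (_ *: _); exact: e.
Qed.

End LinExt.
End FreeModule.

Section PathAlgebra.
Variables (k : fieldType) (Q : quiver).

Definition pathalg : Type := freemod k (qpath Q).
HB.instance Definition _ := GRing.Lmodule.on pathalg.

Definition pelt (p : qpath Q) : pathalg := fm_base k p.

Definition oelt (o : option (qpath Q)) : pathalg := oapp pelt 0 o.

Fact pa_mul_key : unit. Proof. by []. Qed.
Definition pa_mul : pathalg -> pathalg -> pathalg :=
  locked_with pa_mul_key
    (fun f g => linext (fun p => linext (fun q => oelt (pmul p q)) g) f).

Lemma pa_mulE f g :
  pa_mul f g = linext (fun p => linext (fun q => oelt (pmul p q)) g) f.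
Proof. by rewrite /pa_mul unlock. Qed.

Definition pa_one : pathalg := \sum_(i : vert Q) pelt (pid i).

Lemma pa_mul_linearl g : linear (pa_mul^~ g).
Proof. by move=> c f f'; rewrite !pa_mulE linearP. Qed.

Lemma pa_mul_linearr f : linear (pa_mul f).
Proof.
move=> c g g'; rewrite !pa_mulE /linext scaler_sumr -big_split /=.
by apply: eq_bigr => p _; rewrite -!/(linext _ _) linearP scalerDr !scalerA mulrC.
Qed.

Lemma pa_mulUU p q : pa_mul (pelt p) (pelt q) = oelt (pmul p q).
Proof. by rewrite pa_mulE !linextU. Qed.

Lemma pa_mul0l g : pa_mul 0 g = 0.
Proof. by have := pa_mul_linearl g (-1) 0 0; rewrite scaler0 addr0 scaleN1r addNr. Qed.

Lemma pa_mul0r f : pa_mul f 0 = 0.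
Proof. by have := pa_mul_linearr f (-1) 0 0; rewrite scaler0 addr0 scaleN1r addNr. Qed.

Lemma pa_mulDl : left_distributive pa_mul +%R.
Proof. by move=> f g h; have := pa_mul_linearl h 1 f g; rewrite !scale1r. Qed.

Lemma pa_mulDr : right_distributive pa_mul +%R.
Proof. by move=> f g h; have := pa_mul_linearr f 1 g h; rewrite !scale1r. Qed.

Lemma pa_ext (V : lmodType k) (u w : pathalg -> V) : linear u -> linear w ->
  (forall p, u (pelt p) = w (pelt p)) -> u =1 w.
Proof. exact: lin_ext. Qed.

Lemma oelt_mulr o r : pa_mul (oelt o) (pelt r) = oelt (obind (fun p => pmul p r) o).
Proof. by case: o => [p|]; [exact: pa_mulUU|exact: pa_mul0l]. Qed.

Lemma oelt_mull p o : pa_mul (pelt p) (oelt o) = oelt (obind (pmul p) o).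
Proof. by case: o => [q|]; [exact: pa_mulUU|exact: pa_mul0r]. Qed.

Lemma pa_mulA : associative pa_mul.
Proof.
move=> f g h; move: g.
apply: pa_ext => [c x y|c x y|q].
- by rewrite (pa_mul_linearl h c x y) (pa_mul_linearr f c).
- by rewrite (pa_mul_linearr f c x y) (pa_mul_linearl h c).
move: f; apply: pa_ext => [c x y|c x y|p].
- by rewrite (pa_mul_linearl _ c x y).
- by rewrite (pa_mul_linearl (pelt q) c x y) (pa_mul_linearl h c).
move: h; apply: pa_ext => [c x y|c x y|r].
- by rewrite (pa_mul_linearr (pelt q) c x y) (pa_mul_linearr (pelt p) c).
- by rewrite (pa_mul_linearr _ c x y).
by rewrite (pa_mulUU p q) (pa_mulUU q r) oelt_mulr oelt_mull pmulA.
Qed.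

Lemma pa_mul_suml (J : finType) (F : J -> pathalg) g :
  pa_mul (\sum_j F j) g = \sum_j pa_mul (F j) g.
Proof.
by apply: (big_morph (pa_mul^~ g)) => [x y|]; [exact: pa_mulDl|exact: pa_mul0l].
Qed.

Lemma pa_mul_sumr (J : finType) (F : J -> pathalg) f :
  pa_mul f (\sum_j F j) = \sum_j pa_mul f (F j).
Proof.
by apply: (big_morph (pa_mul f)) => [x y|]; [exact: pa_mulDr|exact: pa_mul0r].
Qed.

Lemma pa_mul1 : left_id pa_one pa_mul.
Proof.
apply: pa_ext => [c x y|//|p]; first exact: pa_mul_linearr.
rewrite pa_mul_suml (bigD1 (psrc p)) //= pa_mulUU pmul_idl eqxx.
by rewrite big1 ?addr0 // => i ne; rewrite pa_mulUU pmul_idl (negPf ne).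
Qed.

Lemma pa_mulr1 : right_id pa_one pa_mul.
Proof.
apply: pa_ext => [c x y|//|p]; first exact: pa_mul_linearl.
rewrite pa_mul_sumr (bigD1 (ptgt p)) //= pa_mulUU pmul_idr eqxx.
by rewrite big1 ?addr0 // => i ne; rewrite pa_mulUU pmul_idr eq_sym (negPf ne).
Qed.

HB.instance Definition _ := GRing.Zmodule_isPzRing.Build pathalg
  pa_mulA pa_mul1 pa_mulr1 pa_mulDl pa_mulDr.

Lemma pa_scaleAl (c : k) (f g : pathalg) : c *: (f * g) = (c *: f) * g.
Proof.
by have := pa_mul_linearl g c f 0; rewrite pa_mul0l !addr0 => <-.
Qed.

Lemma pa_scaleAr (c : k) (f g : pathalg) : c *: (f * g) = f * (c *: g).
Proof.
by have := pa_mul_linearr f c g 0; rewrite pa_mul0r !addr0 => <-.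
Qed.

Definition idem (i : vert Q) : pathalg := pelt (pid i).
Definition arr (a : arrow Q) : pathalg := pelt (parr a).

End PathAlgebra.

Section DoubleInclusion.
Variables (k : fieldType) (Q : quiver).

Lemma dpath_subproof (p : qpath Q) :
  @walk (qdouble Q) (psrc p) (map inl (parrows p)).
Proof.
case: p => [[i s] /=]; rewrite /psrc /parrows /=.
by elim: s i => [|a s IH] i //= /andP[-> /IH].
Qed.

Definition dpath (p : qpath Q) : qpath (qdouble Q) :=
  exist _ (psrc p, map inl (parrows p)) (dpath_subproof p).

Lemma ptgt_dpath p : ptgt (dpath p) = ptgt p.
Proof. by rewrite /ptgt /= -map_comp. Qed.

Lemma pmul_dpath p q : pmul (dpath p) (dpath q) = omap dpath (pmul p q).
Proof.
rewrite /pmul; case: eqP => [e|n]; case: eqP => [e'|n'] //=.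
- by congr Some; apply: qpathP; rewrite // /parrows /= map_cat.
- by case: n'; rewrite -ptgt_dpath.
- by case: n; rewrite ptgt_dpath.
Qed.

Definition dincl (f : pathalg k Q) : pathalg k (qdouble Q) :=
  linext (fun p => pelt k (dpath p)) f.

Lemma dincl_linear : linear dincl.
Proof. exact: linext_linear. Qed.
HB.instance Definition _ :=
  GRing.isLinear.Build k (pathalg k Q) (pathalg k (qdouble Q)) _ dincl dincl_linear.

Lemma dinclU p : dincl (pelt k p) = pelt k (dpath p).
Proof. exact: linextU. Qed.

Lemma dincl_monoid_morphism : monoid_morphism dincl.
Proof.
have d0 : dincl 0 = 0 by exact: linear0.
have hs (J : finType) (F : J -> pathalg k Q) : dincl (\sum_j F j) = \sum_j dincl (F j).
  exact: linear_sum.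
split=> [|f g].
  rewrite hs; apply: eq_bigr => i _; rewrite dinclU.
  by congr pelt; apply: qpathP.
move: f; apply: pa_ext => [c x y|c x y|p].
- by rewrite [X in dincl X]pa_mul_linearl dincl_linear.
- by rewrite dincl_linear [LHS]pa_mul_linearl.
move: g; apply: pa_ext => [c x y|c x y|q].
- by rewrite [X in dincl X]pa_mul_linearr dincl_linear.
- by rewrite dincl_linear [LHS]pa_mul_linearr.
rewrite !dinclU [X in dincl X]pa_mulUU [RHS]pa_mulUU pmul_dpath.
by case: (pmul p q) => [r|] /=; rewrite ?dinclU ?d0.
Qed.
HB.instance Definition _ :=
  GRing.isMonoidMorphism.Build (pathalg k Q) (pathalg k (qdouble Q)) dincl
    dincl_monoid_morphism.

End DoubleInclusion.

Section TwoSidedQuotient.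
Variables (R : pzRingType) (S : set R).
Local Open Scope quotient_scope.

Definition in_ideal (x : R) : Prop :=
  exists (n : nat) (a s b : 'I_n -> R),
    (forall i, S (s i)) /\ x = \sum_(i < n) a i * s i * b i.

Definition ideal : {pred R} := fun x => `[< in_ideal x >].

Lemma idealP x : reflect (in_ideal x) (x \in ideal).
Proof. exact: asboolP. Qed.

Lemma ideal_zmod_closed : zmod_closed ideal.
Proof.
split.
  apply/idealP; exists 0%N, (fun _ => 0), (fun _ => 0), (fun _ => 0).
  by rewrite big_ord0; split=> // -[].
move=> x y /idealP[n [a [s [b [hs ->]]]]] /idealP[m [a' [s' [b' [hs' ->]]]]].
apply/idealP; exists (n + m)%N.
pose J (T : Type) (f : 'I_n -> T) (g : 'I_m -> T) i :=
  match split i with inl i => f i | inr j => g j end.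
exists (J _ a (fun j => - a' j)), (J _ s s'), (J _ b b'); split.
  by move=> i; rewrite /J; case: (split i).
rewrite big_split_ord /= -sumrN; congr (_ + _); apply: eq_bigr => i _; rewrite /J.
  by rewrite (unsplitK (inl i)).
by rewrite (unsplitK (inr i)) !mulNr.
Qed.
HB.instance Definition _ := GRing.isZmodClosed.Build R ideal ideal_zmod_closed.

Lemma ideal_mull a x : x \in ideal -> a * x \in ideal.
Proof.
case/idealP=> n [c [s [b [hs ->]]]]; apply/idealP.
exists n, (fun i => a * c i), s, b; split=> //.
by rewrite mulr_sumr; apply: eq_bigr => i _; rewrite !mulrA.
Qed.

Lemma ideal_mulr a x : x \in ideal -> x * a \in ideal.
Proof.
case/idealP=> n [c [s [b [hs ->]]]]; apply/idealP.
exists n, c, s, (fun i => b i * a); split=> //.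
by rewrite mulr_suml; apply: eq_bigr => i _; rewrite !mulrA.
Qed.

Definition qring : Type := Quotient.quot (ideal : zmodClosed R).
HB.instance Definition _ := GRing.Zmodule.on qring.
HB.instance Definition _ := EqQuotient.on qring.

Definition qpi (x : R) : qring := \pi x.
Definition qmul (x y : qring) : qring := qpi (repr x * repr y).

Lemma qpi_eq x y : (qpi x == qpi y) = (x - y \in ideal).
Proof. by rewrite Quotient.idealrBE. Qed.

Lemma qpi_zmod_morphism : zmod_morphism qpi.
Proof. by move=> x y; rewrite /qpi !piE. Qed.
HB.instance Definition _ :=
  GRing.isZmodMorphism.Build R qring qpi qpi_zmod_morphism.

Lemma qpi_repr x : qpi (repr x) = x.
Proof. exact: reprK. Qed.

Lemma qpiM x y : qmul (qpi x) (qpi y) = qpi (x * y).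
Proof.
apply/eqP; rewrite qpi_eq.
set x' := repr _; set y' := repr _.
have hx : x' - x \in ideal by rewrite -qpi_eq qpi_repr.
have hy : y' - y \in ideal by rewrite -qpi_eq qpi_repr.
have -> : x' * y' - x * y = x' * (y' - y) + (x' - x) * y.
  by rewrite mulrBr mulrBl addrA subrK.
by apply: rpredD; [exact: ideal_mull|exact: ideal_mulr].
Qed.

Lemma qmulA : associative qmul.
Proof.
by move=> x y z; rewrite -(qpi_repr x) -(qpi_repr y) -(qpi_repr z) !qpiM mulrA.
Qed.
Lemma qmul1 : left_id (qpi 1) qmul.
Proof. by move=> x; rewrite -(qpi_repr x) qpiM mul1r. Qed.
Lemma qmulr1 : right_id (qpi 1) qmul.
Proof. by move=> x; rewrite -(qpi_repr x) qpiM mulr1. Qed.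
Lemma qmulDl : left_distributive qmul +%R.
Proof.
move=> x y z; rewrite -(qpi_repr x) -(qpi_repr y) -(qpi_repr z).
by rewrite -raddfD !qpiM mulrDl raddfD.
Qed.
Lemma qmulDr : right_distributive qmul +%R.
Proof.
move=> x y z; rewrite -(qpi_repr x) -(qpi_repr y) -(qpi_repr z).
by rewrite -raddfD !qpiM mulrDr raddfD.
Qed.
HB.instance Definition _ := GRing.Zmodule_isPzRing.Build qring
  qmulA qmul1 qmulr1 qmulDl qmulDr.

Lemma qpi_monoid_morphism : monoid_morphism qpi.
Proof. by split=> // x y; rewrite -qpiM. Qed.
HB.instance Definition _ :=
  GRing.isMonoidMorphism.Build R qring qpi qpi_monoid_morphism.

End TwoSidedQuotient.

Section Heisenberg.
Variables (k : fieldType) (Q : quiver) (v : vert Q -> k).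

Local Notation kQbar := (pathalg k (qdouble Q)).

Definition dbl_arr (a : arrow Q) : kQbar := @arr k (qdouble Q) (inl a).
Definition dbl_star (a : arrow Q) : kQbar := @arr k (qdouble Q) (inr a).

Definition rho (i : vert Q) : kQbar :=
  \sum_(a : arrow Q | qtail a == i) dbl_arr a * dbl_star a
  - \sum_(a : arrow Q | qhead a == i) dbl_star a * dbl_arr a.

Definition vrho : kQbar := \sum_(i : vert Q) (v i)^-1 *: rho i.

Definition veta (b : arrow (qdouble Q)) : kQbar :=
  arr k b * vrho - vrho * arr k b.

(* The weight may vanish at a vertex here, in which case its inverse is 0 by
   convention; this does not occur for a regular weight. *)
Definition qha : Type := qring [set veta b | b in [set: arrow (qdouble Q)]]%classic.
HB.instance Definition _ := GRing.PzRing.on qha.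

Definition qha_map : pathalg k Q -> qha := qpi _ \o @dincl k Q.
HB.instance Definition _ := GRing.RMorphism.on qha_map.

End Heisenberg.

(* Restriction of scalars: an alias of B, indexed by phi, that carries the left
   A-module structure a *: x = phi a * x. *)
Definition restr (A B : pzRingType) (phi : {rmorphism A -> B}) : Type := B.

Section Restriction.
Variables (A B : pzRingType) (phi : {rmorphism A -> B}).

HB.instance Definition _ := GRing.Zmodule.on (restr phi).

Definition restr_scale (a : A) (x : restr phi) : restr phi := phi a * (x : B).

Lemma restr_scaleA a b x :
  restr_scale a (restr_scale b x) = restr_scale (a * b) x.
Proof. by rewrite /restr_scale rmorphM mulrA. Qed.
Lemma restr_scale1 : left_id 1 restr_scale.
Proof. by move=> x; rewrite /restr_scale rmorph1 mul1r. Qed.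
Lemma restr_scaleDr : right_distributive restr_scale +%R.
Proof. by move=> a x y; exact: mulrDr. Qed.
Lemma restr_scaleDl x : {morph restr_scale^~ x : a b / a + b}.
Proof. by move=> a b; rewrite /restr_scale rmorphD mulrDl. Qed.
HB.instance Definition _ := GRing.Zmodule_isLmodule.Build A (restr phi)
  restr_scaleA restr_scale1 restr_scaleDr restr_scaleDl.

End Restriction.

Section DirectSum.
Variables (A : pzRingType) (I : Type) (M : I -> lmodType A).

Definition dprod : Type := forall i, M i.
HB.instance Definition _ := gen_eqMixin dprod.
HB.instance Definition _ := gen_choiceMixin dprod.

Definition dprod_add (f g : dprod) : dprod := fun i => f i + g i.
Definition dprod_opp (f : dprod) : dprod := fun i => - f i.
Definition dprod_zero : dprod := fun i => 0.
Definition dprod_scale (a : A) (f : dprod) : dprod := fun i => a *: f i.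

Lemma dprod_addA : associative dprod_add.
Proof. by move=> f g h; apply: functional_extensionality_dep => i; exact: addrA. Qed.
Lemma dprod_addC : commutative dprod_add.
Proof. by move=> f g; apply: functional_extensionality_dep => i; exact: addrC. Qed.
Lemma dprod_add0 : left_id dprod_zero dprod_add.
Proof. by move=> f; apply: functional_extensionality_dep => i; exact: add0r. Qed.
Lemma dprod_addN : left_inverse dprod_zero dprod_opp dprod_add.
Proof. by move=> f; apply: functional_extensionality_dep => i; exact: addNr. Qed.
HB.instance Definition _ := GRing.isZmodule.Build dprod
  dprod_addA dprod_addC dprod_add0 dprod_addN.

Lemma dprod_scaleA a b f :
  dprod_scale a (dprod_scale b f) = dprod_scale (a * b) f.
Proof. by apply: functional_extensionality_dep => i; exact: scalerA. Qed.
Lemma dprod_scale1 : left_id 1 dprod_scale.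
Proof. by move=> f; apply: functional_extensionality_dep => i; exact: scale1r. Qed.
Lemma dprod_scaleDr : right_distributive dprod_scale +%R.
Proof.
by move=> a f g; apply: functional_extensionality_dep => i; exact: scalerDr.
Qed.
Lemma dprod_scaleDl f : {morph dprod_scale^~ f : a b / a + b}.
Proof.
by move=> a b; apply: functional_extensionality_dep => i; exact: scalerDl.
Qed.
HB.instance Definition _ := GRing.Zmodule_isLmodule.Build A dprod
  dprod_scaleA dprod_scale1 dprod_scaleDr dprod_scaleDl.

Definition fin_supported : {pred dprod} :=
  fun f => `[< finite_set [set i : I | f i <> 0]%classic >].

Lemma fin_supported_submod : submod_closed fin_supported.
Proof.
split.
  by apply/asboolP; apply: (@sub_finite_set _ _ set0) => // i /=; case.
move=> a f g /asboolP hf /asboolP hg; apply/asboolP.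
have : finite_set ([set i : I | f i <> 0] `|` [set i | g i <> 0])%classic.
  by rewrite finite_setU.
apply: sub_finite_set => i /= ne.
have [f0|] := pselect (f i = 0); last by left.
right=> g0; apply: ne.
by rewrite -[(a *: f + g) i]/(a *: f i + g i) f0 g0 scaler0 addr0.
Qed.
HB.instance Definition _ :=
  GRing.isSubmodClosed.Build A dprod fin_supported fin_supported_submod.

Definition dsum : Type := {f : dprod | f \in fin_supported}.
HB.instance Definition _ := [isSub of dsum for @sval _ _].
HB.instance Definition _ := [Choice of dsum by <:].
HB.instance Definition _ := [SubChoice_isSubLmodule of dsum by <:].

End DirectSum.

Definition lmod_iso (A : pzRingType) (M N : lmodType A) : Prop :=
  exists f : {linear M -> N}, bijective f.

Section FiniteDimensionalModules.
Variables (k : fieldType) (Q : quiver).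

(* A finite-dimensional left kQ-module, as a finite-dimensional k-space with an
   algebra morphism from kQ to its endomorphisms ([\o] is the usual
   composition, so the action is on the left). *)
Record fdmod := FdMod {
  fd_space : vectType k;
  fd_act : pathalg k Q -> 'End(fd_space);
  fd_act_linear : linear fd_act;
  fd_act1 : fd_act 1 = \1%VF;
  fd_actM : forall a b, fd_act (a * b) = (fd_act a \o fd_act b)%VF }.

Definition mod_of (N : fdmod) : Type := fd_space N.
HB.instance Definition _ N := GRing.Zmodule.on (mod_of N).

Definition mod_scale N (a : pathalg k Q) (x : mod_of N) : mod_of N := fd_act N a x.

Lemma mod_scaleA N a b x :
  @mod_scale N a (mod_scale b x) = mod_scale (a * b) x.
Proof. by rewrite /mod_scale fd_actM comp_lfunE. Qed.
Lemma mod_scale1 N : left_id 1 (@mod_scale N).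
Proof. by move=> x; rewrite /mod_scale fd_act1 id_lfunE. Qed.
Lemma mod_scaleDr N : right_distributive (@mod_scale N) +%R.
Proof. by move=> a x y; exact: linearD. Qed.
Lemma mod_scaleDl N x : {morph (@mod_scale N)^~ x : a b / a + b}.
Proof.
move=> a b; have := fd_act_linear N 1 a b; rewrite !scale1r /mod_scale => ->.
by rewrite add_lfunE.
Qed.
HB.instance Definition _ N := GRing.Zmodule_isLmodule.Build (pathalg k Q) (mod_of N)
  (@mod_scaleA N) (@mod_scale1 N) (@mod_scaleDr N) (@mod_scaleDl N).

Definition fdim (N : fdmod) : nat := \dim {:fd_space N}.

(* e_i N is the image of the action of e_i. *)
Definition fdim_at (N : fdmod) (i : vert Q) : nat := \dim (limg (fd_act N (idem k i))).

Definition submodule (N : fdmod) (U : {vspace fd_space N}) : Prop :=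
  forall a : pathalg k Q, (fd_act N a @: U <= U)%VS.

Definition indecomposable (N : fdmod) : Prop :=
  {:fd_space N}%VS != 0%VS /\
  forall U W : {vspace fd_space N},
    submodule U -> submodule W ->
    (U + W)%VS = fullv -> (U :&: W)%VS = 0%VS -> U = 0%VS \/ W = 0%VS.

(* The family N is a set of representatives of the isomorphism classes of
   indecomposable finite-dimensional kQ-modules. *)
Definition is_ind (I : Type) (N : I -> fdmod) : Prop :=
  [/\ forall i, indecomposable (N i),
      forall i j, lmod_iso (mod_of (N i)) (mod_of (N j)) -> i = j
    & forall M, indecomposable M -> exists i, lmod_iso (mod_of M) (mod_of (N i))].

Definition regular_weight (v : vert Q -> k) : Prop :=
  forall N : fdmod, indecomposable N ->
    \sum_(i : vert Q) v i * (fdim_at N i)%:R != 0.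

End FiniteDimensionalModules.

(* Main.v *)
Require Import Defs.
From HB Require Import structures.
From mathcomp Require Import all_boot all_order all_algebra.
From mathcomp Require Import ring lra zify.
From mathcomp Require Import boolp classical_sets cardinality.
From mathcomp Require finmap monalg.

(* Let c : Q_0 -> {1, -1} be a bipartite colouring, u_i = c_i v_i, and let x be
   the sum of all arrows a and all c_{t(a)} a^*. Then e_i x x e_i = u_i z e_i,
   where z is the central element, so a module over the quiver Heisenberg algebra
   is a representation of the double of Q on which x commutes with
   z = \sum_i u_i^-1 e_i x x e_i. This description only depends on the underlying
   graph and on u, and one compares it at an orientation with a source j and at
   the orientation reflected at j, with u_j replaced by - u_j and u_i by u_i - u_j
   at the neighbours i of j: exchanging the space V_j for another factorization
   of the endomorphism \sum x e_j x of \sum_i V_i shifted by u_j z is an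
   equivalence off the modules concentrated at j (a deformed preprojective
   reflection).

   By induction along reflections that kill M, one builds a Heisenberg module Y
   with a universal map eta from the kQ-module M, together with a decomposition
   of Y over kQ: if Y is the induced module for the Bernstein-Gelfand-Ponomarev
   reflection of M, the new Y is R_j(Y) + S_j^{dim M_j}. By adjunction the summand
   N occurs dim Hom(M, N) times. The step needs that a vector of \sum_i V_i
   killed by the map to V_j comes from the new space at j; this follows from
   the universal property of Y applied to a second module built on Y. An invariant
   nondegenerate form on Y, carried through the induction, turns injectivity and
   surjectivity of the structure maps at j into each other.

   Only finitely many reflections are needed, by positivity of the Cartan form.
   For M = kQ one has Y = Lambda and dim Hom(kQ, N) = dim N. *)

Set Implicit Arguments.
Unset Strict Implicit.
Unset Printing Implicit Defensive.

Import Order.TTheory GRing.Theory Num.Theory.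
Local Open Scope ring_scope.

(** * Linear algebra *)

(** Regularity is used in one form: along all reflections the weights stay nonzero. The reflected
    weight pairs with the dimension vector of N as the old weight pairs with that of the reflection
    of N, so regularity passes from each orientation to the next, and the central element on the new
    space at j is obtained by dividing by [u_j].

    The obstacle in the step is a conflict between two constructions of that space. The universal
    property asks for a cokernel of the maps leaving j, the decomposition over kQ for a kernel of
    the maps entering j. Both fit one space only if the two have equal dimension and the new
    outgoing map hits the whole kernel. The first holds because the form makes the maps into and out
    of j adjoint, the second is the exactness statement [ker_im].

    The Heisenberg algebra is not known beforehand to be finite-dimensional. Hence the universal
    property ranges over arbitrary k-spaces, while Y itself is finite-dimensional by construction;
    finiteness of the algebra comes out at the end, by comparing it with Y. *)

Section LinearAlgebra.
Variable k : fieldType.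

(* Sealed, since unification would otherwise match it with any linear map by eta. *)
Fact mklin_sig (U V : lmodType k) (f : U -> V) (H : linear f) :
  {F : {linear U -> V} | F =1 f}.
Proof.
pose F : {linear U -> V} := HB.pack f (GRing.isLinear.Build k U V _ f H).
by exists F.
Qed.

Definition mklin (U V : lmodType k) (f : U -> V) (H : linear f) : {linear U -> V} :=
  sval (mklin_sig H).

Lemma mklinE (U V : lmodType k) (f : U -> V) (H : linear f) v : mklin H v = f v.
Proof. exact: (svalP (mklin_sig H)). Qed.

Definition closed_pred (V : lmodType k) (D : V -> Prop) : Prop :=
  D 0 /\ forall c u v, D u -> D v -> D (c *: u + v).

(** A subspace of maximal dimension among those inside [D] is all of [D]: one more vector of [D]
    would enlarge it. *)
Lemma vspace_of (V : vectType k) (D : V -> Prop) : closed_pred D ->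
  {U : {vspace V} | forall v, v \in U <-> D v}.
Proof.
move=> [D0 DP]; apply: cid.
pose P n := `[< exists U : {vspace V}, \dim U = n /\ forall v, v \in U -> D v >].
have P0 : exists n, P n.
  exists 0%N; apply/asboolP; exists 0%VS; split; first exact: dimv0.
  by move=> v; rewrite memv0 => /eqP ->.
have Pb n : P n -> (n <= \dim {:V})%N.
  by move=> /asboolP [U [<- _]]; apply: dimvS; exact: subvf.
case: (ex_maxnP P0 Pb) => n /asboolP [U [dU UD]] nmax.
exists U => v; split; first exact: UD.
move=> Dv; apply: contraT => nv.
have : P (\dim (U + <[v]>)).
  apply/asboolP; exists (U + <[v]>)%VS; split=> // w /memv_addP [u uU [x /vlineP [c ->] ->]].
  by rewrite addrC; apply: DP => //; exact: UD.
move/nmax; rewrite -dU leqNgt.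
have/dimv_leqif_sup := addvSl U <[v]>%VS.
move=> [_ E]; have := dimvS (addvSl U <[v]>%VS); rewrite leq_eqVlt => /orP [|-> //].
rewrite E => /subvP /(_ v); rewrite (subvP (addvSr U _)) ?memv_line // => /(_ isT) vU.
by rewrite vU in nv.
Qed.

Definition subV (V : vectType k) (D : V -> Prop) (H : closed_pred D) : {vspace V} :=
  projT1 (vspace_of H).

Lemma subVP (V : vectType k) (D : V -> Prop) (H : closed_pred D) v :
  v \in subV H <-> D v.
Proof. exact: (projT2 (vspace_of H)). Qed.

(** A complement as a model of the quotient is again a [vectType] and comes with a linear
    section. *)
Definition quot (V : vectType k) (U : {vspace V}) : vectType k := subvs_of (U^C)%VS.

Lemma quot_subproof (V : vectType k) (U : {vspace V}) :
  linear (fun v : V => vsproj (U^C)%VS (v - projv U v)).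
Proof.
move=> c u v; rewrite -linearP; congr (vsproj _ _).
by rewrite linearP scalerBr opprD addrACA.
Qed.

Definition qmap (V : vectType k) (U : {vspace V}) : {linear V -> quot U} :=
  mklin (@quot_subproof V U).

Definition qsec (V : vectType k) (U : {vspace V}) : {linear quot U -> V} := vsval.

Lemma qmap_eq0 (V : vectType k) (U : {vspace V}) v : qmap U v = 0 <-> v \in U.
Proof.
rewrite /qmap mklinE; split=> [|vU].
  move/(congr1 vsval); rewrite vsprojK ?memv_projC // linear0 => /eqP.
  by rewrite subr_eq0 => /eqP ->; exact: memv_proj.
by rewrite projv_id // subrr linear0.
Qed.

Lemma qsecK (V : vectType k) (U : {vspace V}) c : qmap U (qsec U c) = c.
Proof.
apply: val_inj; rewrite /qmap mklinE /= vsprojK ?memv_projC //.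
have : vsval c \in lker (projv U) by rewrite lker_proj; exact: subvsP.
by rewrite memv_ker => /eqP ->; rewrite subr0.
Qed.

Lemma dim_exact (S U V : vectType k) (f : {linear S -> U}) (g : {linear U -> V}) :
  (forall s, f s = 0 -> s = 0) -> (forall v, exists u, g u = v) ->
  (forall s, g (f s) = 0) -> (forall u, g u = 0 -> exists s, f s = u) ->
  (\dim {:U} = \dim {:S} + \dim {:V})%N.
Proof.
move=> fi gs gf ex; rewrite -(limg_ker_dim (linfun g) fullv) capfv; congr (_ + _)%N.
  rewrite -(@limg_dim_eq _ _ _ (linfun f)).
    congr (\dim _); apply/vspaceP => u; apply/idP/idP.
      rewrite memv_ker lfunE /= => /eqP /ex [s <-].
      by rewrite -[f s]lfunE; apply: memv_img; exact: memvf.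
    by case/memv_imgP => s _ ->; rewrite memv_ker !lfunE /= gf.
  apply/eqP; rewrite -subv0; apply/subvP => u /memv_capP [_].
  by rewrite memv_ker lfunE /= memv0 => /eqP /fi ->.
congr (\dim _); apply/vspaceP => v; rewrite memvf; have [u <-] := gs v.
by rewrite -[g u]lfunE; apply: memv_img; exact: memvf.
Qed.

Lemma dim_sub (U V : vectType k) (A : {vspace U}) (B : {vspace V}) (f : {linear U -> V}) :
  (forall u, u \in A -> f u \in B) -> (forall u, u \in A -> f u = 0 -> u = 0) ->
  (\dim A <= \dim B)%N.
Proof.
move=> fAB fi; rewrite -(@limg_dim_eq _ _ _ (linfun f)); last first.
  apply/eqP; rewrite -subv0; apply/subvP => u /memv_capP [uA].
  by rewrite memv_ker lfunE /= memv0 => /eqP /(fi _ uA) ->.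
by apply: dimvS; apply/subvP => _ /memv_imgP [u uA ->]; rewrite lfunE; exact: fAB.
Qed.

(** A generalized inverse of h. It serves below to split kernels and images by idempotents and to
    extend a map from an image to the whole space. *)
Lemma linear_section (U V : vectType k) (h : {linear U -> V}) :
  exists s : {linear V -> U}, forall u, h (s (h u)) = h u.
Proof.
exists ((linfun h)^-1)%VF => u.
have /lfunP /(_ u) := inv_lfun_def (linfun h).
by rewrite !comp_lfunE /= !lfunE.
Qed.

(** Nondegeneracy makes [v |-> B v] injective into the dual, and the dimensions agree. *)
Lemma form_repr (V : vectType k) (B : V -> V -> k) :
  (forall v, linear_for *%R (B v)) -> (forall w, linear_for *%R (B^~ w)) ->
  (forall v, (forall w, B v w = 0) -> v = 0) ->
  forall h : {linear V -> k^o}, exists v, forall w, B v w = h w.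
Proof.
move=> Br Bl nd h.
pose b v : {linear V -> k^o} := mklin (Br v : linear (B v : V -> k^o)).
have bl : linear (fun v => linfun (b v) : 'Hom(V, k^o)).
  by move=> c u v; apply/lfunP => w; rewrite add_lfunE scale_lfunE !lfunE !mklinE; exact: Bl.
pose F := linfun (mklin bl).
have FE u w : F u w = B u w.
  by rewrite /F [X in (X : 'Hom(_, _)) w]lfunE mklinE lfunE mklinE.
have Fi : lker F == 0%VS.
  rewrite -subv0; apply/subvP => v; rewrite memv_ker memv0 => /eqP e.
  by apply/eqP/nd => w; rewrite -FE e zero_lfunE.
have : (limg F == fullv)%VS.
  rewrite eqEdim subvf /= limg_dim_eq ?capfv; last exact/eqP.
  by rewrite !dimvf /dim /= muln1.
move/eqP/vspaceP/(_ (linfun h)); rewrite memvf => /memv_imgP [v _ e].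
by exists v => w; rewrite -FE -e lfunE.
Qed.

End LinearAlgebra.

(** * Representations on a total space *)

Section Glue.
Variables (k : fieldType).

(* W is the direct sum of the kernel of the idempotent ej and of C. This is an
   interface, since W is a vectType or merely an lmodType according to V and C. *)
Record glue (V C W : lmodType k) (ej : V -> V) := Glue {
  ga : {linear V -> W}; gb : {linear W -> V};
  gu : {linear C -> W}; gv : {linear W -> C};
  gba : forall v, gb (ga v) = v - ej v;
  gvu : forall c, gv (gu c) = c;
  gbu : forall c, gb (gu c) = 0;
  gva : forall v, gv (ga v) = 0;
  gdec : forall w, ga (gb w) + gu (gv w) = w }.

Lemma gext (V C W : lmodType k) (ej : V -> V) (G : glue C W ej) (w w' : W) :
  gb G w = gb G w' -> gv G w = gv G w' -> w = w'.
Proof. by move=> e1 e2; rewrite -(gdec G w) -(gdec G w') e1 e2. Qed.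

Arguments gext {V C W ej} G {w w'}.

Section Vect.
Variables (V C : vectType k) (ej : {linear V -> V}).
Hypothesis ejP : forall v, ej (ej v) = ej v.

Definition gW : vectType k := (subvs_of (lker (linfun ej)) * C)%type.

Fact gW_a_lin : linear (fun v : V => (vsproj (lker (linfun ej)) (v - ej v), 0) : gW).
Proof.
move=> c u v; apply: (f_equal2 pair); last by rewrite /= scaler0 addr0.
rewrite /=.
rewrite -linearP; congr (vsproj _ _).
by rewrite linearP scalerBr opprD addrACA.
Qed.
Fact gW_b_lin : linear (fun w : gW => vsval w.1).
Proof. by []. Qed.
Fact gW_u_lin : linear (fun c : C => (0, c) : gW).
Proof. by move=> c u v; apply: (f_equal2 pair) => //=; rewrite scaler0 addr0. Qed.
Fact gW_v_lin : linear (fun w : gW => w.2).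
Proof. by []. Qed.

Lemma ker_idem v : v - ej v \in lker (linfun ej).
Proof. by rewrite memv_ker lfunE /= linearB /= ejP subrr. Qed.

Definition gG : glue C gW ej.
Proof.
apply: (@Glue V C gW ej (mklin gW_a_lin) (mklin gW_b_lin) (mklin gW_u_lin) (mklin gW_v_lin)).
- by move=> v; rewrite !mklinE /= vsprojK // ker_idem.
- by move=> c; rewrite !mklinE.
- by move=> c; rewrite !mklinE.
- by move=> v; rewrite !mklinE.
- move=> [a c]; rewrite !mklinE /=; apply: (f_equal2 pair); last by rewrite /= add0r.
  have := subvsP a.
  by rewrite memv_ker lfunE /= addr0 => /eqP ->; rewrite subr0 vsvalK.
Qed.

End Vect.
End Glue.
Arguments gext {k V C W ej} G {w w'}.

Section Ops.
Variables (k : fieldType) (I : finType).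

(* oe i is the projection onto the space at i, and ox the sum of all structure maps;
   the map from l to i is thus oe i \o ox \o oe l. *)
Record ops (V : lmodType k) := Ops {
  oe : I -> {linear V -> V};
  ox : {linear V -> V} }.

Definition isops (V : lmodType k) (M : ops V) : Prop :=
  (forall i l v, oe M i (oe M l v) = if i == l then oe M l v else 0) /\
  (forall v, \sum_i oe M i v = v).

(* The relation g i l says that the orientation has a structure map from l to i;
   all other components of ox are ignored by ghom, and vanish in clean ops. *)
Definition ghom (g : rel I) (V W : lmodType k) (M : ops V) (N : ops W) (f : V -> W) : Prop :=
  (forall i v, f (oe M i v) = oe N i (f v)) /\
  (forall i l v, g i l -> f (oe M i (ox M (oe M l v))) = oe N i (ox N (oe N l (f v)))).

Definition fullhom (V W : lmodType k) (M : ops V) (N : ops W) (f : V -> W) : Prop :=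
  (forall i v, f (oe M i v) = oe N i (f v)) /\
  (forall v, f (ox M v) = ox N (f v)).

Definition clean (g : rel I) (V : lmodType k) (M : ops V) : Prop :=
  forall i l v, ~~ g i l -> oe M i (ox M (oe M l v)) = 0.

Section OpsTheory.
Variables (V : lmodType k) (M : ops V) (MP : isops M).
Lemma oee i v : oe M i (oe M i v) = oe M i v.
Proof. by case: MP => H _; rewrite H eqxx. Qed.
Lemma oe_neq i l v : i != l -> oe M i (oe M l v) = 0.
Proof. by case: MP => H _ /negPf n; rewrite H n. Qed.
Lemma oeE i l v : oe M i (oe M l v) = if i == l then oe M l v else 0.
Proof. by case: MP. Qed.
Lemma sum_oe v : \sum_i oe M i v = v.
Proof. by case: MP. Qed.
Lemma oe_ext (u v : V) : (forall i, oe M i u = oe M i v) -> u = v.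
Proof. by move=> H; rewrite -(sum_oe u) -(sum_oe v); apply: eq_bigr. Qed.
End OpsTheory.

Lemma clean_x g (V : lmodType k) (M : ops V) (MP : isops M) :
  clean g M -> forall i v, oe M i (ox M v) = \sum_(l | g i l) oe M i (ox M (oe M l v)).
Proof.
move=> cM i v; rewrite -{1}(sum_oe MP v) !linear_sum [RHS]big_mkcond /=.
by apply: eq_bigr => l _; case: ifP => // /negbT /cM.
Qed.

Lemma ghom_id g (V : lmodType k) (M : ops V) : ghom g M M idfun.
Proof. by []. Qed.

Lemma ghom_comp g (V1 V2 V3 : lmodType k) (M1 : ops V1) (M2 : ops V2) (M3 : ops V3) f1 f2 :
  ghom g M1 M2 f1 -> ghom g M2 M3 f2 -> ghom g M1 M3 (f2 \o f1).
Proof.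
move=> [e1 x1] [e2 x2]; split=> [i v|i l v gil] /=; first by rewrite e1 e2.
by rewrite x1 // x2.
Qed.

Lemma ghom_D g (V W : lmodType k) (M : ops V) (N : ops W) f1 f2 c :
  ghom g M N f1 -> ghom g M N f2 -> ghom g M N (fun v => c *: f1 v + f2 v).
Proof.
move=> [e1 x1] [e2 x2]; split=> [i v|i l v gil] /=; first by rewrite e1 e2 linearP.
by rewrite x1 // x2 // -!linearP.
Qed.

(* Replacement of the space at the vertex j by C, with q the sum of the maps into C
   and ka the sum of the maps out of C. *)
Section VertexReplacement.
Variables (V C W : lmodType k) (M : ops V) (j : I) (G : glue C W (oe M j)).
Variables (ka : {linear C -> V}) (q : {linear V -> C}).
Hypothesis MP : isops M.

Fact vr_e_lin i : linear (fun w => if i == j then gu G (gv G w) else ga G (oe M i (gb G w))).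
Proof. by move=> c u v; case: ifP => _; rewrite !linearP. Qed.
Fact vr_x_lin : linear (fun w => ga G (ox M (gb G w) + ka (gv G w)) + gu G (q (gb G w))).
Proof.
by move=> c u v; rewrite !linearP /= addrACA -scalerDr !linearP scalerDr addrACA.
Qed.

Definition vr : ops W := Ops (fun i => mklin (vr_e_lin i)) (mklin vr_x_lin).

Lemma gb_j w : oe M j (gb G w) = 0.
Proof.
rewrite -{1}(gdec G w) linearD /= gbu addr0 gba linearB /= oee //.
by rewrite subrr.
Qed.

Lemma gb_e i w : gb G (oe vr i w) = if i == j then 0 else oe M i (gb G w).
Proof.
rewrite /= mklinE; case: ifP => [_|n]; first by rewrite gbu.
by rewrite gba oe_neq ?subr0 // eq_sym n.
Qed.

Lemma gv_e i w : gv G (oe vr i w) = if i == j then gv G w else 0.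
Proof. by rewrite /= mklinE; case: ifP => _; rewrite (gvu, gva). Qed.

Lemma gb_x w : gb G (ox vr w) =
  ox M (gb G w) + ka (gv G w) - oe M j (ox M (gb G w) + ka (gv G w)).
Proof. by rewrite /= mklinE linearD /= gbu addr0 gba. Qed.

Lemma gv_x w : gv G (ox vr w) = q (gb G w).
Proof. by rewrite /= mklinE linearD /= gvu gva add0r. Qed.

Lemma gb_exe i l w : gb G (oe vr i (ox vr (oe vr l w))) =
  if i == j then 0 else
  if l == j then oe M i (ka (gv G w)) else oe M i (ox M (oe M l (gb G w))).
Proof.
rewrite gb_e; case: ifP => // n; rewrite gb_x gb_e gv_e linearB /= [X in _ - X]oe_neq ?n //.
by rewrite subr0; case: ifP => _; rewrite linear0 ?add0r ?addr0.
Qed.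

Lemma gv_exe i l w : gv G (oe vr i (ox vr (oe vr l w))) =
  if (i == j) && (l != j) then q (oe M l (gb G w)) else 0.
Proof.
by rewrite gv_e; case: ifP => // _; rewrite gv_x gb_e; case: ifP => _ //=; rewrite linear0.
Qed.

Lemma vr_isops : isops vr.
Proof.
split=> [i l w|w].
  case: (eqVneq i l) => [->|nil]; apply: (gext G); rewrite !(gb_e, gv_e) ?linear0.
  - by case: (l == j); rewrite // oee.
  - by case: (l == j).
  - by case: (i == j); case: (l == j); rewrite ?linear0 // oe_neq.
  - case: ifP => // /eqP ei; case: ifP => // /eqP el.
    by rewrite ei el eqxx in nil.
apply: (gext G); rewrite linear_sum /=.
  rewrite -[RHS](sum_oe MP) [RHS](bigD1 j) //= gb_j add0r (bigD1 j) //= gb_e eqxx add0r.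
  by apply: eq_bigr => i n; rewrite gb_e (negPf n).
rewrite (bigD1 j) //= gv_e eqxx big1 ?addr0 // => i n.
by rewrite gv_e (negPf n).
Qed.

End VertexReplacement.
End Ops.

(** * Reflection functors *)

Record mod (k : fieldType) (I : finType) := Mod {
  mV :> vectType k; mo : ops I mV; mP : isops mo }.
#[global] Hint Resolve mP : core.

Section Reflection.
Variables (k : fieldType) (I : finType) (adj : rel I).
Hypotheses (adj_sym : symmetric adj) (adj_irr : irreflexive adj).
Local Notation mod := (mod k I).

Section Nb.
Variables (V : lmodType k) (M : ops I V) (MP : isops M) (j : I).

Fact nb_lin : linear (fun v => \sum_(i | adj j i) oe M i v).
Proof.
move=> c u v; rewrite scaler_sumr -big_split /=; apply: eq_bigr => i _.
by rewrite linearP.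
Qed.
Definition nbsum := mklin nb_lin.

Lemma e_nb i v : oe M i (nbsum v) = if adj j i then oe M i v else 0.
Proof.
rewrite /nbsum mklinE linear_sum /=; case: ifP => a.
  rewrite (bigD1 i) //= oee // big1 ?addr0 // => l /andP [_ n].
  by rewrite oe_neq // eq_sym.
rewrite big1 // => l al; rewrite oe_neq //; apply/eqP => e.
by rewrite e al in a.
Qed.

Lemma nb_e i v : nbsum (oe M i v) = if adj j i then oe M i v else 0.
Proof.
rewrite /nbsum mklinE; case: ifP => a.
  rewrite (bigD1 i) //= oee // big1 ?addr0 // => l /andP [_ n].
  by rewrite oe_neq.
rewrite big1 // => l al; rewrite oe_neq //; apply/eqP => e.
by rewrite -e al in a.
Qed.

Lemma nb_nb v : nbsum (nbsum v) = nbsum v.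
Proof.
apply: (oe_ext MP) => i; rewrite e_nb; case: ifP => // a.
by rewrite e_nb a.
Qed.

Lemma ej_nb v : oe M j (nbsum v) = 0.
Proof. by rewrite e_nb adj_irr. Qed.

Lemma nb_ej v : nbsum (oe M j v) = 0.
Proof. by rewrite nb_e adj_irr. Qed.

End Nb.

Lemma nb_hom (V W : lmodType k) (M : ops I V) (N : ops I W) j (f : {linear V -> W}) :
  (forall i v, f (oe M i v) = oe N i (f v)) -> forall v, f (nbsum M j v) = nbsum N j (f v).
Proof. by move=> fe v; rewrite /nbsum !mklinE linear_sum /=; apply: eq_bigr => i _. Qed.

Lemma zero_lin (U V : lmodType k) : linear (fun _ : U => 0 : V).
Proof. by move=> c u v; rewrite scaler0 addr0. Qed.
Definition lin0 (U V : lmodType k) := mklin (@zero_lin U V).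

Section At.
Variable (j : I).

(* The reflection functor at a source j: V_j becomes the cokernel of the sum of
   the maps that leave j. *)
Section Plus.
Variable M : mod.
Let MP := mP M.

(** The cokernel is taken as a quotient of the whole space, by all vectors whose neighbour part lies
    in the image. The components outside the neighbours of j die as well, so no separate carrier for
    the neighbours is needed. *)
Definition rp_pred (v : M) : Prop :=
  exists w, nbsum (mo M) j v = nbsum (mo M) j (ox (mo M) (oe (mo M) j w)).
Lemma rp_closed : closed_pred rp_pred.
Proof.
split; first by exists 0; rewrite !linear0.
by move=> c u v [w e] [w' e']; exists (c *: w + w'); rewrite !linearP e e'.
Qed.

Definition rpC : vectType k := quot (subV rp_closed).
Definition rpq : {linear M -> rpC} := qmap (subV rp_closed).
Definition rps : {linear rpC -> M} := qsec (subV rp_closed).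

Lemma rpq0 v : rpq v = 0 <-> rp_pred v.
Proof. by rewrite qmap_eq0; exact: subVP. Qed.

Lemma rpqs c : rpq (rps c) = c. Proof. exact: qsecK. Qed.

Lemma rpq_nb v : rpq (nbsum (mo M) j v) = rpq v.
Proof.
apply/eqP; rewrite -subr_eq0 -linearB; apply/eqP/rpq0; exists 0.
by rewrite linearB /= nb_nb // subrr !linear0.
Qed.

Definition rpG := gG rpC (@oee _ _ _ _ MP j).

Definition rp : mod := Mod (vr_isops rpG (lin0 _ _) rpq MP).
End Plus.

(* The reflection functor at a sink j: V_j becomes the kernel of the sum of the
   maps that enter j. *)
Section Minus.
Variable N : mod.
Let NP := mP N.

Definition rm_pred (v : N) : Prop := nbsum (mo N) j v = v /\ oe (mo N) j (ox (mo N) v) = 0.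
Lemma rm_closed : closed_pred rm_pred.
Proof.
split; first by split; rewrite !linear0.
by move=> c u v [n1 x1] [n2 x2]; split; rewrite !linearP /= ?n1 ?n2 // x1 x2 scaler0 addr0.
Qed.

Definition rmC : vectType k := subvs_of (subV rm_closed).
Definition rmk : {linear rmC -> N} := vsval.
Definition rml : {linear N -> rmC} := vsproj (subV rm_closed).

Lemma rmkP c : rm_pred (rmk c).
Proof. by apply/(subVP rm_closed); exact: subvsP. Qed.
Lemma rmk_nb c : nbsum (mo N) j (rmk c) = rmk c. Proof. by case: (rmkP c). Qed.
Lemma rmk_x c : oe (mo N) j (ox (mo N) (rmk c)) = 0. Proof. by case: (rmkP c). Qed.
Lemma rmk_inj : injective rmk. Proof. exact: val_inj. Qed.
Lemma rmlK v : rm_pred v -> rmk (rml v) = v.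
Proof. by move/(subVP rm_closed) => h; exact: vsprojK. Qed.

Definition rmG := gG rmC (@oee _ _ _ _ NP j).
Definition rm : mod := Mod (vr_isops rmG rmk (lin0 _ _) NP).

Lemma rm_ext (w w' : rm) : gb rmG w = gb rmG w' ->
  rmk (gv rmG w) = rmk (gv rmG w') -> w = w'.
Proof. by move=> e1 /rmk_inj e2; exact: (gext rmG). Qed.
End Minus.

Section Orientation.
Variables (g g' : rel I).
Hypotheses (g_adj : forall i, g i j = adj i j) (g_src : forall l, g j l = false)
  (g'_adj : forall l, g' j l = adj j l) (g'_snk : forall i, g' i j = false)
  (gg' : forall i l, i != j -> l != j -> g i l = g' i l).

Lemma ghom_xnb (V W : lmodType k) (M : ops I V) (N : ops I W) (f : {linear V -> W}) :
  ghom g' M N f -> forall v, f (oe M j (ox M (nbsum M j v))) = oe N j (ox N (nbsum N j (f v))).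
Proof.
move=> [fe fx] v; rewrite /nbsum !mklinE !linear_sum /=.
by apply: eq_bigr => i a; rewrite fx // g'_adj.
Qed.

Section Functor.
Variables (N L : mod) (f : {linear N -> L}) (fh : ghom g' (mo N) (mo L) f).

Fact rmf_lin : linear (fun w : rm N =>
  ga (rmG L) (f (gb (rmG N) w)) + gu (rmG L) (rml L (f (rmk N (gv (rmG N) w))))).
Proof. by move=> c u v; rewrite !linearP /= scalerDr addrACA. Qed.
Definition rmf : {linear rm N -> rm L} := mklin rmf_lin.

Lemma rmf_b w : gb (rmG L) (rmf w) = f (gb (rmG N) w).
Proof.
rewrite /rmf mklinE linearD /= gba gbu addr0; case: fh => fe _.
by rewrite -fe (gb_j (rmG N) (mP N)) linear0 subr0.
Qed.

Lemma rmf_k w : rmk L (gv (rmG L) (rmf w)) = f (rmk N (gv (rmG N) w)).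
Proof.
rewrite /rmf mklinE linearD /= gva gvu add0r rmlK //.
set c := gv _ _; have [n x] := rmkP c; have [fe _] := fh.
split; first by rewrite -(nb_hom j fe) n.
by rewrite -n (nb_hom j fe) -(ghom_xnb fh) n x linear0.
Qed.

Lemma rmf_hom : ghom g (mo (rm N)) (mo (rm L)) rmf.
Proof.
have [fe fx] := fh; split=> [i w|i l w gil].
  apply: rm_ext; rewrite ?(rmf_b, rmf_k) !(gb_e, gv_e) //.
    by case: (i == j); rewrite ?linear0 // rmf_b fe.
  by case: (i == j); rewrite ?linear0 // rmf_k.
have nij : i != j by apply: contraTneq gil => ->; rewrite g_src.
apply: rm_ext; rewrite ?(rmf_b, rmf_k) !(gb_exe, gv_exe) //; last first.
  by rewrite (negPf nij) !linear0.
rewrite (negPf nij); case: eqP => [el|/eqP nlj]; first by rewrite fe rmf_k.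
by rewrite fx -?gg' // rmf_b.
Qed.
End Functor.
End Orientation.
End At.
End Reflection.

(** * Idempotents, isomorphisms and dimension vectors *)

Section Indecomposable.
Variables (k : fieldType) (I : finType).
Local Notation mod := (mod k I).

(* Indecomposability is stated with idempotent endomorphisms. *)
Definition indec (g : rel I) (M : mod) : Prop :=
  (exists v : M, v <> 0) /\
  forall f : {linear M -> M}, ghom g (mo M) (mo M) f -> (forall v, f (f v) = f v) ->
    (forall v, f v = 0) \/ (forall v, f v = v).

Definition miso (g : rel I) (M N : mod) : Prop :=
  exists (f : {linear M -> N}) (h : {linear N -> M}),
    [/\ ghom g (mo M) (mo N) f, ghom g (mo N) (mo M) h, cancel f h & cancel h f].

Lemma miso_sym g M N : miso g M N -> miso g N M.
Proof. by move=> [f [h [? ? ? ?]]]; exists h, f. Qed.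

Lemma miso_trans g M N L : miso g M N -> miso g N L -> miso g M L.
Proof.
move=> [f [h [fg hg fh hf]]] [f' [h' [fg' hg' fh' hf']]].
exists (f' \o f), (h \o h'); split.
- exact: (ghom_comp fg fg').
- exact: (ghom_comp hg' hg).
- exact: (can_comp fh' fh).
- exact: (can_comp hf hf').
Qed.

Lemma miso_bij g (M N : mod) (f : {linear M -> N}) : ghom g (mo M) (mo N) f ->
  (forall v, f v = 0 -> v = 0) -> (forall w, exists v, f v = w) -> miso g M N.
Proof.
move=> [fe fx] fi fs.
have inj : injective f.
  move=> u v e; apply/eqP; rewrite -subr_eq0; apply/eqP/fi.
  by rewrite linearB /= e subrr.
pose h w := sval (cid (fs w)).
have hK : cancel h f by move=> w; exact: svalP (cid (fs w)).
have hl : linear h by move=> c u v; apply: inj; rewrite linearP /= !hK.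
exists f, (mklin hl); split=> //.
- split=> [i v|i l v gil]; rewrite !mklinE; apply: inj; first by rewrite fe !hK.
  by rewrite fx // !hK.
- by move=> v; rewrite mklinE; apply: inj; rewrite hK.
- by move=> v; rewrite mklinE hK.
Qed.

Lemma miso_indec g (M N : mod) : miso g M N -> indec g M -> indec g N.
Proof.
move=> [f [h [fg hg fh hf]]] [[v v0] Mi]; split.
  by exists (f v) => e; apply: v0; rewrite -(fh v) e linear0.
move=> p pg pp.
have [] := Mi (h \o (p \o f)) (ghom_comp (ghom_comp fg pg) hg).
- by move=> w /=; rewrite hf pp.
- by move=> e; left=> w; rewrite -(hf w) -[p _]hf [h _]e linear0.
- by move=> e; right=> w; rewrite -{1}(hf w) -[p _]hf [h _]e.
Qed.

Definition dm (M : mod) i : nat := \dim (limg (linfun (oe (mo M) i))).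

Lemma mem_limg_oe (M : mod) i v : (v \in limg (linfun (oe (mo M) i))) = (oe (mo M) i v == v).
Proof.
apply/memv_imgP/eqP => [[u _ ->]|<-]; first by rewrite lfunE /= oee.
by exists v; rewrite ?memvf // lfunE.
Qed.

Lemma miso_dm g M N i : miso g M N -> dm M i = dm N i.
Proof.
have le L L' : miso g L L' -> (dm L i <= dm L' i)%N.
  move=> [f [h [[fe _] _ fh _]]]; apply: (@dim_sub _ _ _ _ _ f) => [u|u _ e].
    by rewrite !mem_limg_oe -fe => /eqP ->.
  by rewrite -(fh u) e linear0.
by move=> h; apply/eqP; rewrite eqn_leq !le //; exact: miso_sym.
Qed.

Lemma dim_sum_oe (M : mod) (P : pred I) (f : {linear M -> M}) :
  (forall v, f v = \sum_(i | P i) oe (mo M) i v) ->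
  \dim (limg (linfun f)) = (\sum_(i | P i) dm M i)%N.
Proof.
move=> fE; rewrite /dm.
have /directvP /= <- : directv (\sum_(i | P i) limg (linfun (oe (mo M) i))).
  apply/directv_sum_independent => us usP e i Pi.
  have := congr1 (oe (mo M) i) e; rewrite linear0 linear_sum /= (bigD1 i) //=.
  rewrite big1 ?addr0 => [|l /andP [Pl n]]; last first.
    by have := usP l Pl; rewrite mem_limg_oe => /eqP <-; rewrite oe_neq // eq_sym.
  by have := usP i Pi; rewrite mem_limg_oe => /eqP ->.
congr (\dim _); apply/vspaceP => v; apply/memv_imgP/memv_sumP.
  move=> [u _ ->]; exists (fun i => oe (mo M) i u); rewrite ?lfunE ?fE // => i _.
  by rewrite mem_limg_oe oee.
move=> [us usP ->]; exists (\sum_(i | P i) us i); rewrite ?memvf // lfunE /= fE.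
apply: eq_bigr => i Pi; rewrite linear_sum /= (bigD1 i) //= big1 ?addr0.
  by have := usP i Pi; rewrite mem_limg_oe => /eqP ->.
by move=> l /andP [Pl n]; have := usP l Pl; rewrite mem_limg_oe => /eqP <-; rewrite oe_neq // eq_sym.
Qed.

Lemma dim_dm (M : mod) : \dim {:M} = (\sum_i dm M i)%N.
Proof.
rewrite -(@dim_sum_oe M predT idfun); last by move=> v; rewrite sum_oe.
congr (\dim _); apply/vspaceP => v; rewrite memvf; apply/esym/memv_imgP.
by exists v; rewrite ?memvf // lfunE.
Qed.

End Indecomposable.

(** * The reflection at a sink is fully faithful off the simple at j *)

Section BGP.
Variables (k : fieldType) (I : finType) (adj : rel I).
Hypotheses (adj_sym : symmetric adj) (adj_irr : irreflexive adj).
Local Notation mod := (mod k I).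
Variable (j : I).
Variables (g g' : rel I).
Hypotheses (g_adj : forall i, g i j = adj i j) (g_src : forall l, g j l = false)
  (g'_adj : forall l, g' j l = adj j l) (g'_snk : forall i, g' i j = false)
  (gg' : forall i l, i != j -> l != j -> g i l = g' i l).
Local Notation rm := (rm adj j).
Local Notation rp := (rp adj j).
Local Notation rmG := (rmG adj j).
Local Notation rpG := (rpG adj j).
Local Notation rmk := (rmk adj j).
Local Notation rml := (rml adj j).
Local Notation rmf := (rmf adj j).
Local Notation e M i := (oe (mo M) i).
Local Notation x M := (ox (mo M)).
Local Notation nb M := (nbsum adj (mo M) j).

(** Joint surjectivity of the maps into a sink j and joint injectivity of the maps out of a source
    j. Under these the reflections lose nothing; an indecomposable that violates them is
    concentrated at j, see [indec_psurj] and [indec_iinj]. *)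
Definition psurj (N : mod) := forall v, exists w, e N j v = e N j (x N (nb N w)).
Definition iinj (M : mod) := forall v, nb M (x M (e M j v)) = 0 -> e M j v = 0.
Definition concentrated (N : mod) := forall v, e N j v = v.

Section VR.
Variables (V C W : lmodType k) (M : ops I V) (G : glue C W (oe M j)).
Variables (ka : {linear C -> V}) (q : {linear V -> C}).
Hypothesis MP : isops M.
Local Notation R := (vr G ka q).

Lemma ga_e i v : oe R i (ga G v) = if i == j then 0 else ga G (oe M i v).
Proof.
case: (eqVneq i j) => [->|n]; apply: (gext G).
- by rewrite gb_e // eqxx linear0.
- by rewrite gv_e // eqxx gva linear0.
- rewrite gb_e // (negPf n) !gba linearB /= [X in _ - X]oe_neq //.
  by rewrite [X in _ = _ - X]oe_neq // eq_sym.
- by rewrite gv_e // (negPf n) gva.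
Qed.

Lemma ga_exe i l v : i != j -> l != j ->
  oe R i (ox R (oe R l (ga G v))) = ga G (oe M i (ox M (oe M l v))).
Proof.
move=> /negPf ni /negPf nl; apply: (gext G); rewrite !(gb_exe, gv_exe) // ni nl /=.
  by rewrite !gba linearB /= [X in _ - X]oe_neq ?nl // subr0 oe_neq ?subr0 // eq_sym ni.
by rewrite gva.
Qed.

Lemma gu_e i c : oe R i (gu G c) = if i == j then gu G c else 0.
Proof.
apply: (gext G); rewrite !(gb_e, gv_e) //; case: eqP => // _;
  by rewrite ?gbu ?gvu ?linear0.
Qed.

Lemma gb_nb w : gb G (nbsum adj R j w) = nbsum adj M j (gb G w).
Proof.
rewrite /nbsum !mklinE linear_sum /=; apply: eq_bigr => i a; rewrite gb_e //.
by case: eqP a => // ->; rewrite adj_irr.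
Qed.

Lemma gv_nb w : gv G (nbsum adj R j w) = 0.
Proof.
rewrite /nbsum !mklinE linear_sum /= big1 // => i a; rewrite gv_e //.
by case: eqP a => // ->; rewrite adj_irr.
Qed.

Lemma ga_gb w : ga G (gb G w) = w - oe R j w.
Proof.
apply: (gext G).
  by rewrite gba gb_j // linearB /= gb_e // eqxx !subr0.
by rewrite gva linearB /= gv_e // eqxx subrr.
Qed.

Lemma gu_gv w : gu G (gv G w) = oe R j w.
Proof.
by apply: (gext G); rewrite ?gbu ?gvu ?gb_e ?gv_e ?eqxx.
Qed.
End VR.

Lemma rmf_comp (N L P : mod) (f : {linear N -> L}) (h : {linear L -> P}) (hf : {linear N -> P}) :
  ghom g' (mo N) (mo L) f -> ghom g' (mo L) (mo P) h -> ghom g' (mo N) (mo P) hf ->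
  (forall v, hf v = h (f v)) -> forall w, rmf hf w = rmf h (rmf f w).
Proof.
move=> fg hg hfg E w; apply: rm_ext.
  by rewrite !(rmf_b fg, rmf_b hg, rmf_b hfg) E.
by rewrite !(rmf_k g'_adj fg, rmf_k g'_adj hg, rmf_k g'_adj hfg) E.
Qed.

Lemma rmf_id (N : mod) (f : {linear N -> N}) : ghom g' (mo N) (mo N) f ->
  (forall v, f v = v) -> forall w, rmf f w = w.
Proof.
by move=> fg E w; apply: rm_ext; rewrite ?(rmf_b fg) ?(rmf_k g'_adj fg) E.
Qed.

Lemma rmf0 (N L : mod) (f : {linear N -> L}) : ghom g' (mo N) (mo L) f ->
  (forall v, f v = 0) -> forall w, rmf f w = 0.
Proof.
by move=> fg E w; apply: rm_ext; rewrite ?(rmf_b fg) ?(rmf_k g'_adj fg) E !linear0.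
Qed.

(** The reflection remembers a morphism off j, and by [psurj] the values off j determine those at
    j. *)
Lemma rmf_faithful (N L : mod) (f h : {linear N -> L}) :
  ghom g' (mo N) (mo L) f -> ghom g' (mo N) (mo L) h -> psurj N ->
  (forall w, rmf f w = rmf h w) -> forall v, f v = h v.
Proof.
move=> fg hg ps E.
have E0 v : e N j v = 0 -> f v = h v.
  move=> v0; have -> : v = gb (rmG N) (ga (rmG N) v) by rewrite gba v0 subr0.
  by rewrite -(rmf_b fg) -(rmf_b hg) E.
move=> v; have Df : f v = f (v - e N j v) + f (e N j v) by rewrite -linearD subrK.
have Dh : h v = h (v - e N j v) + h (e N j v) by rewrite -linearD subrK.
rewrite Df Dh E0; last by rewrite linearB /= oee // subrr.
congr (_ + _); have [w ->] := ps v.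
rewrite (ghom_xnb g'_adj fg) (ghom_xnb g'_adj hg).
by rewrite -(nb_hom _ j fg.1) -(nb_hom _ j hg.1) E0 // ej_nb.
Qed.

Section Full.
Variables (N L : mod) (f : {linear rm N -> rm L}).
Hypotheses (fg : ghom g (mo (rm N)) (mo (rm L)) f).
Let F v := gb (rmG L) (f (ga (rmG N) v)).
Fact F_lin : linear F. Proof. by move=> c u v; rewrite /F !linearP. Qed.

Lemma F_e i v : i != j -> F (e N i v) = e L i (F v).
Proof.
move=> n; rewrite /F; have [fe _] := fg.
have -> : ga (rmG N) (e N i v) = e (rm N) i (ga (rmG N) v) by rewrite ga_e // (negPf n).
by rewrite fe gb_e // (negPf n).
Qed.

Lemma F_j v : F (e N j v) = 0.
Proof.
rewrite /F; have -> : ga (rmG N) (e N j v) = 0; last by rewrite !linear0.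
by apply: (gext (rmG N)); rewrite ?gba ?gva ?linear0 // oee // subrr.
Qed.

Lemma F_nb v : F (nb N v) = nb L (F v).
Proof.
rewrite /nbsum !mklinE -[LHS](mklinE F_lin) linear_sum; apply: eq_bigr => i a.
rewrite mklinE F_e //.
by apply: contraTneq a => ->; rewrite adj_irr.
Qed.

Lemma F_exe i l v : i != j -> l != j -> g' i l ->
  F (e N i (x N (e N l v))) = e L i (x L (e L l (F v))).
Proof.
move=> ni nl gil; rewrite /F; have [_ fx] := fg.
rewrite -(ga_exe (rmG N) (rmk N) (lin0 _ _)) // fx ?gg' //.
by rewrite gb_exe // (negPf ni) (negPf nl).
Qed.

Lemma f_b w : gb (rmG L) (f w) = F (gb (rmG N) w).
Proof.
rewrite /F -{1}(gdec (rmG N) w) !linearD /=; have [fe _] := fg.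
have -> : gu (rmG N) (gv (rmG N) w) = e (rm N) j w.
  exact: gu_gv.
by rewrite fe gb_e // eqxx addr0.
Qed.

Lemma f_k w : rmk L (gv (rmG L) (f w)) = F (rmk N (gv (rmG N) w)).
Proof.
set c := gv _ w; have [fe fx] := fg.
rewrite -[rmk N c]rmk_nb F_nb; apply: (oe_ext (mP L)) => i; rewrite e_nb //.
case: ifP => a; last first.
  by rewrite -[rmk L _]rmk_nb e_nb // a.
have n : i != j by apply: contraTneq a => ->; rewrite adj_irr.
rewrite -F_e //; have gij : g i j by rewrite g_adj adj_sym.
have := congr1 (gb (rmG L)) (fx i j w gij).
rewrite gb_exe // (negPf n) eqxx => <-.
rewrite /F; congr (gb _ (f _)); apply: (gext (rmG N)).
  by rewrite gba gb_exe // (negPf n) eqxx oe_neq ?subr0 // eq_sym.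
by rewrite gv_exe // (negPf n) gva.
Qed.

Fact h_lin : linear (fun v => e N j (x N (nb N v))).
Proof. by move=> c u v; rewrite !linearP. Qed.

Lemma F_h u : e N j (x N (nb N u)) = 0 -> e L j (x L (nb L (F u))) = 0.
Proof.
move=> hu; have uK : rm_pred adj j (nb N u) by split; rewrite ?nb_nb.
rewrite -F_nb -(rmlK uK).
have -> : rml N (nb N u) = gv (rmG N) (gu (rmG N) (rml N (nb N u))) by rewrite gvu.
by rewrite -f_k rmk_x.
Qed.

(** Off j a morphism of the reflections is already a morphism [F] of the originals. It respects the
    kernels of the maps into j ([F_h]), hence descends to their images; the generalized inverse [s]
    extends it to the whole space at j, so that surjectivity into j is not assumed. *)
Lemma rm_full : exists f' : {linear N -> L}, ghom g' (mo N) (mo L) f' /\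
  forall w, f w = rmf f' w.
Proof.
have [s sP] := linear_section (mklin h_lin).
have {}sP u : e N j (x N (nb N (s (e N j (x N (nb N u)))))) = e N j (x N (nb N u)).
  by have := sP u; rewrite !mklinE.
pose f' v := F v + e L j (x L (nb L (F (s (e N j v))))).
have f'_lin : linear f'.
  move=> c u v; rewrite /f' -!(mklinE F_lin) !linearP /= scalerDr addrACA.
  by rewrite !mklinE.
have Fh u : e L j (x L (nb L (F (s (e N j (x N (nb N u))))))) = e L j (x L (nb L (F u))).
  apply/eqP; rewrite -subr_eq0; apply/eqP.
  have : e L j (x L (nb L (F (s (e N j (x N (nb N u))) - u)))) = 0.
    by apply: F_h; rewrite !linearB /= sP subrr.
  by rewrite -[F _](mklinE F_lin) !linearB /= !mklinE.
have FL v : e L j (F v) = 0 by rewrite /F gb_j.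
have F0 : F 0 = 0 by rewrite /F !linear0.
have f'g : ghom g' (mo N) (mo L) (mklin f'_lin).
  split=> [i v|i l v gil]; rewrite !mklinE /f'.
    case: (eqVneq i j) => [->|n].
      by rewrite F_j add0r linearD /= FL add0r !oee.
    by rewrite F_e // [e N j _]oe_neq ?linear0 ?F0 ?linear0 ?addr0 ?linearD /= 1?eq_sym // [X in _ + X]oe_neq ?addr0.
  have nl : l != j by apply: contraTneq gil => ->; rewrite g'_snk.
  have -> : e L l (F v + e L j (x L (nb L (F (s (e N j v)))))) = e L l (F v).
    by rewrite linearD /= [X in _ + X]oe_neq ?addr0.
  case: (eqVneq i j) => [ei|n].
    rewrite ei in gil *; rewrite F_j add0r oee //.
    have a : adj j l by rewrite -g'_adj.
    have -> : e N l v = nb N (e N l v) by rewrite nb_e // a.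
    by rewrite Fh F_e // nb_e // a.
  by rewrite F_exe // [e N j _]oe_neq 1?eq_sym // linear0 F0 !linear0 addr0.
exists (mklin f'_lin); split=> // w.
have E v : e N j v = 0 -> mklin f'_lin v = F v.
  by move=> v0; rewrite mklinE /f' v0 linear0 F0 !linear0 addr0.
apply: rm_ext.
  by rewrite (rmf_b f'g) E ?gb_j // f_b.
by rewrite (rmf_k g'_adj f'g) f_k E // -rmk_nb ej_nb.
Qed.
End Full.

End BGP.

Section BGP2.
Variables (k : fieldType) (I : finType) (adj : rel I).
Hypotheses (adj_sym : symmetric adj) (adj_irr : irreflexive adj).
Local Notation mod := (mod k I).
Variable (j : I).

Fact simple_e_lin i : linear (fun v : k^o => if i == j then v else 0 : k^o).
Proof. by move=> c u v; case: eqP => // _; rewrite scaler0 addr0. Qed.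
Definition simple_ops : ops I k^o := Ops (fun i => mklin (simple_e_lin i)) (lin0 _ _).
Lemma simple_isops : isops simple_ops.
Proof.
split=> [i l v|v] /=.
  rewrite !mklinE; case: (eqVneq l j) => [-> //|n].
  by case: (i == j); case: (i == l).
rewrite (bigD1 j) //= mklinE eqxx big1 ?addr0 // => i n.
by rewrite mklinE (negPf n).
Qed.
Definition simple : mod := Mod simple_isops.

Lemma simple_eE i (v : simple) : oe (mo simple) i v = if i == j then v else 0.
Proof. by rewrite /= mklinE. Qed.
Lemma simple_xE (v : simple) : ox (mo simple) v = 0.
Proof. by rewrite /= mklinE. Qed.

Lemma dim_simple : \dim {: simple} = 1%N.
Proof. by rewrite dimvf. Qed.

Lemma simple_indec g : indec g simple.
Proof.
split; first by exists 1; apply/eqP; exact: oner_neq0.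
move=> f _ ff; have fE (v : simple) : f v = v * f 1.
  by rewrite -[X in f X]mulr1 -[_ * 1]/(v *: (1 : k^o)) linearZ.
have := ff 1; rewrite fE => /eqP.
rewrite -subr_eq0 -{3}[f 1]mul1r -mulrBl mulf_eq0 => /orP [|] /eqP e.
  by right=> v; rewrite fE; move/eqP: e; rewrite subr_eq0 => /eqP ->; rewrite mulr1.
by left=> v; rewrite fE e mulr0.
Qed.

Variables (g g' : rel I).
Hypotheses (g_adj : forall i, g i j = adj i j) (g_src : forall l, g j l = false)
  (g'_adj : forall l, g' j l = adj j l) (g'_snk : forall i, g' i j = false)
  (gg' : forall i l, i != j -> l != j -> g i l = g' i l).
Local Notation rm := (rm adj j).
Local Notation rp := (rp adj j).
Local Notation rmG := (rmG adj j).
Local Notation rpG := (rpG adj j).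
Local Notation rmk := (rmk adj j).
Local Notation rml := (rml adj j).
Local Notation rmf := (rmf adj j).
Local Notation rpq := (rpq adj j).
Local Notation rps := (rps adj j).
Local Notation e M i := (oe (mo M) i).
Local Notation x M := (ox (mo M)).
Local Notation nb M := (nbsum adj (mo M) j).
Local Notation psurj := (psurj adj j).
Local Notation iinj := (iinj adj j).
Local Notation concentrated := (concentrated j).

(** There is no loop at j, so every linear endomorphism of a concentrated module is a morphism. The
    projection onto the line of one nonzero vector is then a nonzero idempotent, hence the
    identity. *)
Lemma concentrated_simple h (N : mod) : h j j = false -> concentrated N -> indec h N ->
  miso h simple N.
Proof.
move=> hjj cN [[v0 v0n] Ni].
have e0 i v : i != j -> e N i v = 0 by move=> n; rewrite -(cN v) oe_neq.
have eN i v : e N i v = if i == j then v else 0.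
  by case: eqP => [->|/eqP]; [exact: cN|exact: e0].
pose p : {linear N -> N} := projv <[v0]>%VS.
have pg : ghom h (mo N) (mo N) p.
  split=> [i v|i l v hil]; first by rewrite !eN; case: eqP; rewrite ?linear0.
  rewrite !eN; case: (eqVneq i j) => [ei|_]; last by rewrite linear0.
  case: (eqVneq l j) => [el|_]; last by rewrite !linear0.
  by rewrite ei el hjj in hil.
have pp v : p (p v) = p v by rewrite /p /= projv_proj.
have pv v : p v = v.
  have [p0|//] := Ni p pg pp; case: v0n.
  by rewrite -(p0 v0) /p /= projv_id // memv_line.
have fl : linear (fun c : simple => (c : k) *: v0 : N).
  by move=> c a b; rewrite scalerDl scalerA.
apply: (@miso_bij _ _ _ _ _ (mklin fl)).
- split=> [i v|i l v hil]; rewrite [LHS]mklinE [X in _ = e N _ (x N (e N _ X))]mklinE || rewrite [LHS]mklinE [X in _ = e N _ X]mklinE.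
    by rewrite simple_eE eN; case: ifP; rewrite ?scale0r.
  rewrite simple_eE simple_xE !eN; case: (eqVneq i j) => [ei|_]; last by rewrite scale0r.
  rewrite scale0r; case: (eqVneq l j) => [el|_]; last by rewrite linear0.
  by rewrite ei el hjj in hil.
- move=> c; rewrite mklinE => /eqP; rewrite scaler_eq0 => /orP [/eqP //|/eqP e].
  by case: v0n.
- move=> w; have : p w \in <[v0]>%VS by rewrite /p /= memv_proj.
  by rewrite pv => /vlineP [c ->]; exists c; rewrite mklinE.
Qed.

Lemma concentrated_rm (N : mod) : concentrated N -> forall w : rm N, w = 0.
Proof.
move=> cN w; apply: rm_ext; rewrite !linear0.
  by rewrite -[LHS]cN gb_j.
by rewrite -[LHS]rmk_nb -[X in nb N X]cN nb_e // adj_irr.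
Qed.

Lemma psurj_rm_neq0 (N : mod) : psurj N -> (forall w : rm N, w = 0) -> forall v : N, v = 0.
Proof.
move=> ps w0.
have E0 v : e N j v = 0 -> v = 0.
  move=> v0; have <- : gb (rmG N) (ga (rmG N) v) = v by rewrite gba v0 subr0.
  by rewrite (w0 (ga (rmG N) v)) linear0.
move=> v; have : v - e N j v = 0 by apply: E0; rewrite linearB /= oee // subrr.
move/eqP; rewrite subr_eq0 => /eqP ->; have [w ->] := ps v.
by rewrite (E0 (nb N w)) ?ej_nb // !linear0.
Qed.

Lemma rm_indec (N : mod) : psurj N -> indec g' N -> indec g (rm N).
Proof.
move=> ps [[v vn] Ni]; split.
  by apply: contrapT => h; apply: vn; apply: psurj_rm_neq0 => // w;
     apply: contrapT => wn; apply: h; exists w.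
move=> f fg ff; have [f' [f'g fE]] := rm_full adj_sym adj_irr g_adj g'_adj g'_snk gg' fg.
have f'f'g : ghom g' (mo N) (mo N) (f' \o f') by exact: (ghom_comp f'g f'g).
have idem v' : f' (f' v') = f' v'.
  apply: (rmf_faithful adj_irr g'_adj f'f'g f'g ps) => w.
  by rewrite (rmf_comp g'_adj f'g f'g f'f'g) // -!fE ff.
have [h|h] := Ni f' f'g idem; [left|right] => w; rewrite fE.
  by rewrite (rmf0 g'_adj f'g).
by rewrite (rmf_id g'_adj f'g).
Qed.

Lemma indec_rm (N : mod) : psurj N -> indec g (rm N) -> indec g' N.
Proof.
move=> ps [[w wn] Ni]; split.
  apply: contrapT => h; apply: wn; apply: rm_ext.
    by apply: contrapT => e; apply: h; exists (gb (rmG N) w); rewrite linear0 in e.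
  by apply: contrapT => e; apply: h; exists (rmk N (gv (rmG N) w)); rewrite !linear0 in e.
move=> f fg ff.
have Fg := rmf_hom g_src g'_adj gg' fg.
have FF v : rmf f (rmf f v) = rmf f v by rewrite -(rmf_comp g'_adj fg fg fg).
have zg : ghom g' (mo N) (mo N) (lin0 N N).
  by split=> *; rewrite !mklinE !linear0.
have [h|h] := Ni _ Fg FF; [left|right].
  move=> v; rewrite (rmf_faithful adj_irr g'_adj fg zg ps) ?mklinE // => w'.
  by rewrite h (rmf0 g'_adj zg) // => u; rewrite mklinE.
have ig : ghom g' (mo N) (mo N) (idfun : {linear N -> N}) by [].
move=> v; rewrite (rmf_faithful adj_irr g'_adj fg ig ps) // => w'.
by rewrite h (rmf_id g'_adj ig).
Qed.

Lemma rm_miso (N L : mod) : psurj N -> psurj L -> miso g (rm N) (rm L) -> miso g' N L.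
Proof.
move=> psN psL [f [h [fg hg fh hf]]].
have [f' [f'g fE]] := rm_full adj_sym adj_irr g_adj g'_adj g'_snk gg' fg.
have [h' [h'g hE]] := rm_full adj_sym adj_irr g_adj g'_adj g'_snk gg' hg.
exists f', h'; split=> // v.
  have cg : ghom g' (mo N) (mo N) (h' \o f') by exact: (ghom_comp f'g h'g).
  have ig : ghom g' (mo N) (mo N) (idfun : {linear N -> N}) by [].
  apply: (rmf_faithful adj_irr g'_adj cg ig psN) => w.
  by rewrite (rmf_comp g'_adj f'g h'g cg) // -fE -hE fh (rmf_id g'_adj ig).
have cg : ghom g' (mo L) (mo L) (f' \o h') by exact: (ghom_comp h'g f'g).
have ig : ghom g' (mo L) (mo L) (idfun : {linear L -> L}) by [].
apply: (rmf_faithful adj_irr g'_adj cg ig psL) => w.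
by rewrite (rmf_comp g'_adj h'g f'g cg) // -hE -fE hf (rmf_id g'_adj ig).
Qed.

Lemma miso_rm (N L : mod) : miso g' N L -> miso g (rm N) (rm L).
Proof.
move=> [f [h [fg hg fh hf]]].
exists (rmf f), (rmf h); split; try exact: (rmf_hom g_src g'_adj gg').
  move=> w; have cg : ghom g' (mo N) (mo N) (h \o f) by exact: (ghom_comp fg hg).
  by rewrite -(rmf_comp g'_adj fg hg cg) // (rmf_id g'_adj cg).
move=> w; have cg : ghom g' (mo L) (mo L) (f \o h) by exact: (ghom_comp hg fg).
by rewrite -(rmf_comp g'_adj hg fg cg) // (rmf_id g'_adj cg).
Qed.

(** [P] projects the space at j onto the image of the maps entering j. As nothing leaves the sink j,
    the difference of [e N j] and [P] is an idempotent endomorphism: if it is zero, the maps are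
    surjective, and if it is the identity, N is concentrated at j. *)
Lemma indec_psurj (N : mod) : indec g' N -> psurj N \/ concentrated N.
Proof.
move=> [_ Ni].
have hl : linear (fun v => e N j (x N (nb N v))) by move=> c u v; rewrite !linearP.
have [s sP] := linear_section (mklin hl).
have {}sP u : e N j (x N (nb N (s (e N j (x N (nb N u)))))) = e N j (x N (nb N u)).
  by have := sP u; rewrite !mklinE.
pose P v := e N j (x N (nb N (s (e N j v)))).
have Pe v : e N j (P v) = P v by rewrite /P oee.
have PP v : P (P v) = P v by rewrite {1}/P Pe sP.
have Ph v : P (e N j (x N (nb N v))) = e N j (x N (nb N v)) by rewrite /P oee // sP.
have Pl : linear P by move=> c u v; rewrite /P !linearP.
have fl : linear (fun v => e N j v - P v).
  by move=> c u v; rewrite -!(mklinE Pl) !linearP /= addrACA -scalerDr !mklinE.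
have P0 : P 0 = 0 by rewrite -(mklinE Pl) linear0.
have Pj v : P (e N j v) = P v by rewrite /P oee.
have fg : ghom g' (mo N) (mo N) (mklin fl).
  split=> [i v|i l v gil]; rewrite !mklinE.
    case: (eqVneq i j) => [->|n]; first by rewrite linearB /= Pj Pe !oee.
    rewrite [e N j _]oe_neq 1?eq_sym // -Pj [e N j _]oe_neq 1?eq_sym // P0 subr0.
    by rewrite linearB /= -[P v]Pe !oe_neq // subr0.
  have nl : l != j by apply: contraTneq gil => ->; rewrite g'_snk.
  rewrite [e N l (_ - _)]linearB /= -[P v]Pe !(oe_neq _ _ nl) // subr0 !linear0.
  case: (eqVneq i j) => [ei|n].
    rewrite ei in gil *; have a : adj j l by rewrite -g'_adj.
    by rewrite oee // -[e N l v](_ : nb N (e N l v) = _) ?Ph ?subrr // nb_e // a.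
  by rewrite [e N j _]oe_neq 1?eq_sym // -Pj [e N j _]oe_neq 1?eq_sym // P0 subr0.
have ff v : mklin fl (mklin fl v) = mklin fl v.
  rewrite !mklinE linearB /= oee // Pe -!(mklinE Pl) linearB /= !mklinE PP Pj.
  by rewrite subrr subr0.
have [f0|f1] := Ni _ fg ff.
  left=> v; exists (s (e N j v)); apply/eqP; rewrite -subr_eq0; apply/eqP.
  by have := f0 v; rewrite mklinE.
right=> v; rewrite -{1}(f1 v) mklinE linearB /= oee // Pe.
by have := f1 v; rewrite mklinE.
Qed.

(** Dual to [indec_psurj]: here [P] is a projection of the space at j along the common kernel of the
    maps leaving j. *)
Lemma indec_iinj (M : mod) : indec g M -> iinj M \/ concentrated M.
Proof.
move=> [_ Mi].
have hl : linear (fun v => nb M (x M (e M j v))) by move=> c u v; rewrite !linearP.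
have [s sP] := linear_section (mklin hl).
have {}sP u : nb M (x M (e M j (s (nb M (x M (e M j u)))))) = nb M (x M (e M j u)).
  by have := sP u; rewrite !mklinE.
pose P v := e M j (s (nb M (x M (e M j v)))).
have Pe v : e M j (P v) = P v by rewrite /P oee.
have Pj v : P (e M j v) = P v by rewrite /P oee.
have PP v : P (P v) = P v by rewrite {1}/P Pe {1}/P sP.
have Pl : linear P by move=> c u v; rewrite /P !linearP.
have fl : linear (fun v => e M j v - P v).
  by move=> c u v; rewrite -!(mklinE Pl) !linearP /= addrACA -scalerDr !mklinE.
have P0 : P 0 = 0 by rewrite -(mklinE Pl) linear0.
have fg : ghom g (mo M) (mo M) (mklin fl).
  split=> [i v|i l v gil]; rewrite !mklinE.
    case: (eqVneq i j) => [->|n]; first by rewrite linearB /= Pj Pe !oee.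
    rewrite [e M j _]oe_neq 1?eq_sym // -Pj [e M j _]oe_neq 1?eq_sym // P0 subr0.
    by rewrite linearB /= -[P v]Pe !oe_neq // subr0.
  have ni : i != j by apply: contraTneq gil => ->; rewrite g_src.
  rewrite [e M j _]oe_neq 1?eq_sym // -Pj [e M j _]oe_neq 1?eq_sym // P0 subr0.
  case: (eqVneq l j) => [el|n]; last first.
    by rewrite linearB /= -[P v]Pe !oe_neq // subr0 !linear0.
  rewrite el in gil *; have a : adj j i by rewrite adj_sym -g_adj.
  have -> : e M j (e M j v - P v) = e M j (v - s (nb M (x M (e M j v)))).
    by rewrite !linearB /= oee // Pe.
  set u := v - _; have <- : e M i (nb M (x M (e M j u))) = e M i (x M (e M j u)).
    by rewrite e_nb // a.
  by rewrite /u !linearB /= sP subrr.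
have ff v : mklin fl (mklin fl v) = mklin fl v.
  rewrite !mklinE linearB /= oee // Pe -!(mklinE Pl) linearB /= !mklinE PP Pj.
  by rewrite subrr subr0.
have [f0|f1] := Mi _ fg ff.
  left=> v v0; have := f0 v; rewrite mklinE => /eqP; rewrite subr_eq0 => /eqP ->.
  by rewrite /P v0 !linear0.
right=> v; rewrite -{1}(f1 v) mklinE linearB /= oee // Pe.
by have := f1 v; rewrite mklinE.
Qed.

End BGP2.

(** * Spaces of morphisms *)

Section HomDim.
Variables (k : fieldType) (I : finType).
Local Notation mod := (mod k I).

Lemma ghom_closed g (M N : mod) :
  closed_pred (fun f : 'Hom(M, N) => ghom g (mo M) (mo N) f).
Proof.
split; first by split=> *; rewrite !zero_lfunE !linear0.
move=> c f h fg hg; have [E X] := ghom_D c fg hg.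
by split=> [i v|i l v gil]; rewrite !add_lfunE !scale_lfunE; [exact: E|exact: X].
Qed.
Definition homV g (M N : mod) : {vspace 'Hom(M, N)} := subV (@ghom_closed g M N).
Definition dhom g (M N : mod) : nat := \dim (homV g M N).

Lemma mem_homV g (M N : mod) (f : 'Hom(M, N)) : f \in homV g M N <-> ghom g (mo M) (mo N) f.
Proof. exact: subVP. Qed.

Lemma ghom_linfun g (M N : mod) (f : {linear M -> N}) :
  ghom g (mo M) (mo N) f -> linfun f \in homV g M N.
Proof. by move=> [E X]; apply/mem_homV; split=> [i v|i l v gil]; rewrite !lfunE; [exact: E|exact: X]. Qed.

End HomDim.

Section BGP3.
Variables (k : fieldType) (I : finType) (adj : rel I).
Hypotheses (adj_sym : symmetric adj) (adj_irr : irreflexive adj).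
Local Notation mod := (mod k I).
Variable (j : I).
Variables (g g' : rel I).
Hypotheses (g_adj : forall i, g i j = adj i j) (g_src : forall l, g j l = false)
  (g'_adj : forall l, g' j l = adj j l) (g'_snk : forall i, g' i j = false)
  (gg' : forall i l, i != j -> l != j -> g i l = g' i l).
Local Notation rm := (rm adj j).
Local Notation rp := (rp adj j).
Local Notation rmG := (rmG adj j).
Local Notation rpG := (rpG adj j).
Local Notation rmk := (rmk adj j).
Local Notation rml := (rml adj j).
Local Notation rmf := (rmf adj j).
Local Notation rpq := (rpq adj j).
Local Notation rps := (rps adj j).
Local Notation e M i := (oe (mo M) i).
Local Notation x M := (ox (mo M)).
Local Notation nb M := (nbsum adj (mo M) j).
Local Notation psurj := (psurj adj j).
Local Notation iinj := (iinj adj j).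
Local Notation concentrated := (concentrated j).

Lemma dm_rm_neq (N : mod) i : i != j -> dm (rm N) i = dm N i.
Proof.
move=> n; apply/eqP; rewrite eqn_leq; apply/andP; split.
  apply: (@dim_sub k (rm N) N (limg (linfun (e (rm N) i))) (limg (linfun (e N i))) (gb (rmG N))) => u; rewrite !mem_limg_oe.
    by move=> /eqP {2}<-; rewrite gb_e // (negPf n).
  move=> /eqP <- h; apply: (gext (rmG N)); rewrite linear0 ?gv_e ?(negPf n) //.
apply: (@dim_sub k N (rm N) (limg (linfun (e N i))) (limg (linfun (e (rm N) i))) (ga (rmG N))) => u; rewrite !mem_limg_oe.
  by move=> /eqP {2}<-; rewrite ga_e // (negPf n).
move=> /eqP <- h; have := congr1 (gb (rmG N)) h.
by rewrite gba linear0 [X in _ - X]oe_neq 1?eq_sym // subr0.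
Qed.

(** Rank and nullity of the map from the neighbours to the space at j: its kernel is the new space,
    its image the old one by [psurj]. On dimension vectors this is the simple reflection at j. *)
Lemma dm_rm_eq (N : mod) : psurj N -> (dm (rm N) j + dm N j = \sum_(i | adj j i) dm N i)%N.
Proof.
move=> ps; rewrite -(@dim_sum_oe _ _ _ (adj j) (nb N)); last by move=> v; rewrite /nbsum mklinE.
have fl : linear (fun v => e N j (x N v)) by move=> c u v; rewrite !linearP.
pose f := linfun (mklin fl).
rewrite -(limg_ker_dim f (limg (linfun (nb N)))); congr (_ + _)%N.
  have mem v : (v \in (limg (linfun (nb N)) :&: lker f)%VS) <-> rm_pred adj j v.
    rewrite memv_cap memv_ker /f lfunE /= mklinE; split.
      move=> /andP [/memv_imgP [u _ ->] /eqP]; rewrite lfunE /=.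
      by move=> h; split; rewrite ?nb_nb.
    move=> [<- ->]; rewrite eqxx andbT -[nb N v]lfunE; apply: memv_img; exact: memvf.
  have kl : linear (fun w : rm N => rmk N (gv (rmG N) w)) by move=> c u v; rewrite !linearP.
  have ul : linear (fun v : N => gu (rmG N) (rml N v)) by move=> c u v; rewrite !linearP.
  apply/eqP; rewrite eqn_leq; apply/andP; split.
    apply: (@dim_sub _ _ _ _ _ (mklin kl)) => u.
      by move=> _; rewrite mklinE; apply/mem; exact: rmkP.
    rewrite mklinE mem_limg_oe => /eqP uE h; rewrite -uE.
    by apply: rm_ext; rewrite ?gb_e ?gv_e // eqxx ?h !linear0.
  apply: (@dim_sub k N (rm N) (limg (linfun (nb N)) :&: lker f) (limg (linfun (e (rm N) j))) (mklin ul)) => u; rewrite mklinE.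
    by rewrite mem_limg_oe gu_e // eqxx.
  move/mem => uK h; have := congr1 (fun w => rmk N (gv (rmG N) w)) h.
  by rewrite gvu rmlK // !linear0.
congr (\dim _); apply/vspaceP => v; rewrite mem_limg_oe; apply/eqP/memv_imgP.
  move=> <-; have [w ->] := ps v; exists (nb N w); last by rewrite /f lfunE /= [RHS]mklinE.
  by rewrite -[nb N w]lfunE; apply: memv_img; exact: memvf.
by move=> [u _ ->]; rewrite /f lfunE /= mklinE oee.
Qed.

Lemma rp_xnb (M : mod) w : e (rp M) j (x (rp M) (nb (rp M) w)) = gu (rpG M) (rpq M (gb (rpG M) w)).
Proof.
apply: (gext (rpG M)).
  by rewrite gb_e // eqxx gbu.
by rewrite gv_e // eqxx gv_x gb_nb // rpq_nb gvu.
Qed.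

Lemma rp_psurj (M : mod) : psurj (rp M).
Proof.
move=> w; exists (ga (rpG M) (rps M (gv (rpG M) w))).
rewrite rp_xnb gba linearB /= rpqs.
have -> : rpq M (e M j (rps M (gv (rpG M) w))) = 0.
  by rewrite -rpq_nb nb_ej // linear0.
by rewrite subr0; exact: (esym (gu_gv (rpG M) (lin0 _ _) (rpq M) (mP M) w)).
Qed.

Lemma ghom_nbx (V W : lmodType k) (M : ops I V) (N : ops I W) (f : {linear V -> W}) :
  ghom g M N f ->
  forall v, f (nbsum adj M j (ox M (oe M j v))) = nbsum adj N j (ox N (oe N j (f v))).
Proof.
move=> [fe fx] v; rewrite /nbsum !mklinE linear_sum /=.
by apply: eq_bigr => i a; rewrite fx // g_adj adj_sym.
Qed.

Lemma rmk_ej (N : mod) c : e N j (rmk N c) = 0.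
Proof. by rewrite -rmk_nb ej_nb. Qed.

Lemma rm_nbx (N : mod) w : nb (rm N) (x (rm N) (e (rm N) j w)) = ga (rmG N) (rmk N (gv (rmG N) w)).
Proof.
apply: (gext (rmG N)).
  rewrite gb_nb // gb_x gb_e // gv_e // eqxx !linear0 add0r linearB /= nb_ej // subr0.
  by rewrite rmk_nb gba rmk_ej subr0.
by rewrite gv_nb // gva.
Qed.

(** An injective map is the kernel of its cokernel. The space at j of M corresponds, through [t], to
    its image among the neighbours. *)
Lemma rm_rp (M : mod) : iinj M -> miso g M (rm (rp M)).
Proof.
move=> ii.
pose t m := ga (rpG M) (nb M (x M (e M j m))).
have tK m : rm_pred adj j (t m : rp M).
  split.
    apply: (gext (rpG M)); rewrite ?gb_nb ?gv_nb // /t ?gva //.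
    by rewrite gba linearB nb_ej // nb_nb // ej_nb // subr0.
  have -> : t m = nb (rp M) (t m).
    apply: (gext (rpG M)); rewrite ?gb_nb ?gv_nb // /t ?gva //.
    by rewrite gba linearB nb_ej // nb_nb // ej_nb // subr0.
  rewrite rp_xnb /t gba ej_nb // subr0.
  rewrite (_ : rpq M _ = 0) ?linear0 //; apply/rpq0; exists m.
  by rewrite nb_nb.
have fl : linear (fun m => ga (rmG (rp M)) (ga (rpG M) m) + gu (rmG (rp M)) (rml (rp M) (t m))).
  by move=> c u v; rewrite /t !linearP scalerDr addrACA.
have fb m : gb (rmG (rp M)) (mklin fl m) = ga (rpG M) m.
  rewrite mklinE linearD gba gbu addr0; have -> : e (rp M) j (ga (rpG M) m) = 0.
    by rewrite ga_e // eqxx.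
  by rewrite subr0.
have fk m : rmk (rp M) (gv (rmG (rp M)) (mklin fl m)) = t m.
  by rewrite mklinE linearD gva gvu add0r; exact: rmlK.
have tj m : t (e M j m) = t m by rewrite /t oee.
have tn i m : i != j -> t (e M i m) = 0 by move=> n; rewrite /t oe_neq 1?eq_sym // !linear0.
apply: (@miso_bij _ _ g M (rm (rp M)) (mklin fl)).
- split=> [i v|i l v gil].
    apply: rm_ext; rewrite ?fb ?fk !(gb_e, gv_e) //.
      case: (eqVneq i j) => [->|n]; last by rewrite fb ga_e // (negPf n).
      apply: (gext (rpG M)); rewrite ?gba ?gva ?linear0 //.
      by rewrite oee // subrr.
    case: (eqVneq i j) => [->|n]; first by rewrite fk tj.
    by rewrite linear0 tn.
  have ni : i != j by apply: contraTneq gil => ->; rewrite g_src.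
  apply: rm_ext; rewrite ?fb ?fk !(gb_exe, gv_exe) // (negPf ni) ?andFb; last first.
    by rewrite tn // linear0.
  case: (eqVneq l j) => [el|nl]; last by rewrite fb ga_exe.
  rewrite fk /t ga_e // (negPf ni) e_nb // el in gil *.
  by rewrite adj_sym -g_adj gil.
- move=> m m0; have := congr1 (fun w => gb (rpG M) (gb (rmG (rp M)) w)) m0.
  rewrite fb gba !linear0 => /eqP; rewrite subr_eq0 => /eqP ->; apply: ii.
  have := congr1 (fun w => gb (rpG M) (rmk (rp M) (gv (rmG (rp M)) w))) m0.
  by rewrite fk /t gba ej_nb // subr0 !linear0.
- move=> w; set y := rmk (rp M) (gv (rmG (rp M)) w).
  have [yn yx] := rmkP (gv (rmG (rp M)) w); rewrite -/y in yn yx.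
  have [v vE] : rp_pred adj j (gb (rpG M) y).
    apply/rpq0; have := congr1 (gv (rpG M)) yx; rewrite -{1}yn rp_xnb gvu linear0.
    by [].
  exists (gb (rpG M) (gb (rmG (rp M)) w) + e M j v).
  have wj : e (rp M) j (gb (rmG (rp M)) w) = 0 by rewrite gb_j.
  apply: rm_ext.
    rewrite fb linearD (ga_gb (rpG M) (lin0 _ _) (rpq M) (mP M)) wj subr0.
    apply: (gext (rpG M)); rewrite linearD ?gba ?gva ?addr0 //.
    by rewrite oee // subrr addr0.
  rewrite fk -/y; apply: (gext (rpG M)); rewrite /t ?gba ?gva.
    rewrite ej_nb // subr0 linearD gb_j // add0r oee // -vE.
    by rewrite -[in RHS]yn gb_nb.
  by rewrite -yn gv_nb.
Qed.

Lemma rp_indec (M : mod) : iinj M -> indec g M -> indec g' (rp M).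
Proof.
move=> ii Mi; apply: (indec_rm adj_irr g_src g'_adj gg'); first exact: rp_psurj.
exact: miso_indec (rm_rp ii) Mi.
Qed.

Lemma rp_clean (M : mod) : clean g (mo M) -> clean g' (mo (rp M)).
Proof.
move=> cM i l w ngil; apply: (gext (rpG M)); rewrite ?gb_exe ?gv_exe // linear0.
  case: (eqVneq i j) => // ni; case: (eqVneq l j) => [_|nl]; first by rewrite mklinE linear0.
  by apply: cM; rewrite gg'.
case: (eqVneq i j) => //= ei; case: (eqVneq l j) => //= nl.
by rewrite ei g'_adj in ngil; rewrite -rpq_nb nb_e // (negPf ngil) linear0.
Qed.

End BGP3.

(** * Adjunction of the two reflections *)

Section Adjunction.
Variables (k : fieldType) (I : finType) (adj : rel I).
Hypotheses (adj_sym : symmetric adj) (adj_irr : irreflexive adj).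
Local Notation mod := (mod k I).
Variable (j : I).
Variables (g g' : rel I).
Hypotheses (g_adj : forall i, g i j = adj i j) (g_src : forall l, g j l = false)
  (g'_adj : forall l, g' j l = adj j l) (g'_snk : forall i, g' i j = false)
  (gg' : forall i l, i != j -> l != j -> g i l = g' i l).
Local Notation rm := (rm adj j).
Local Notation rp := (rp adj j).
Local Notation rmG := (rmG adj j).
Local Notation rpG := (rpG adj j).
Local Notation rmk := (rmk adj j).
Local Notation rml := (rml adj j).
Local Notation rmf := (rmf adj j).
Local Notation rpq := (rpq adj j).
Local Notation rps := (rps adj j).
Local Notation e M i := (oe (mo M) i).
Local Notation x M := (ox (mo M)).
Local Notation nb M := (nbsum adj (mo M) j).
Local Notation psurj := (psurj adj j).
Local Notation iinj := (iinj adj j).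
Local Notation concentrated := (concentrated j).

(** No structure map enters j, so a morphism into the simple at j is an arbitrary functional on the
    space at j. *)
Lemma dhom_simple (M : mod) : dhom g M (simple k j) = dm M j.
Proof.
pose E := limg (linfun (e M j)); pose H : vectType k := 'Hom(subvs_of E, k^o).
have -> : dm M j = \dim {:H} by rewrite !dimvf /dim /= muln1.
have ej_sub (u : subvs_of E) : e M j (vsval u) = vsval u.
  by apply/eqP; rewrite -mem_limg_oe; exact: subvsP.
have to_lin : linear (fun f : 'Hom(M, simple k j) => linfun (f \o (vsval : {linear subvs_of E -> M})) : H).
  by move=> c f h; apply/lfunP => v; rewrite add_lfunE scale_lfunE !lfunE /= add_lfunE scale_lfunE.
have of_lin : linear (fun f : H => linfun (f \o (vsproj E \o e M j)) : 'Hom(M, simple k j)).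
  by move=> c f h; apply/lfunP => v; rewrite add_lfunE scale_lfunE !lfunE /= add_lfunE scale_lfunE.
apply/eqP; rewrite eqn_leq; apply/andP; split.
  apply: (@dim_sub k 'Hom(M, simple k j) H (homV g M (simple k j)) fullv (mklin to_lin)) => f.
    by rewrite memvf.
  move=> /mem_homV [fe _]; rewrite mklinE => /lfunP f0; apply/lfunP => v.
  have : e (simple k j) j (f v) = 0; last by rewrite simple_eE eqxx zero_lfunE.
  rewrite -fe; have vE : e M j v \in E by rewrite mem_limg_oe oee.
  by have := f0 (vsproj E (e M j v)); rewrite zero_lfunE lfunE /= vsprojK.
apply: (@dim_sub k H 'Hom(M, simple k j) fullv (homV g M (simple k j)) (mklin of_lin)) => f _.
  apply/mem_homV; rewrite mklinE; split=> [i v|i l v gil]; rewrite !lfunE /=.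
    rewrite -[RHS]/(e (simple k j) i _) simple_eE.
    case: (eqVneq i j) => [->|n]; first by rewrite oee.
    by rewrite oe_neq 1?eq_sym // !linear0.
  have ni : i != j by apply: contraTneq gil => ->; rewrite g_src.
  rewrite oe_neq 1?eq_sym // !linear0.
  by rewrite -[RHS]/(e (simple k j) i _) simple_eE (negPf ni).
rewrite mklinE => /lfunP f0; apply/lfunP => u.
by have := f0 (vsval u); rewrite !zero_lfunE lfunE /= ej_sub vsvalK.
Qed.

Section HomRmRp.
Variables (M N : mod).

Fact to_rp_lin1 (f : 'Hom(M, rm N)) : linear (fun v : rp M =>
  gb (rmG N) (f (gb (rpG M) v)) + e N j (x N (nb N (gb (rmG N) (f (rps M (gv (rpG M) v))))))).
Proof. by move=> c u v; rewrite !linearP /= scalerDr addrACA. Qed.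
Definition to_rp (f : 'Hom(M, rm N)) : 'Hom(rp M, N) := linfun (mklin (to_rp_lin1 f)).

Lemma to_rpE f v : to_rp f v = gb (rmG N) (f (gb (rpG M) v)) +
  e N j (x N (nb N (gb (rmG N) (f (rps M (gv (rpG M) v)))))).
Proof. by rewrite /to_rp lfunE mklinE. Qed.

Fact to_rp_lin : linear to_rp.
Proof.
move=> c f h; apply/lfunP => v.
rewrite !(to_rpE, add_lfunE, scale_lfunE) !linearP /=.
by rewrite scalerDr addrACA.
Qed.

Definition of_rp_t (f : 'Hom(rp M, N)) (m : M) : N := f (ga (rpG M) (nb M (x M (e M j m)))).
Fact of_rp_lin1 (f : 'Hom(rp M, N)) : linear (fun m : M =>
  ga (rmG N) (f (ga (rpG M) m)) + gu (rmG N) (rml N (of_rp_t f m))).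
Proof. by move=> c u v; rewrite /of_rp_t !linearP /= scalerDr addrACA. Qed.
Definition of_rp (f : 'Hom(rp M, N)) : 'Hom(M, rm N) := linfun (mklin (of_rp_lin1 f)).

Lemma of_rpE f m : of_rp f m = ga (rmG N) (f (ga (rpG M) m)) + gu (rmG N) (rml N (of_rp_t f m)).
Proof. by rewrite /of_rp lfunE mklinE. Qed.

Fact of_rp_lin : linear of_rp.
Proof.
move=> c f h; apply/lfunP => v.
rewrite /of_rp_t !(of_rpE, add_lfunE, scale_lfunE) /of_rp_t !(add_lfunE, scale_lfunE) !linearP /=.
by rewrite scalerDr addrACA.
Qed.

Section To.
Variables (f : 'Hom(M, rm N)) (fg : ghom g (mo M) (mo (rm N)) f).
Local Notation F m := (gb (rmG N) (f m)).
Local Notation h n := (e N j (x N (nb N n))).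

Lemma toF_e i m : i != j -> F (e M i m) = e N i (F m).
Proof. by move=> n; rewrite fg.1 gb_e // (negPf n). Qed.
Lemma toF_j m : F (e M j m) = 0.
Proof. by rewrite fg.1 gb_e // eqxx. Qed.
Lemma toF_nb m : F (nb M m) = nb N (F m).
Proof.
rewrite /nbsum !mklinE !linear_sum /=; apply: eq_bigr => i a; rewrite toF_e //.
by apply: contraTneq a => ->; rewrite adj_irr.
Qed.
Lemma toF_nbx m : F (nb M (x M (e M j m))) = rmk N (gv (rmG N) (f m)).
Proof.
rewrite (ghom_nbx adj_sym g_adj fg) rm_nbx // gba rmk_ej // subr0.
by [].
Qed.
Lemma toF_q m : h (F (rps M (rpq M m))) = h (F m).
Proof.
have [w wE] : rp_pred adj j (rps M (rpq M m) - m).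
  by apply/rpq0; rewrite linearB /= rpqs subrr.
have H u v : nb N u = nb N v + rmk N (gv (rmG N) (f w)) -> h u = h v.
  by move=> ->; rewrite !linearD /= rmk_x addr0.
apply: H; rewrite -toF_nbx -!toF_nb -wE linearB.
by rewrite !linearB /= subrKC.
Qed.

Lemma to_rp_hom : ghom g' (mo (rp M)) (mo N) (to_rp f).
Proof.
have jF m : e N j (F m) = 0 by rewrite gb_j.
have F0 : F 0 = 0 by rewrite !linear0.
split=> [i v|i l v gil]; rewrite !to_rpE.
  rewrite gb_e // gv_e //; case: (eqVneq i j) => [->|n].
    by rewrite F0 add0r linearD /= jF add0r oee.
  by rewrite toF_e // !linear0 addr0 [RHS]linearD [X in _ = _ + X]oe_neq // addr0.
have nl : l != j by apply: contraTneq gil => ->; rewrite g'_snk.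
rewrite !(gb_exe, gv_exe) // (negPf nl) andbT.
have -> : e N l (F (gb (rpG M) v) + h (F (rps M (gv (rpG M) v)))) = e N l (F (gb (rpG M) v)).
  by rewrite linearD [X in _ + X]oe_neq ?addr0.
case: (eqVneq i j) => [ei|n].
  have a : adj j l by rewrite -g'_adj -ei.
  rewrite F0 add0r toF_q ei toF_e // nb_e // a.
  by [].
rewrite !linear0 addr0.
rewrite fg.2 ?gg' //.
by rewrite gb_exe // (negPf n) (negPf nl).
Qed.

Lemma to_rp_inj : to_rp f = 0 -> f = 0.
Proof.
move=> /lfunP f0; have F0 m : F m = 0.
  have := f0 (ga (rpG M) m); rewrite to_rpE zero_lfunE gva !linear0 addr0 gba.
  by rewrite linearB linearB /= toF_j subr0.
apply/lfunP => m; rewrite zero_lfunE; apply: rm_ext; rewrite ?F0 ?linear0 //.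
by rewrite -toF_nbx F0 ?linear0.
Qed.
End To.

Section Of.
Variables (f : 'Hom(rp M, N)) (fg : ghom g' (mo (rp M)) (mo N) f).
Local Notation t := (of_rp_t f).

Lemma of_nbx (m : M) : nb (rp M) (ga (rpG M) (nb M m)) = ga (rpG M) (nb M m).
Proof.
apply: (gext (rpG M)); rewrite ?gb_nb ?gv_nb ?gva //.
by rewrite !gba linearB /= nb_nb // ej_nb // linear0.
Qed.

Lemma of_rp_tP m : rm_pred adj j (t m).
Proof.
rewrite /of_rp_t; set y := x M _; split; first by rewrite -(nb_hom adj j fg.1) of_nbx.
rewrite -of_nbx (nb_hom adj j fg.1) -(ghom_xnb g'_adj fg) rp_xnb // gba ej_nb // subr0.
rewrite (_ : rpq M _ = 0) ?linear0 //; apply/rpq0; exists m.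
by rewrite nb_nb.
Qed.

Lemma of_b m : gb (rmG N) (of_rp f m) = f (ga (rpG M) m).
Proof.
have ej0 : e (rp M) j (ga (rpG M) m) = 0 by rewrite ga_e // eqxx.
by rewrite of_rpE linearD gbu addr0 gba -fg.1 ej0 linear0 subr0.
Qed.

Lemma of_k m : rmk N (gv (rmG N) (of_rp f m)) = t m.
Proof. by rewrite of_rpE linearD gva gvu add0r; apply: rmlK; exact: of_rp_tP. Qed.

Lemma of_rp_hom : ghom g (mo M) (mo (rm N)) (of_rp f).
Proof.
have tj m : t (e M j m) = t m by rewrite /of_rp_t oee.
have tn i m : i != j -> t (e M i m) = 0.
  by move=> n; rewrite /of_rp_t oe_neq 1?eq_sym // !linear0.
have aj m : f (ga (rpG M) (e M j m)) = 0.
  rewrite (_ : ga (rpG M) _ = 0) ?linear0 //.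
  by apply: (gext (rpG M)); rewrite ?gba ?gva ?linear0 // oee // subrr.
split=> [i v|i l v gil].
  apply: rm_ext; rewrite ?of_b ?of_k !(gb_e, gv_e) //.
    case: (eqVneq i j) => [->//|n]; rewrite of_b -fg.1 ga_e //.
    by rewrite (negPf n).
  case: (eqVneq i j) => [->|n]; first by rewrite of_k tj.
  by rewrite linear0 tn.
have ni : i != j by apply: contraTneq gil => ->; rewrite g_src.
apply: rm_ext; rewrite ?of_b ?of_k !(gb_exe, gv_exe) // (negPf ni) ?andFb; last first.
  by rewrite tn // linear0.
case: (eqVneq l j) => [el|nl]; last first.
  by rewrite of_b -fg.2 -?gg' // ga_exe.
rewrite of_k /of_rp_t -fg.1 ga_e // (negPf ni) e_nb // el in gil *.
by rewrite adj_sym -g_adj gil.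
Qed.

Lemma of_rp_inj : of_rp f = 0 -> f = 0.
Proof.
move=> /lfunP f0; have F0 m : f (ga (rpG M) m) = 0.
  by rewrite -of_b f0 zero_lfunE linear0.
have E0 v : e (rp M) j v = 0 -> f v = 0.
  move=> v0; have := gdec (rpG M) v; rewrite (gu_gv (rpG M) (lin0 _ _) (rpq M) (mP M)) v0 addr0.
  by move=> <-; exact: F0.
apply/lfunP => v; rewrite zero_lfunE.
have -> : f v = f (v - e (rp M) j v) + f (e (rp M) j v) by rewrite -linearD subrK.
rewrite (E0 (v - _)) ?add0r; last by rewrite linearB oee ?subrr.
have [w ->] := rp_psurj adj_irr v.
have fn : f (nb (rp M) w) = 0 by apply: E0; rewrite ej_nb.
have E := ghom_xnb g'_adj fg w; have E2 := nb_hom adj j fg.1 w.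
by apply: etrans E _; rewrite -E2 [X in x N X]fn !linear0.
Qed.
End Of.

(** The adjunction holds for all M and N. Two injective linear maps between the spaces of morphisms
    settle the dimensions, without a proof that they are inverse to each other. *)
Lemma dhom_adj : dhom g M (rm N) = dhom g' (rp M) N.
Proof.
apply/eqP; rewrite eqn_leq; apply/andP; split.
  apply: (@dim_sub k _ _ (homV g M (rm N)) (homV g' (rp M) N) (mklin to_rp_lin)) => f /mem_homV fg.
    by rewrite mklinE; apply/mem_homV; exact: to_rp_hom.
  by rewrite mklinE; exact: to_rp_inj.
apply: (@dim_sub k _ _ (homV g' (rp M) N) (homV g M (rm N)) (mklin of_rp_lin)) => f /mem_homV fg.
  by rewrite mklinE; apply/mem_homV; exact: of_rp_hom.
by rewrite mklinE; exact: of_rp_inj.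
Qed.

End HomRmRp.
End Adjunction.

(** * Heisenberg modules *)

Section SubLmod.
Variables (k : fieldType) (V : lmodType k) (D : V -> Prop) (DP : closed_pred D).

Definition spred : {pred V} := fun v => `[< D v >].
Fact spred_closed : submod_closed spred.
Proof.
split; first by apply/asboolP; case: DP.
by move=> c u v /asboolP Du /asboolP Dv; apply/asboolP; case: DP => _; apply.
Qed.
HB.instance Definition _ := GRing.isSubmodClosed.Build k V spred spred_closed.
Definition sublmod : Type := {v : V | v \in spred}.
HB.instance Definition _ := [isSub of sublmod for @sval _ _].
HB.instance Definition _ := [Choice of sublmod by <:].
HB.instance Definition _ := [SubChoice_isSubLmodule of sublmod by <:].

(** The targets of the universal property have arbitrary dimension, and reflecting them back
    requires a kernel inside an [lmodType]. The type is hidden behind its universal property. *)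
Lemma sub_lmod : {T : lmodType k & {i : {linear T -> V} | [/\ injective i, forall t, D (i t) &
  forall (U : lmodType k) (f : {linear U -> V}), (forall u, D (f u)) ->
    exists h : {linear U -> T}, forall u, i (h u) = f u]}}.
Proof.
pose T : lmodType k := sublmod.
have il : linear (fun v : T => val v) by [].
have iE v : mklin il v = val v by rewrite mklinE.
have inj : injective (mklin il) by move=> u v; rewrite !iE; exact: val_inj.
exists T, (mklin il); split=> //.
  by move=> t; rewrite iE; apply/asboolP; exact: valP t.
move=> U f Df; pose h u : T := exist _ (f u) (asboolT (Df u)).
have hE u : mklin il (h u) = f u by rewrite iE.
have hl : linear h by move=> c u v; apply: inj; rewrite [RHS]linearP !iE /= linearP.
by exists (mklin hl) => u; rewrite [mklin hl u]mklinE hE.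
Qed.
End SubLmod.

Lemma glue_lmod (k : fieldType) (V C : lmodType k) (ej : {linear V -> V}) :
  (forall v, ej (ej v) = ej v) -> exists W : lmodType k, inhabited (glue C W ej).
Proof.
move=> ejP; have DP : closed_pred (fun v => ej v = 0).
  by split; rewrite ?linear0 // => c u v e1 e2; rewrite linearP e1 e2 scaler0 addr0.
have al : linear (fun v => v - ej v).
  by move=> c u v; rewrite !linearP /= addrACA -scalerDr.
have [T [i [inj iP lift]]] := sub_lmod DP.
have [v|a aE] := lift _ (mklin al); first by rewrite mklinE linearB /= ejP subrr.
pose W : lmodType k := (T * C)%type.
have gal : linear (fun v => (a v, 0) : W).
  by move=> c u v; apply: (f_equal2 pair); rewrite /= ?linearP // scaler0 addr0.
have gbl : linear (fun w : W => i w.1) by move=> c u v; rewrite /= linearP.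
have gul : linear (fun c : C => (0, c) : W).
  by move=> c u v; apply: (f_equal2 pair) => //=; rewrite scaler0 addr0.
have gvl : linear (fun w : W => w.2) by [].
exists W; apply: inhabits.
apply: (@Glue k V C W ej (mklin gal) (mklin gbl) (mklin gul) (mklin gvl)).
- by move=> v; rewrite !mklinE aE mklinE.
- by move=> c; rewrite !mklinE.
- by move=> c; rewrite !mklinE /= linear0.
- by move=> v; rewrite !mklinE.
- move=> [v c]; rewrite !mklinE; apply: (f_equal2 pair); last by rewrite /= add0r.
  by apply: inj; rewrite /= addr0 aE mklinE iP subr0.
Qed.

Section Lam.
Variables (k : fieldType) (I : finType) (adj : rel I).
Hypotheses (adj_sym : symmetric adj) (adj_irr : irreflexive adj).

Section Zeta.
Variables (u : I -> k) (V : lmodType k) (M : ops I V).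
Fact zeta_lin : linear (fun v => \sum_i (u i)^-1 *: oe M i (ox M (ox M (oe M i v)))).
Proof.
move=> c v w; rewrite scaler_sumr -big_split /=; apply: eq_bigr => i _.
by rewrite !linearP.
Qed.
Definition zeta := mklin zeta_lin.

(* Here x is the sum of all a and all c_{t(a)} a^*, and u_i = c_i v_i with c the
   bipartite colouring, so that zeta is the central element. *)
Definition lam : Prop := [/\ isops M, clean adj M & forall v, ox M (zeta v) = zeta (ox M v)].

Hypotheses (u0 : forall i, u i != 0) (MP : isops M).

Lemma e_zeta i v : oe M i (zeta v) = zeta (oe M i v).
Proof.
rewrite /zeta !mklinE linear_sum /= (bigD1 i) //= big1 ?addr0 => [|l n].
  rewrite [RHS](bigD1 i) //= [X in _ + X]big1 ?addr0 => [|l n].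
    by rewrite linearZ /= !oee.
  by rewrite (oe_neq MP _ n) !linear0 ?scaler0.
by rewrite linearZ /= oe_neq 1?eq_sym // scaler0.
Qed.

Lemma exxe i v : oe M i (ox M (ox M (oe M i v))) = u i *: zeta (oe M i v).
Proof.
rewrite /zeta mklinE (bigD1 i) //= big1 ?addr0 => [|l n].
  by rewrite scalerA divff // scale1r oee.
by rewrite (oe_neq MP _ n) !linear0 ?scaler0.
Qed.

Lemma zeta_intro (z : {linear V -> V}) : (forall i v, oe M i (z v) = z (oe M i v)) ->
  (forall i v, oe M i (ox M (ox M (oe M i v))) = u i *: z (oe M i v)) ->
  forall v, zeta v = z v.
Proof.
move=> ze zx v; rewrite /zeta mklinE -[in RHS](sum_oe MP v) linear_sum.
by apply: eq_bigr => i _; rewrite zx scalerA mulVf // scale1r.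
Qed.

End Zeta.

Lemma zeta_hom u (V W : lmodType k) (M : ops I V) (N : ops I W) (f : {linear V -> W}) :
  fullhom M N f -> forall v, f (zeta u M v) = zeta u N (f v).
Proof.
move=> [fe fx] v; rewrite /zeta !mklinE linear_sum; apply: eq_bigr => i _.
by rewrite linearZ /= fe !fx fe.
Qed.

Lemma zeta_clean g u (V : lmodType k) (M : ops I V) : isops M -> clean g M ->
  (forall i l, g i l -> ~~ g l i) -> forall v, zeta u M v = 0.
Proof.
move=> MP cM gas v.
rewrite /zeta mklinE big1 // => i _; rewrite (clean_x MP cM) big1 ?scaler0 // => l gil.
by rewrite [X in ox M X]cM ?linear0 //; exact: gas.
Qed.

(** A representation of the oriented graph is a Heisenberg module on which the reversed arrows act
    by zero. The central element consists of closed walks of length two, and these vanish. *)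
Lemma clean_lam g u (V : lmodType k) (M : ops I V) : isops M -> clean g M ->
  (forall i l, g i l -> adj i l) -> (forall i l, g i l -> ~~ g l i) -> lam u M.
Proof.
move=> MP cM ga gas; split=> //.
  by move=> i l v n; apply: cM; apply: contra n; exact: ga.
by move=> v; rewrite !(zeta_clean u MP cM gas) linear0.
Qed.

Section Replace.
Variables (j : I) (u u1 : I -> k) (V C W : lmodType k) (M : ops I V) (G : glue C W (oe M j)).
Variables (ka : {linear C -> V}) (q : {linear V -> C}) (zC : {linear C -> C}).
Hypotheses (u10 : forall i, u1 i != 0).
Variable (d : k).
Hypotheses (u0 : forall i, u i != 0) (ML : lam u M).
Let MP : isops M. Proof. by case: ML. Qed.
Let cM : clean adj M. Proof. by case: ML. Qed.
Let xz v : ox M (zeta u M v) = zeta u M (ox M v). Proof. by case: ML. Qed.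
Local Notation z := (zeta u M).
Local Notation nb := (nbsum adj M j).
Hypothesis u1E : forall i, i != j -> u1 i = u i + (if adj j i then d else 0).
Hypotheses (ka_nb : forall c, nb (ka c) = ka c) (q_nb : forall v, q (nb v) = q v).
Hypothesis kaq : forall v, ka (q v) = nb (ox M (oe M j (ox M (nb v)))) + d *: z (nb v).
Hypothesis qka : forall c, q (ka c) = u1 j *: zC c.
Hypothesis qz : forall v, q (z v) = zC (q v).
Hypothesis zka : forall c, z (ka c) = ka (zC c).
Local Notation R := (vr G ka q).

Lemma ejx_nb v : oe M j (ox M (nb v)) = oe M j (ox M v).
Proof.
rewrite !(clean_x MP cM j); apply: eq_bigr => l a.
by rewrite e_nb // a.
Qed.

Lemma nb_xej v : nb (ox M (oe M j v)) = ox M (oe M j v).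
Proof.
apply: (oe_ext MP) => i; rewrite e_nb //; case: ifP => // /negbT a.
by rewrite cM // adj_sym.
Qed.

Fact vr_z_lin : linear (fun w => ga G (z (gb G w)) + gu G (zC (gv G w))).
Proof. by move=> c v w; rewrite !linearP /= scalerDr addrACA. Qed.

Lemma gb_vr_z w : gb G (mklin vr_z_lin w) = z (gb G w).
Proof. by rewrite mklinE linearD /= gba gbu addr0 e_zeta // gb_j // linear0 subr0. Qed.

Lemma gv_vr_z w : gv G (mklin vr_z_lin w) = zC (gv G w).
Proof. by rewrite mklinE linearD /= gva gvu add0r. Qed.

Lemma ej_ka c : oe M j (ka c) = 0.
Proof. by rewrite -ka_nb ej_nb. Qed.

Lemma vr_clean : clean adj R.
Proof.
move=> i l w nil; apply: (gext G); rewrite ?gb_exe ?gv_exe // linear0.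
  case: (eqVneq i j) => // ni; case: (eqVneq l j) => [el|nl]; last exact: cM.
  by rewrite el in nil; rewrite -ka_nb e_nb // adj_sym (negPf nil).
case: (eqVneq i j) => //= ei; case: (eqVneq l j) => //= nl.
by rewrite ei in nil; rewrite -q_nb nb_e // (negPf nil) linear0.
Qed.

Lemma vr_exxe i w : oe R i (ox R (ox R (oe R i w))) = u1 i *: mklin vr_z_lin (oe R i w).
Proof.
case: (eqVneq i j) => [->|n]; apply: (gext G); rewrite [in RHS]linearZ_LR ?gb_vr_z ?gv_vr_z.
- by rewrite !gb_e // eqxx linear0 scaler0.
- rewrite gv_e // [in RHS]gv_e // eqxx gv_x gb_x // gb_e // eqxx linear0 add0r gv_e // eqxx.
  by rewrite ej_ka subr0 qka.
- rewrite gb_e // [in RHS]gb_e // (negPf n) gb_x // gv_x // linearB [X in _ - X]oe_neq // subr0.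
  rewrite gb_x // gv_e // (negPf n) linear0 addr0 gb_e // (negPf n).
  (* The closed walks at i through vertices other than j are the old ones. The walk through j is now
     given by [ka] after [q], which by [kaq] exceeds the old one by d z at the neighbours: this is
     the change of the weight. *)
  rewrite kaq u1E //; set v := oe M i (gb G w).
  have vi : oe M i v = v by rewrite /v oee.
  have zE : oe M i (z v) = z v by rewrite (e_zeta u MP) vi.
  have xx : oe M i (ox M (ox M v)) = u i *: z v by rewrite -[in LHS]vi (exxe u0 MP) vi.
  rewrite linearD [ox M (_ - _)]linearB [oe M i (_ - _)]linearB xx.
  have nbv : nb v = if adj j i then v else 0 by rewrite /v nb_e.
  rewrite nbv; case: ifP => a.
    by rewrite linearD linearZ_LR e_nb // a zE scalerDl addrA subrK.
  rewrite cM 1?adj_sym ?a // !linear0 ?scaler0 ?addr0.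
  by rewrite linear0 !addr0.
- rewrite gv_e // [in RHS]gv_e // (negPf n) linear0.
  by rewrite ?scaler0.
Qed.

Lemma vr_zeta w : zeta u1 R w = ga G (z (gb G w)) + gu G (zC (gv G w)).
Proof.
rewrite (zeta_intro u10 (vr_isops G ka q MP) (z := mklin vr_z_lin)) ?mklinE //; last exact: vr_exxe.
move=> i v; apply: (gext G).
  rewrite gb_e // [in RHS]gb_vr_z gb_vr_z gb_e //.
  by case: (i == j); rewrite ?linear0 // e_zeta.
rewrite gv_e // [in RHS]gv_vr_z gv_vr_z gv_e //.
by case: (i == j); rewrite ?linear0.
Qed.

Lemma gb_zeta w : gb G (zeta u1 R w) = z (gb G w).
Proof. by rewrite vr_zeta -(mklinE vr_z_lin) gb_vr_z. Qed.

Lemma gv_zeta w : gv G (zeta u1 R w) = zC (gv G w).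
Proof. by rewrite vr_zeta -(mklinE vr_z_lin) gv_vr_z. Qed.

(** One replacement principle for three uses: d = u_j builds the new module ([step_lam]), d = -u_j
    reflects a target back ([step_univ]), and d = 0 gives another module of the same weight
    ([alt_lam]). *)
Lemma vr_lam : lam u1 R.
Proof.
split; [exact: vr_isops|exact: vr_clean|move=> w].
apply: (gext G); last by rewrite gv_x // gb_zeta gv_zeta gv_x // qz.
rewrite gb_x // gb_zeta gv_zeta [RHS]gb_zeta gb_x // [RHS]linearB.
have -> : ox M (z (gb G w)) + ka (zC (gv G w)) = z (ox M (gb G w) + ka (gv G w)).
  by rewrite linearD zka xz.
by rewrite e_zeta.
Qed.

End Replace.
End Lam.

(** * The inductive step *)

Section Biproduct.
Variables (k : fieldType) (I : finType) (adj : rel I).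
Hypotheses (adj_sym : symmetric adj) (adj_irr : irreflexive adj).
Local Notation mod := (mod k I).

Definition biprod (g : rel I) (Y : mod) (T : finType) (N : T -> mod) : Prop :=
  exists (inn : forall a, {linear N a -> Y}) (out : forall a, {linear Y -> N a}),
  [/\ forall a, ghom g (mo (N a)) (mo Y) (inn a), forall a, ghom g (mo Y) (mo (N a)) (out a),
      forall a v, out a (inn a v) = v, forall a b v, a != b -> out a (inn b v) = 0
    & forall y, \sum_a inn a (out a y) = y].

(** With U the sum of the neighbour spaces and S the space at j, the hypotheses give exact sequences
    0 -> ker -> U -> S -> 0 and 0 -> S -> U -> coker -> 0. *)
Lemma rmC_rpC_dim j (Y : mod) : psurj adj j Y -> iinj adj j Y ->
  \dim {: rmC adj j Y} = \dim {: rpC adj j Y}.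
Proof.
move=> ps ij; have YP := mP Y.
pose U := subvs_of (limg (linfun (nbsum adj (mo Y) j))).
pose S := subvs_of (limg (linfun (oe (mo Y) j))).
have UP v : v \in limg (linfun (nbsum adj (mo Y) j)) <-> nbsum adj (mo Y) j v = v.
  split=> [/memv_imgP [w _ ->]|<-]; first by rewrite lfunE /= nb_nb.
  by rewrite -[nbsum _ _ _ _]lfunE memv_img ?memvf.
have UE (v : U) : nbsum adj (mo Y) j (vsval v) = vsval v by apply/UP; exact: subvsP.
have SE (v : S) : oe (mo Y) j (vsval v) = vsval v by apply/eqP; rewrite -mem_limg_oe; exact: subvsP.
have U_nb v (h : nbsum adj (mo Y) j v = v) : vsval (vsproj (limg (linfun (nbsum adj (mo Y) j))) v) = v.
  by apply: vsprojK; apply/UP.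
have S_e v : oe (mo Y) j v = v -> vsval (vsproj (limg (linfun (oe (mo Y) j))) v) = v.
  by move=> h; apply: vsprojK; rewrite mem_limg_oe h.
have f1l : linear (fun v : rmC adj j Y => vsproj _ (rmk adj j Y v) : U).
  by move=> c a b; rewrite !linearP.
have f1E v : vsval (mklin f1l v) = rmk adj j Y v by rewrite mklinE U_nb // rmk_nb.
have g1l : linear (fun v : U => vsproj _ (oe (mo Y) j (ox (mo Y) (vsval v))) : S).
  by move=> c a b; rewrite !linearP.
have g1E v : vsval (mklin g1l v) = oe (mo Y) j (ox (mo Y) (vsval v)) by rewrite mklinE S_e // oee.
have f2l : linear (fun v : S => vsproj _ (nbsum adj (mo Y) j (ox (mo Y) (vsval v))) : U).
  by move=> c a b; rewrite !linearP.
have f2E v : vsval (mklin f2l v) = nbsum adj (mo Y) j (ox (mo Y) (vsval v)).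
  by rewrite [in LHS]mklinE U_nb // nb_nb.
have g2l : linear (fun v : U => rpq adj j Y (vsval v)) by move=> c a b; rewrite !linearP.
have E1 : (\dim {: U} = \dim {: rmC adj j Y} + \dim {: S})%N.
  apply: (dim_exact (f := mklin f1l) (g := mklin g1l)).
  - by move=> v /(congr1 vsval); rewrite f1E linear0 => h; apply: (@rmk_inj _ _ adj j Y); rewrite h linear0.
  - move=> v; have [y yE] := ps (vsval v).
    exists (vsproj _ (nbsum adj (mo Y) j y)); apply: val_inj; rewrite -[LHS]/(vsval _) g1E U_nb ?nb_nb //.
    by rewrite -yE SE.
  - by move=> v; apply: val_inj; rewrite -[LHS]/(vsval _) g1E f1E rmk_x.
  move=> v /(congr1 vsval); rewrite g1E linear0 => v0.
  exists (rml adj j Y (vsval v)); apply: val_inj; rewrite -[LHS]/(vsval _) f1E rmlK //.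
have E2 : (\dim {: U} = \dim {: S} + \dim {: rpC adj j Y})%N.
  apply: (dim_exact (f := mklin f2l) (g := mklin g2l)).
  - move=> v /(congr1 vsval); rewrite f2E linear0 -[vsval v]SE => /ij.
    by rewrite SE => h; apply: val_inj.
  - move=> c; exists (vsproj _ (nbsum adj (mo Y) j (rps adj j Y c))).
    by rewrite mklinE U_nb ?nb_nb // rpq_nb rpqs.
  - move=> v; rewrite [LHS]mklinE f2E rpq_nb; apply/rpq0; exists (vsval v).
    by rewrite SE.
  move=> v; rewrite mklinE => /rpq0 [y yE].
  exists (vsproj _ (oe (mo Y) j y)); apply: val_inj; rewrite -[LHS]/(vsval _) f2E S_e ?oee //.
  by rewrite -yE UE.
by apply/eqP; rewrite -(eqn_add2r (\dim {: S})) -E1 E2 addnC.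
Qed.

Section Split.
Variables (j : I) (g g' : rel I).
Hypotheses (g_adj : forall i, g i j = adj i j) (g_src : forall l, g j l = false)
  (g'_adj : forall l, g' j l = adj j l)
  (gg' : forall i l, i != j -> l != j -> g i l = g' i l).
Variables (Y : mod) (C : vectType k).
Let YP := mP Y.
Variables (ka : {linear C -> Y}) (q : {linear Y -> C}).
Hypotheses (kaP : forall c, rm_pred adj j (ka c))
  (ka_surj : forall v, rm_pred adj j v -> exists c, ka c = v).
Variable d : nat.
Hypothesis dC : (\dim {: C} = \dim {: rmC adj j Y} + d)%N.
Variables (T : finType) (N : T -> mod).
Hypothesis Ybip : biprod g' Y N.
Let G := gG C (@oee _ _ _ _ YP j).
Definition spM : mod := Mod (vr_isops G ka q YP).
Definition spN (a : 'I_d + T) : mod :=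
  match a with inl _ => simple k j | inr b => rm adj j (N b) end.

(** For the orientation g only the map [ka] out of the new space counts, and it is onto the kernel
    used by [rm]. Splitting it leaves the reflection of Y plus d vectors killed by [ka], that is, d
    simples at j; reflecting the summands of Y does the rest. *)
Lemma split_biprod : biprod g spM spN.
Proof.
have [inn [out [ig og oi oi0 io]]] := Ybip.
have kal : linear (fun c => rml adj j Y (ka c)) by move=> c a b; rewrite !linearP.
have kaE c : rmk adj j Y (mklin kal c) = ka c by rewrite mklinE rmlK.
have [s sP] := linear_section (mklin kal).
have ks v : ka (s v) = rmk adj j Y v.
  have [c cE] := ka_surj (rmkP v).
  have <- : mklin kal c = v by apply: (@rmk_inj _ _ adj j Y); rewrite kaE.
  by rewrite -[in LHS]kaE sP.
pose K := lker (linfun (mklin kal)).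
have KP c : c \in K <-> ka c = 0.
  rewrite memv_ker lfunE; split=> [/eqP h|h].
    by rewrite -kaE h linear0.
  by apply/eqP/(@rmk_inj _ _ adj j Y); rewrite kaE h linear0.
have dK : \dim K = d.
  have := limg_ker_dim (linfun (mklin kal)) fullv; rewrite capfv.
  have -> : \dim (limg (linfun (mklin kal))) = \dim {: rmC adj j Y}.
    congr (\dim _); apply/vspaceP => v; rewrite memvf -[v](_ : mklin kal (s v) = _).
      by rewrite -[mklin kal _]lfunE memv_img ?memvf.
    by apply: (@rmk_inj _ _ adj j Y); rewrite kaE ks.
  by rewrite dC addnC => /addnI.
pose xi i := (vbasis K)`_i.
have xiK i : (i < d)%N -> ka (xi i) = 0.
  by move=> id; apply/KP/vbasis_mem/mem_nth; rewrite size_tuple dK.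
have rhol : linear (fun c => c - s (mklin kal c)).
  by move=> a b c; rewrite !linearP addrACA -scalerDr.
have rhoK c : c - s (mklin kal c) \in K.
  by apply/KP; rewrite linearB ks kaE subrr.
have il (i : 'I_d) : linear (fun c : simple k j => gu G ((c : k) *: xi i)).
  by move=> a b c; rewrite -linearP; congr (gu G _); rewrite scalerA -scalerDl.
have ol (i : 'I_d) : linear (fun y : spM => coord (vbasis K) (cast_ord (esym dK) i) (gv G y - s (mklin kal (gv G y))) : simple k j).
  by move=> a b c; rewrite !linearP addrACA -scalerDr linearP.
have thl : linear (fun v : rm adj j Y => ga G (gb (rmG adj j Y) v) + gu G (s (gv (rmG adj j Y) v))).
  by move=> a b c; rewrite !linearP addrACA -scalerDr.
have th'l : linear (fun y : spM => ga (rmG adj j Y) (gb G y) + gu (rmG adj j Y) (mklin kal (gv G y))).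
  by move=> a b c; rewrite !linearP addrACA -scalerDr.
have thb v : gb G (mklin thl v) = gb (rmG adj j Y) v.
  by rewrite mklinE linearD gba gbu addr0 gb_j // subr0.
have thv v : gv G (mklin thl v) = s (gv (rmG adj j Y) v).
  by rewrite mklinE linearD gva gvu add0r.
have th'b v : gb (rmG adj j Y) (mklin th'l v) = gb G v.
  by rewrite [in LHS]mklinE linearD gba gbu addr0 gb_j // subr0.
have th'v v : gv (rmG adj j Y) (mklin th'l v) = mklin kal (gv G v).
  by rewrite [in LHS]mklinE linearD gva gvu add0r.
have rme i (v : rm adj j Y) : gb (rmG adj j Y) (oe (mo (rm adj j Y)) i v) = if i == j then 0 else oe (mo Y) i (gb (rmG adj j Y) v).
  exact: gb_e.
have rmv i (v : rm adj j Y) : gv (rmG adj j Y) (oe (mo (rm adj j Y)) i v) = if i == j then gv (rmG adj j Y) v else 0.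
  exact: gv_e.
have spe i (v : spM) : gb G (oe (mo spM) i v) = if i == j then 0 else oe (mo Y) i (gb G v).
  exact: gb_e.
have spv i (v : spM) : gv G (oe (mo spM) i v) = if i == j then gv G v else 0.
  exact: gv_e.
have spb i l (v : spM) : gb G (oe (mo spM) i (ox (mo spM) (oe (mo spM) l v))) =
  if i == j then 0 else if l == j then oe (mo Y) i (ka (gv G v)) else oe (mo Y) i (ox (mo Y) (oe (mo Y) l (gb G v))).
  exact: gb_exe.
have spx i l (v : spM) : gv G (oe (mo spM) i (ox (mo spM) (oe (mo spM) l v))) = if (i == j) && (l != j) then q (oe (mo Y) l (gb G v)) else 0.
  exact: gv_exe.
have rmb i l (v : rm adj j Y) : gb (rmG adj j Y) (oe (mo (rm adj j Y)) i (ox (mo (rm adj j Y)) (oe (mo (rm adj j Y)) l v))) =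
  if i == j then 0 else if l == j then oe (mo Y) i (rmk adj j Y (gv (rmG adj j Y) v)) else oe (mo Y) i (ox (mo Y) (oe (mo Y) l (gb (rmG adj j Y) v))).
  exact: gb_exe.
have rmx i l (v : rm adj j Y) : gv (rmG adj j Y) (oe (mo (rm adj j Y)) i (ox (mo (rm adj j Y)) (oe (mo (rm adj j Y)) l v))) = 0.
  by rewrite (gv_exe (rmG adj j Y) (rmk adj j Y) (lin0 _ _)) // /lin0 mklinE; case: ifP.
have nij i l : g i l -> i != j by move=> gil; apply: contraTneq gil => ->; rewrite g_src.
have thg : ghom g (mo (rm adj j Y)) (mo spM) (mklin thl).
  split=> [i v|i l v gil]; apply: (gext G).
  - by rewrite thb spe rme thb.
  - by rewrite thv spv rmv thv; case: ifP; rewrite ?linear0.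
  - by rewrite thb spb rmb thb thv ks.
  - by rewrite thv spx rmx linear0 (negPf (nij _ _ gil)).
have th'g : ghom g (mo spM) (mo (rm adj j Y)) (mklin th'l).
  split=> [i v|i l v gil]; apply: (gext (rmG adj j Y)).
  - by rewrite th'b spe rme th'b.
  - by rewrite th'v spv rmv th'v; case: ifP; rewrite ?linear0.
  - by rewrite th'b spb rmb th'b th'v kaE.
  - by rewrite th'v spx rmx (negPf (nij _ _ gil)) linear0.
have th'th v : mklin th'l (mklin thl v) = v.
  apply: rm_ext; first by rewrite th'b thb.
  by rewrite th'v thv kaE ks.
pose inn' (a : 'I_d + T) : {linear spN a -> spM} :=
  match a with inl i => mklin (il i) | inr b => mklin thl \o rmf adj j (inn b) end.
pose out' (a : 'I_d + T) : {linear spM -> spN a} :=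
  match a with inl i => mklin (ol i) | inr b => rmf adj j (out b) \o mklin th'l end.
have rig b := rmf_hom g_src g'_adj gg' (ig b).
have rog b := rmf_hom g_src g'_adj gg' (og b).
have ilb i v : gb G (mklin (il i) v) = 0 by rewrite mklinE gbu.
have ilv i v : gv G (mklin (il i) v) = (v : k) *: xi i by rewrite mklinE gvu.
have th'i i v : mklin th'l (mklin (il i) v) = 0.
  apply: rm_ext; rewrite ?th'b ?th'v ?ilb ?ilv ?linear0 // kaE.
  by rewrite linearZ_LR xiK ?scaler0.
have kxi (i : 'I_d) : mklin kal (xi i) = 0 by apply: (@rmk_inj _ _ adj j Y); rewrite kaE xiK // linear0.
have olE i y : mklin (ol i) y = coord (vbasis K) (cast_ord (esym dK) i) (gv G y - s (mklin kal (gv G y))).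
  exact: (mklinE (ol i)).
have cxi (i i' : 'I_d) : coord (vbasis K) (cast_ord (esym dK) i) (xi i') = (i == i')%:R.
  by rewrite -(inj_eq (@cast_ord_inj _ _ (esym dK))) eq_sym -(coord_free _ _ (basis_free (vbasisP K))).
exists inn', out'; split.
- case=> [i|b] /=; last exact: (ghom_comp (rig b) thg).
  split=> [i' v|i' l v gil]; apply: (gext G).
  + by rewrite ilb spe ilb linear0; case: ifP.
  + rewrite ilv spv ilv simple_eE; case: ifP => // _.
    by rewrite scale0r.
  + rewrite ilb spb ilb ilv !linear0 linearZ_LR xiK // scaler0 linear0.
    by case: ifP => //; case: ifP.
  + rewrite simple_eE simple_xE ilv spx (negPf (nij _ _ gil)).
    by rewrite scale0r.
- case=> [i|b] /=; last exact: (ghom_comp th'g (rog b)).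
  split=> [i' v|i' l v gil].
  + rewrite olE spv simple_eE; case: ifP => _; first by rewrite olE.
    by rewrite !linear0 ?addr0 ?linear0.
  + rewrite olE spx (negPf (nij _ _ gil)) !linear0 ?addr0 ?linear0.
    by rewrite simple_eE (negPf (nij _ _ gil)).
- case=> [i|b] v.
    rewrite [LHS]olE ilv linearZ_LR kxi scaler0 linear0 subr0 linearZ_LR.
    by change ((v : k) * coord (vbasis K) (cast_ord (esym dK) i) (xi i) = v); rewrite cxi eqxx mulr1.
  rewrite -[LHS]/(rmf adj j (out b) (mklin th'l (mklin thl (rmf adj j (inn b) v)))) th'th.
  have E w : idfun w = out b (inn b w) by rewrite oi.
  rewrite -(rmf_comp g'_adj (ig b) (og b) (ghom_id _ _) E).
  exact: (rmf_id g'_adj (ghom_id g' _)).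
- case=> [i|b] [i'|b'] v ab.
  + rewrite [LHS]olE ilv linearZ_LR kxi scaler0 linear0 subr0 linearZ_LR.
    change ((v : k) * coord (vbasis K) (cast_ord (esym dK) i) (xi i') = 0).
    by rewrite cxi (_ : (_ == _) = false) ?mulr0 //; apply: contraNF ab => /eqP ->.
  + rewrite -[LHS]/(mklin (ol i) (mklin thl (rmf adj j (inn b') v))) olE thv.
    have -> : mklin kal (s (gv (rmG adj j Y) (rmf adj j (inn b') v))) = gv (rmG adj j Y) (rmf adj j (inn b') v).
      by apply: (@rmk_inj _ _ adj j Y); rewrite kaE ks.
    by rewrite subrr linear0.
  + by rewrite -[LHS]/(rmf adj j (out b) (mklin th'l (mklin (il i') v))) th'i linear0.
  + rewrite -[LHS]/(rmf adj j (out b) (mklin th'l (mklin thl (rmf adj j (inn b') v)))) th'th.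
    have n : b != b' by apply: contraNneq ab => ->.
    apply: rm_ext.
      by rewrite (rmf_b (og b)) (rmf_b (ig b')) oi0 // linear0.
    by rewrite (rmf_k g'_adj (og b)) (rmf_k g'_adj (ig b')) oi0 // !linear0.
move=> y; rewrite big_sumType /=.
have sumT w : \sum_b rmf adj j (inn b) (rmf adj j (out b) w) = w.
  apply: rm_ext; rewrite !linear_sum.
    rewrite -[RHS]io; apply: eq_bigr => b _; by rewrite (rmf_b (ig b)) (rmf_b (og b)).
  rewrite -[RHS]io; apply: eq_bigr => b _.
  by rewrite (rmf_k g'_adj (ig b)) (rmf_k g'_adj (og b)).
have -> : \sum_b mklin thl (rmf adj j (inn b) (rmf adj j (out b) (mklin th'l y))) = mklin thl (mklin th'l y).
  by rewrite -linear_sum sumT.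
apply: (gext G); rewrite linearD linear_sum.
  by rewrite big1 => [|i _]; rewrite ?ilb // add0r thb th'b.
rewrite thv th'v -[RHS](subrK (s (mklin kal (gv G y)))); congr (_ + _).
rewrite [RHS](coord_vbasis (rhoK (gv G y))).
rewrite (reindex (cast_ord (esym dK))) /=; last first.
  by exists (cast_ord dK) => i _; rewrite (cast_ordK, cast_ordKV).
by apply: eq_bigr => i _; rewrite ilv olE.
Qed.

End Split.
End Biproduct.

(** The dot product of coordinates in a basis of S, after projecting to S. In [step_form] it
    supplies the part of the new form that nothing else determines. *)
Lemma subspace_form (k : fieldType) (V : vectType k) (S : {vspace V}) :
  exists b : V -> V -> k, [/\ forall v, linear_for *%R (b v), forall v w, b v w = b w v &
    forall v, v \in S -> (forall w, w \in S -> b v w = 0) -> v = 0].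
Proof.
pose c i v := coord (vbasis S) i (projv S v).
exists (fun v w => \sum_i c i v * c i w); split=> [v a w w'|v w|v vS h].
- rewrite mulr_sumr -big_split /=; apply: eq_bigr => i _.
  by rewrite /c !linearP /= mulrDr mulrCA.
- by apply: eq_bigr => i _; rewrite mulrC.
rewrite (coord_vbasis vS) big1 // => i _.
have iS : (vbasis S)`_i \in S by apply: vbasis_mem; apply: mem_nth; rewrite size_tuple.
have := h _ iS; rewrite (bigD1 i) //= big1 ?addr0 => [|l n].
  rewrite /c !projv_id // coord_free ?eqxx ?mulr1 => [-> //|]; first by rewrite scale0r.
  exact: basis_free (vbasisP S).
by rewrite /c (projv_id iS) coord_free 1?eq_sym ?(negPf n) ?mulr0 //; exact: basis_free (vbasisP S).
Qed.

(** * Induced Heisenberg modules with an invariant form *)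

Section Free.
Variables (k : fieldType) (I : finType) (adj : rel I).
Local Notation mod := (mod k I).

(* eta exhibits Y as the Heisenberg module induced from M. *)
Definition univ (u : I -> k) (g : rel I) (M Y : mod) (eta : M -> Y) : Prop :=
  forall (Z : lmodType k) (L : ops I Z), lam adj u L ->
  forall f : {linear M -> Z}, ghom g (mo M) L f ->
  exists F : {linear Y -> Z}, fullhom (mo Y) L F /\ forall m, F (eta m) = f m.

(** Generation by [eta] takes the place of uniqueness in the universal property. *)
Definition gen (M Y : mod) (eta : M -> Y) : Prop :=
  forall D : Y -> Prop, closed_pred D -> (forall i v, D v -> D (oe (mo Y) i v)) ->
  (forall v, D v -> D (ox (mo Y) v)) -> (forall m, D (eta m)) -> forall v, D v.

(** Selfadjointness of x and of the projections says that the form is invariant under the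
    anti-automorphism exchanging an arrow a with [c_{t(a)}] times its reverse. *)
Definition form (Y : mod) : Prop :=
  exists B : Y -> Y -> k,
  [/\ forall v, linear_for *%R (B v), forall v w, B v w = B w v,
      forall v w, B (ox (mo Y) v) w = B v (ox (mo Y) w),
      forall i v w, B (oe (mo Y) i v) w = B v (oe (mo Y) i w)
    & forall v, (forall w, B v w = 0) -> v = 0].

Definition good (u : I -> k) (g : rel I) (M Y : mod) (eta : {linear M -> Y}) : Prop :=
  [/\ lam adj u (mo Y), ghom g (mo M) (mo Y) eta, univ u g eta, gen eta & form Y].
End Free.

(** * One reflection of an induced module *)

Section Step.
Variables (k : fieldType) (I : finType) (adj : rel I).
Hypotheses (adj_sym : symmetric adj) (adj_irr : irreflexive adj).
Local Notation mod := (mod k I).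
Variable (j : I).
Variables (g g' : rel I).
Hypotheses (g_adj : forall i, g i j = adj i j) (g_src : forall l, g j l = false)
  (g'_adj : forall l, g' j l = adj j l) (g'_snk : forall i, g' i j = false)
  (gg' : forall i l, i != j -> l != j -> g i l = g' i l)
  (g'_sub : forall i l, g' i l -> adj i l) (g'_asym : forall i l, g' i l -> ~~ g' l i).
Local Notation rm := (rm adj j).
Local Notation rp := (rp adj j).
Local Notation rmG := (rmG adj j).
Local Notation rpG := (rpG adj j).
Local Notation rmk := (rmk adj j).
Local Notation rml := (rml adj j).
Local Notation rpq := (rpq adj j).
Local Notation rps := (rps adj j).
Local Notation e M i := (oe (mo M) i).
Local Notation x M := (ox (mo M)).
Local Notation nb M := (nbsum adj (mo M) j).

Variables (u w : I -> k).
Hypotheses (u0 : forall i, u i != 0) (w0 : forall i, w i != 0).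
Hypothesis wE : forall i, w i = if i == j then - u j else u i - (if adj j i then u j else 0).

Variable (M : mod).
Hypothesis cM : clean g (mo M).
Variables (Y : mod) (eta : {linear rp M -> Y}).
Hypotheses (YL : lam adj w (mo Y)) (etag : ghom g' (mo (rp M)) (mo Y) eta).
Hypotheses (Yuniv : univ adj w g' eta) (Ygen : gen eta) (Yform : form Y).

Local Notation z := (zeta w (mo Y)).
Let YP := mP Y.
Let cY : clean adj (mo Y). Proof. by case: YL. Qed.
Lemma Y_x_zeta v : x Y (z v) = z (x Y v). Proof. by case: YL. Qed.
Lemma Y_nb_zeta v : z (nb Y v) = nb Y (z v).
Proof. by apply: (@nb_hom _ _ adj _ _ (mo Y) (mo Y) j z) => i y; rewrite e_zeta. Qed.
Lemma Y_jxxj v : e Y j (x Y (x Y (e Y j v))) = - (u j *: z (e Y j v)).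
Proof. by rewrite (exxe w0 YP) wE eqxx scaleNr. Qed.
Lemma Y_jx_nb v : e Y j (x Y (nb Y v)) = e Y j (x Y v).
Proof. by rewrite (ejx_nb j YL). Qed.
Lemma Y_nb_xj v : nb Y (x Y (e Y j v)) = x Y (e Y j v).
Proof. by rewrite (nb_xej adj_sym j YL). Qed.

(** On the neighbour space [phi] and [phi'] compose to zero in both orders and differ by u_j z: up
    to this factor, [phi] and the negative of [phi'] are complementary idempotents. [phi'] factors
    through the old space at j, [phi] will factor through the new one. *)
Fact phi'_lin : linear (fun v => nb Y (x Y (e Y j (x Y (nb Y v))))).
Proof. by move=> c a b; rewrite !linearP. Qed.
Definition phi' := mklin phi'_lin.
Fact phi_lin : linear (fun v => phi' v + u j *: z (nb Y v)).
Proof.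
by move=> c a b; rewrite !linearP /= addrACA -scalerDr.
Qed.
Definition phi := mklin phi_lin.

Lemma phi'E v : phi' v = nb Y (x Y (e Y j (x Y (nb Y v)))).
Proof. by rewrite /phi' mklinE. Qed.
Lemma phiE v : phi v = phi' v + u j *: z (nb Y v).
Proof. by rewrite /phi mklinE. Qed.
Lemma phi'_nb v : phi' (nb Y v) = phi' v.
Proof. by rewrite !phi'E nb_nb. Qed.
Lemma nb_phi' v : nb Y (phi' v) = phi' v.
Proof. by rewrite !phi'E nb_nb. Qed.
Lemma phi_nb v : phi (nb Y v) = phi v.
Proof. by rewrite !phiE phi'_nb nb_nb. Qed.
Lemma nb_phi v : nb Y (phi v) = phi v.
Proof. by rewrite !phiE linearD linearZ_LR nb_phi' -Y_nb_zeta nb_nb. Qed.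
Lemma phi'_z v : phi' (z v) = z (phi' v).
Proof. by rewrite !phi'E -Y_nb_zeta Y_x_zeta (e_zeta w YP) Y_x_zeta -Y_nb_zeta. Qed.
Lemma phi_z v : phi (z v) = z (phi v).
Proof. by rewrite !phiE phi'_z -!Y_nb_zeta linearD linearZ_LR. Qed.

(* phi' factors through e_j, where the composite in the other order is w_j z = - u_j z. *)
Lemma phi'_xj v : phi' (x Y (e Y j v)) = - (u j *: z (x Y (e Y j v))).
Proof.
by rewrite phi'E !Y_nb_xj Y_jxxj linearN linearZ_LR Y_x_zeta.
Qed.

Lemma phi_xj v : phi (x Y (e Y j v)) = 0.
Proof. by rewrite phiE phi'_xj Y_nb_xj addNr. Qed.

Lemma phi'_phi' v : phi' (phi' v) = - (u j *: z (phi' v)).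
Proof. by rewrite [phi' v]phi'E Y_nb_xj phi'_xj. Qed.
Lemma phi_phi' v : phi (phi' v) = 0.
Proof. by rewrite [phi' v]phi'E Y_nb_xj phi_xj. Qed.
Lemma phi'_phi v : phi' (phi v) = 0.
Proof.
by rewrite phiE linearD linearZ_LR phi'_phi' phi'_z phi'_nb addNr.
Qed.
Lemma phi_phi v : phi (phi v) = u j *: z (phi v).
Proof. by rewrite [phi v]phiE linearD phi_phi' add0r linearZ_LR phi_z phi_nb -phiE. Qed.
Lemma jx_phi v : e Y j (x Y (phi v)) = 0.
Proof.
rewrite phiE linearD linearD linearZ_LR linearZ_LR phi'E Y_nb_xj Y_jxxj.
by rewrite Y_x_zeta (e_zeta w YP) addNr.
Qed.

(** The image in Y of the neighbour vector to which the arrows leaving j send m. That vector is zero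
    in the cokernel, so the maps of Y into j kill its image ([jx_t]), and [phi] acts on it as u_j z
    ([phi_t]). *)
Definition eta_x (m : M) : Y := eta (ga (rpG M) (nb M (x M (e M j m)))).
Fact t_lin : linear eta_x. Proof. by move=> c a b; rewrite /eta_x !linearP. Qed.

Lemma rp_nb_ga m : nb (rp M) (ga (rpG M) (nb M m)) = ga (rpG M) (nb M m).
Proof. exact: of_nbx. Qed.

Lemma t_nb m : nb Y (eta_x m) = eta_x m.
Proof. by rewrite /eta_x -(nb_hom adj j etag.1) rp_nb_ga. Qed.

Lemma jx_eta m : e Y j (x Y (eta (ga (rpG M) (nb M m)))) = eta (gu (rpG M) (rpq M m)).
Proof.
rewrite -rp_nb_ga (nb_hom adj j etag.1) -(ghom_xnb g'_adj etag) rp_xnb //.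
by rewrite gba ej_nb // subr0 rpq_nb.
Qed.

Lemma jx_t m : e Y j (x Y (eta_x m)) = 0.
Proof.
rewrite /eta_x jx_eta (_ : rpq M _ = 0) ?linear0 //; apply/rpq0; exists m.
by [].
Qed.

Lemma phi'_t m : phi' (eta_x m) = 0.
Proof. by rewrite phi'E t_nb jx_t !linear0. Qed.

Lemma phi_t m : phi (eta_x m) = u j *: z (eta_x m).
Proof. by rewrite phiE phi'_t add0r t_nb. Qed.

Lemma t_ej m : eta_x (e M j m) = eta_x m.
Proof. by rewrite /eta_x oee. Qed.

Lemma rps_diff v : exists y, nb Y (rps Y (rpq Y v)) = nb Y v + x Y (e Y j y).
Proof.
have [y yE] : rp_pred adj j (rps Y (rpq Y v) - v) by apply/rpq0; rewrite linearB rpqs subrr.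
by exists y; rewrite -Y_nb_xj -yE linearB subrKC.
Qed.

Lemma phi_rps v : phi (rps Y (rpq Y v)) = phi v.
Proof. by have [y yE] := rps_diff v; rewrite -phi_nb yE linearD phi_xj addr0 phi_nb. Qed.

Lemma rpq_xj v : rpq Y (x Y (e Y j v)) = 0.
Proof. by apply/rpq0; exists v. Qed.

(** The vectors whose component at j is reached from the neighbours are stable under all operations,
    and they contain the image of [eta] since [rp M] has the property. *)
Lemma Y_psurj : psurj adj j Y.
Proof.
apply: Ygen.
- split; first by exists 0; rewrite !linear0.
  by move=> c a b [a' aE] [b' bE]; exists (c *: a' + b'); rewrite !linearP aE bE.
- move=> i v [v' E]; case: (eqVneq i j) => [->|n]; first by exists v'; rewrite oee.
  by exists 0; rewrite oe_neq 1?eq_sym // !linear0.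
- by move=> v _; exists v; rewrite Y_jx_nb.
- move=> m; have [m' mE] := rp_psurj adj_irr m.
  exists (eta m'); rewrite -etag.1 mE (ghom_xnb g'_adj etag).
  by [].
Qed.

Section Form.
Variable B : Y -> Y -> k.
Hypotheses (Bl : forall v, linear_for *%R (B v)) (Bs : forall v w, B v w = B w v)
  (Bx : forall v w, B (x Y v) w = B v (x Y w))
  (Be : forall i v w, B (e Y i v) w = B v (e Y i w))
  (Bn : forall v, (forall w, B v w = 0) -> v = 0).

Lemma form_addr v a b : B v (a + b) = B v a + B v b.
Proof. by have := Bl v 1 a b; rewrite scale1r mul1r. Qed.
Lemma form_0r v : B v 0 = 0.
Proof. by have := form_addr v 0 0; rewrite addr0 => /eqP; rewrite -subr_eq0 opprD addNKr oppr_eq0 => /eqP. Qed.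
Lemma form_scaler v c a : B v (c *: a) = c * B v a.
Proof. by have := Bl v c a 0; rewrite !addr0 form_0r addr0. Qed.
Lemma form_addl v a b : B (a + b) v = B a v + B b v.
Proof. by rewrite Bs form_addr !(Bs v). Qed.
Lemma form_0l v : B 0 v = 0. Proof. by rewrite Bs form_0r. Qed.
Lemma form_scalel v c a : B (c *: a) v = c * B a v.
Proof. by rewrite Bs form_scaler Bs. Qed.
Lemma form_sumr (P : pred I) (F : I -> Y) v : B v (\sum_(i | P i) F i) = \sum_(i | P i) B v (F i).
Proof. by apply: (big_morph (B v)) => [a b|]; [exact: form_addr|exact: form_0r]. Qed.
Lemma form_nb v y : B (nb Y v) y = B v (nb Y y).
Proof. by rewrite /nbsum !mklinE Bs !form_sumr; apply: eq_bigr => i _; rewrite Bs Be. Qed.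
Lemma form_zeta v y : B (z v) y = B v (z y).
Proof.
rewrite /zeta !mklinE Bs (big_morph (B y) (form_addr y) (form_0r y)) (big_morph (B v) (form_addr v) (form_0r v)).
by apply: eq_bigr => i _; rewrite !form_scaler Bs Be Bx Bx Be.
Qed.
Lemma form_phi v y : B (phi v) y = B v (phi y).
Proof. by rewrite !phiE form_addl form_addr form_scalel form_scaler !phi'E form_nb Bx Be Bx form_nb form_zeta form_nb Y_nb_zeta. Qed.

Lemma form_iinj : iinj adj j Y.
Proof.
move=> v v0; apply: Bn => y; have [y' yE] := Y_psurj y.
by rewrite -(oee YP) Be yE Be oee // -Be -Bx -form_nb v0 form_0l.
Qed.

(** The maps into and out of j are adjoint, so the orthogonal complement of the kernel of the former
    is the image of the latter. The preimage y is obtained by representing the functional B v (nb (s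
    -)), with [s] a generalized inverse of the map into j. *)
Lemma form_perp v : (forall y, nb Y y = y -> e Y j (x Y y) = 0 -> B v y = 0) -> rpq Y v = 0.
Proof.
move=> h; have hl : linear (fun v => e Y j (x Y (nb Y v))) by move=> c a b; rewrite !linearP.
have [s sP] := linear_section (mklin hl).
have {}sP y : e Y j (x Y (nb Y (s (e Y j (x Y (nb Y y)))))) = e Y j (x Y (nb Y y)).
  by have := sP y; rewrite !mklinE.
have fl : linear (fun y => B v (nb Y (s y)) : k^o).
  by move=> c a b; rewrite !linearP form_addr form_scaler.
have [y yP] := form_repr Bl (fun w => ltac:(by move=> c a b; rewrite form_addl form_scalel)) Bn (mklin fl).
apply/rpq0; exists y; apply/eqP; rewrite -subr_eq0; apply/eqP; apply: Bn => y'.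
rewrite -[_ - _]/(_ + - _) -scaleN1r form_addl form_scalel form_nb form_nb Bx Be yP [mklin fl _]mklinE -form_scaler -form_addr scaleN1r -linearB.
by apply: h; rewrite ?nb_nb // !linearB sP subrr.
Qed.
End Form.

Lemma Y_iinj : iinj adj j Y.
Proof. by have [B [Bl Bs Bx Be Bn]] := Yform; exact: (form_iinj Bl Bs Bx Be Bn). Qed.

(** [rp M] with zero reversed arrows is itself a Heisenberg module, so [eta] has a retraction. *)
Lemma proj_M : exists p : {linear Y -> rp M},
  fullhom (mo Y) (mo (rp M)) p /\ forall m, p (eta m) = m.
Proof.
have cR : clean g' (mo (rp M)) by exact: (rp_clean g'_adj gg' cM).
have RL := clean_lam w (mP (rp M)) cR g'_sub g'_asym.
exact: (Yuniv RL (f := idfun) (ghom_id _ _)).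
Qed.

(** The retraction onto [rp M] kills z, and everything coming out of the sink j; hence it kills
    [phi], while it recovers from [eta_x m] the neighbour vector in M. *)
Lemma phi_t_inj v m : phi v + eta_x m = 0 -> nb M (x M (e M j m)) = 0.
Proof.
have [p [pf pe]] := proj_M; have cR : clean g' (mo (rp M)) by exact: (rp_clean g'_adj gg' cM).
have pnb y : p (nb Y y) = nb (rp M) (p y) by exact: (nb_hom adj j pf.1).
have p0 y : p (x Y (e Y j y)) = 0.
  rewrite pf.2 pf.1; apply: (oe_ext (mP (rp M))) => i; rewrite linear0.
  by apply: cR; rewrite g'_snk.
move/(congr1 p); rewrite linear0 linearD phiE linearD phi'E pnb p0 linear0 add0r.
rewrite linearZ_LR (zeta_hom w pf) (zeta_clean w (mP (rp M)) cR g'_asym) scaler0 add0r /eta_x pe.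
move/(congr1 (gb (rpG M))); rewrite gba ej_nb // subr0 linear0.
by [].
Qed.

Section Kernel.
(* The quotient of nb Y by the images of phi and eta_x, with phi' as outgoing map, is
   a second vertex space that makes a Heisenberg module with the same weights out of
   Y; comparing both by the universal property of Y gives ker_im. *)
Definition Jpred v := exists y m, nb Y v = phi y + eta_x m.
Lemma J_closed : closed_pred Jpred.
Proof.
split; first by exists 0, 0; rewrite -(mklinE t_lin) !linear0 addr0.
move=> c a b [y [m E]] [y' [m' E']]; exists (c *: y + y'), (c *: m + m').
by rewrite linearP E E' -!(mklinE t_lin) !linearP /= scalerDr addrACA.
Qed.
Local Notation altC := (quot (subV J_closed)).
Local Notation altq := (qmap (subV J_closed)).
Local Notation alts := (qsec (subV J_closed)).

Lemma altq0 v : altq v = 0 <-> Jpred v.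
Proof. by rewrite qmap_eq0; exact: subVP. Qed.
Lemma altq_nb v : altq (nb Y v) = altq v.
Proof.
apply/eqP; rewrite -subr_eq0 -linearB; apply/eqP/altq0; exists 0, 0.
by rewrite linearB nb_nb // subrr -(mklinE t_lin) !linear0 addr0.
Qed.
Lemma altq_phi v : altq (phi v) = 0.
Proof. by apply/altq0; exists v, 0; rewrite nb_phi -(mklinE t_lin) linear0 addr0. Qed.
Lemma altq_eta_x m : altq (eta_x m) = 0.
Proof. by apply/altq0; exists 0, m; rewrite t_nb linear0 add0r. Qed.
Lemma alts_diff v : Jpred (alts (altq v) - v).
Proof. by apply/altq0; rewrite linearB qsecK subrr. Qed.
Lemma phi'_J v : Jpred v -> phi' v = 0.
Proof. by move=> [y [m E]]; rewrite -phi'_nb E linearD phi'_phi phi'_t addr0. Qed.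
Lemma jx_J v : Jpred v -> e Y j (x Y v) = 0.
Proof. by move=> [y [m E]]; rewrite -Y_jx_nb E linearD linearD jx_phi jx_t addr0. Qed.
Lemma phi'_alts v : phi' (alts (altq v)) = phi' v.
Proof. by apply/eqP; rewrite -subr_eq0 -linearB phi'_J //; exact: alts_diff. Qed.
Lemma jx_alts v : e Y j (x Y (alts (altq v))) = e Y j (x Y v).
Proof. by apply/eqP; rewrite -subr_eq0 -!linearB jx_J //; exact: alts_diff. Qed.
Lemma altq_z_eta_x m : altq (z (eta_x m)) = 0.
Proof.
have -> : z (eta_x m) = (u j)^-1 *: phi (eta_x m) by rewrite phi_t scalerA mulVf // scale1r.
by rewrite linearZ_LR altq_phi scaler0.
Qed.
Lemma altq_zJ v : Jpred v -> altq (z v) = 0.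
Proof.
move=> [y [m E]]; rewrite -altq_nb -Y_nb_zeta E linearD linearD.
by rewrite altq_z_eta_x -phi_z altq_phi addr0.
Qed.
Lemma altq_zs v : altq (z (alts (altq v))) = altq (z v).
Proof. by apply/eqP; rewrite -subr_eq0 -!linearB altq_zJ //; exact: alts_diff. Qed.

Fact altka_lin : linear (fun c => phi' (alts c)). Proof. by move=> c a b; rewrite !linearP. Qed.
Definition altka := mklin altka_lin.
Fact altz_lin : linear (fun c => altq (z (alts c))). Proof. by move=> c a b; rewrite !linearP. Qed.
Definition altz := mklin altz_lin.
Lemma altkaE c : altka c = phi' (alts c). Proof. by rewrite /altka [LHS]mklinE. Qed.
Lemma altzE c : altz c = altq (z (alts c)). Proof. by rewrite /altz [LHS]mklinE. Qed.
Definition altG := gG altC (@oee _ _ _ _ YP j).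
Local Notation altM := (vr altG altka altq).

Lemma alt_lam : lam adj w altM.
Proof.
apply: (@vr_lam _ _ _ adj_sym adj_irr j w w _ _ _ _ altG altka altq altz w0 0 w0 YL).
- by move=> i _; case: ifP => _; rewrite addr0.
- by move=> c; rewrite altkaE nb_phi'.
- exact: altq_nb.
- by move=> v; rewrite scale0r addr0 altkaE phi'_alts phi'E.
- move=> c; rewrite !altkaE !altzE wE eqxx scaleNr.
  have -> : phi' (alts c) = phi (alts c) - u j *: z (nb Y (alts c)) by rewrite phiE addrK.
  by rewrite linearB altq_phi sub0r linearZ_LR Y_nb_zeta altq_nb.
- by move=> v; rewrite altzE altq_zs.
- by move=> c; rewrite !altkaE !altzE -phi'_z phi'_alts.
Qed.

Fact alt_hom_lin : linear (fun m : rp M => ga altG (eta m) + gu altG (altq (eta (ga (rpG M) (rps M (gv (rpG M) m)))))).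
Proof. by move=> c a b; rewrite !linearP /= scalerDr addrACA. Qed.

(** Well-definedness on the cokernel at j of [rp M] of the map into the alternative module; this is
    why [Jpred] also divides out the image of [eta_x]. *)
Lemma altq_rps m : altq (eta (ga (rpG M) (rps M (rpq M m)))) = altq (eta (ga (rpG M) m)).
Proof.
have [y yE] : rp_pred adj j (rps M (rpq M m) - m).
  by apply/rpq0; rewrite linearB rpqs subrr.
apply/eqP; rewrite -subr_eq0 -!linearB; apply/eqP; rewrite -altq_nb.
rewrite -(nb_hom adj j etag.1).
have -> : nb (rp M) (ga (rpG M) (rps M (rpq M m) - m)) = ga (rpG M) (nb M (rps M (rpq M m) - m)).
  apply: (gext (rpG M)); rewrite ?gb_nb ?gv_nb ?gva //.
  by rewrite !gba linearB nb_ej // ej_nb // !subr0.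
by rewrite yE -/(eta_x y) altq_eta_x.
Qed.

Lemma ker_im v : nb Y v = v -> e Y j (x Y v) = 0 -> exists y m, v = phi y + eta_x m.
Proof.
move=> vn vx.
have f2b m : gb altG (mklin alt_hom_lin m) = eta m - e Y j (eta m).
  by rewrite mklinE linearD gba gbu addr0.
have f2v m : gv altG (mklin alt_hom_lin m) = altq (eta (ga (rpG M) (rps M (gv (rpG M) m)))).
  by rewrite mklinE linearD gva gvu add0r.
have f2g : ghom g' (mo (rp M)) altM (mklin alt_hom_lin).
  split=> [i m|i l m gil]; apply: (gext altG).
  - rewrite f2b gb_e // f2b etag.1; case: (eqVneq i j) => [->|n]; first by rewrite oee ?subrr.
    by rewrite linearB [X in _ - X]oe_neq 1?eq_sym // [X in _ = _ - X]oe_neq.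
  - rewrite f2v !gv_e // f2v; case: (i == j) => //.
    by rewrite !linear0.
  - have nl : l != j by apply: contraTneq gil => ->; rewrite g'_snk.
    rewrite f2b gb_exe // (negPf nl) f2b etag.2 //; case: (eqVneq i j) => [->|n]; first by rewrite oee ?subrr.
    rewrite [X in _ - X]oe_neq 1?eq_sym // subr0.
    by rewrite linearB [X in _ = e Y i (x Y (_ - X))]oe_neq // subr0.
  - have nl : l != j by apply: contraTneq gil => ->; rewrite g'_snk.
    rewrite f2v !gv_exe // nl andbT f2b; case: (eqVneq i j) => [_|n]; last by rewrite !linear0.
    rewrite altq_rps linearB [X in _ - X]oe_neq // subr0 -etag.1; congr (altq (eta _)).
    by apply: (gext (rpG M)); rewrite ?gba ?gva ?(gb_e (rpG M) (lin0 _ _) (rpq M)) ?(gv_e (rpG M) (lin0 _ _) (rpq M)) // (negPf nl) // oe_neq ?subr0 // eq_sym.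
have [F [Ff FE]] := Yuniv alt_lam f2g.
(* [H] leads back from the alternative module to Y: at j it sends a class to its image under the
   maps into j, which kill [Jpred]. By generation, [H] after [F] is the identity. *)
have h2_lin : linear (fun b => gb altG b + e Y j (x Y (nb Y (alts (gv altG b))))).
  by move=> c a b; rewrite !linearP scalerDr addrACA.
pose H := mklin h2_lin.
have HE b : H b = gb altG b + e Y j (x Y (nb Y (alts (gv altG b)))) by rewrite /H mklinE.
have Hf : fullhom altM (mo Y) H.
  split=> [i a|a]; rewrite !HE.
    rewrite gb_e // gv_e // linearD; case: (eqVneq i j) => [->|n].
      by rewrite gb_j // !add0r oee.
    by rewrite [X in _ = _ + X]oe_neq // !linear0.
  rewrite gb_x // gv_x // Y_jx_nb jx_alts !linearD.
  have kE : altka (gv altG a) = x Y (e Y j (x Y (nb Y (alts (gv altG a))))).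
    by rewrite altkaE phi'E Y_nb_xj.
  have -> : e Y j (altka (gv altG a)) = 0 by rewrite altkaE -nb_phi' ej_nb.
  rewrite -kE; set p := e Y j _; set p' := x Y _; set p'' := altka _.
  by change (p' + p'' + (- p + - 0) + p = p' + p''); rewrite oppr0 addr0 subrK.
have HF y : H (F y) = y.
  move: y; apply: Ygen.
  - split; first by rewrite !linear0.
    by move=> c a b e1 e2; rewrite !linearP e1 e2.
  - by move=> i a E; rewrite Ff.1 Hf.1 E.
  - by move=> a E; rewrite Ff.2 Hf.2 E.
  move=> m; rewrite FE HE f2b f2v Y_jx_nb jx_alts -Y_jx_nb -(nb_hom adj j etag.1).
  set c := gv (rpG M) m.
  have -> : nb (rp M) (ga (rpG M) (rps M c)) = ga (rpG M) (nb M (rps M c)).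
    by apply: (gext (rpG M)); rewrite ?gb_nb ?gv_nb ?gva // !gba linearB nb_ej // ej_nb // !subr0.
  by rewrite jx_eta rpqs -etag.1 (gu_gv (rpG M) (lin0 _ _) (rpq M) (mP M)) subrK.
(* So [F v] is v itself, without component at j. The component at j of x (F v) is then the class of
   v, and it vanishes because F commutes with x and v is killed on its way to j. *)
have gF : gv altG (F v) = 0 by rewrite -vn (nb_hom adj j Ff.1) gv_nb.
have bF : gb altG (F v) = v by have := HF v; rewrite HE gF !linear0 addr0.
have : altq v = 0.
  have := Ff.2 v; move/(congr1 (oe altM j)); rewrite -Ff.1 vx linear0.
  by move/(congr1 (gv altG)); rewrite linear0 gv_e // eqxx gv_x // bF.
by move/altq0 => [y [m E]]; exists y, m; rewrite -vn.
Qed.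
End Kernel.

Local Notation MjV := (subvs_of (limg (linfun (e M j)))).
Definition vert_space : vectType k := MjV.
Definition inj_j : {linear vert_space -> M} := vsval.
Fact prj_lin : linear (fun m : M => vsproj (limg (linfun (e M j))) (e M j m)).
Proof. by move=> c a b; rewrite !linearP. Qed.
Definition prj_j : {linear M -> vert_space} := mklin prj_lin.

Lemma inj_jE c : e M j (inj_j c) = inj_j c.
Proof. by apply/eqP; rewrite -mem_limg_oe; exact: subvsP. Qed.
Lemma inj_prj m : inj_j (prj_j m) = e M j m.
Proof. by rewrite /prj_j mklinE; apply: vsprojK; rewrite mem_limg_oe oee. Qed.
Lemma prj_inj c : prj_j (inj_j c) = c.
Proof. by apply: val_inj; rewrite -[LHS]/(inj_j (prj_j (inj_j c))) inj_prj inj_jE. Qed.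
Lemma prj_e i m : prj_j (e M i m) = if i == j then prj_j m else 0.
Proof.
apply: val_inj; rewrite -[LHS]/(inj_j _) inj_prj; case: (eqVneq i j) => [->|n].
  by rewrite oee // -inj_prj.
by rewrite oe_neq 1?eq_sym.
Qed.

(** The first factor takes what arrives from the neighbours. The second holds the values of the new
    [stepeta] at j, for which Y has no counterpart, since [rp M] has forgotten the space at j of
    M. *)
Definition stepC : vectType k := (rpC adj j Y * vert_space)%type.
Fact stepq_lin : linear (fun v : Y => (rpq Y v, 0) : stepC).
Proof. by move=> c a b; apply: (f_equal2 pair); rewrite /= ?linearP // scaler0 addr0. Qed.
Definition stepq := mklin stepq_lin.
Lemma stepqE v : stepq v = (rpq Y v, 0). Proof. exact: (mklinE stepq_lin). Qed.
Fact stepka_lin : linear (fun c : stepC => phi (rps Y c.1) + eta_x (inj_j c.2)).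
Proof. by move=> c a b; rewrite -!(mklinE t_lin) !linearP /= scalerDr addrACA. Qed.
Definition stepka := mklin stepka_lin.
Lemma stepkaE c : stepka c = phi (rps Y c.1) + eta_x (inj_j c.2). Proof. exact: (mklinE stepka_lin). Qed.
(** The relation q ka = u_j z leaves no choice for the central element at j. *)
Fact stepz_lin : linear (fun c : stepC => (u j)^-1 *: stepq (stepka c)).
Proof. by move=> c a b; rewrite !linearP. Qed.
Definition stepz := mklin stepz_lin.
Lemma stepzE c : stepz c = (u j)^-1 *: stepq (stepka c). Proof. exact: (mklinE stepz_lin). Qed.
Definition stepG := gG stepC (@oee _ _ _ _ YP j).
Definition stepM : mod := Mod (vr_isops stepG stepka stepq YP).

Lemma eta_x0 : eta_x 0 = 0. Proof. by rewrite -(mklinE t_lin) linear0. Qed.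
Lemma stepka_nb c : nb Y (stepka c) = stepka c.
Proof. by rewrite stepkaE linearD nb_phi t_nb. Qed.
Lemma jx_stepka c : e Y j (x Y (stepka c)) = 0.
Proof. by rewrite stepkaE !linearD jx_phi jx_t addr0. Qed.
Lemma stepq_nb v : stepq (nb Y v) = stepq v.
Proof. by rewrite !stepqE rpq_nb. Qed.
Lemma stepka_stepq v : stepka (stepq v) = phi v.
Proof. by rewrite stepkaE stepqE [(_, _).1]/= [(_, _).2]/= (linear0 inj_j) eta_x0 addr0 phi_rps. Qed.
Lemma stepq_phi v : stepq (phi v) = u j *: stepq (z v).
Proof.
rewrite phiE linearD linearZ_LR Y_nb_zeta stepq_nb phi'E stepq_nb [stepq (x Y _)]stepqE rpq_xj.
by rewrite (_ : (0, 0) = 0) ?add0r.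
Qed.
Lemma stepz_stepq v : stepq (z v) = stepz (stepq v).
Proof. by rewrite stepzE stepka_stepq stepq_phi scalerA mulVf // scale1r. Qed.
Lemma stepka_stepz c : z (stepka c) = stepka (stepz c).
Proof.
rewrite stepzE linearZ_LR stepka_stepq stepkaE !linearD phi_phi phi_t -!scalerDr scalerA mulVf //.
by rewrite scale1r.
Qed.
Lemma stepq_stepka c : stepq (stepka c) = u j *: stepz c.
Proof. by rewrite stepzE scalerA divff // scale1r. Qed.
Lemma weight_step i : i != j -> u i = w i + (if adj j i then u j else 0).
Proof. by move=> n; rewrite wE (negPf n) subrK. Qed.
Lemma stepka_stepq_phi v : stepka (stepq v) = nb Y (x Y (e Y j (x Y (nb Y v)))) + u j *: z (nb Y v).
Proof. by rewrite stepka_stepq phiE phi'E. Qed.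

Lemma step_lam : lam adj u (mo stepM).
Proof.
exact: (vr_lam adj_sym adj_irr stepG u0 w0 YL weight_step stepka_nb stepq_nb stepka_stepq_phi stepq_stepka stepz_stepq stepka_stepz).
Qed.
Lemma step_zeta y : zeta u (mo stepM) y = ga stepG (z (gb stepG y)) + gu stepG (stepz (gv stepG y)).
Proof.
exact: (vr_zeta adj_sym adj_irr stepG u0 w0 YL weight_step stepka_nb stepka_stepq_phi stepq_stepka).
Qed.

Fact stepeta_lin : linear (fun m : M => ga stepG (eta (ga (rpG M) m)) + gu stepG (0, prj_j m)).
Proof.
move=> c a b; rewrite scalerDr addrACA; congr (_ + _); first by rewrite !linearP.
by rewrite -linearP; congr (gu stepG _); apply: (f_equal2 pair); rewrite /= ?linearP // scaler0 addr0.
Qed.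
Definition stepeta : {linear M -> stepM} := mklin stepeta_lin.
Lemma ga_ej m : ga (rpG M) (e M j m) = 0.
Proof. by apply: (gext (rpG M)); rewrite ?gba ?gva ?linear0 // oee // subrr. Qed.
Lemma ej_eta_ga m : e Y j (eta (ga (rpG M) m)) = 0.
Proof. by rewrite -etag.1 (ga_e (rpG M) (lin0 _ _) (rpq M)) // eqxx linear0. Qed.
Lemma gb_stepeta m : gb stepG (stepeta m) = eta (ga (rpG M) m).
Proof. by rewrite /stepeta mklinE linearD gbu addr0 gba ej_eta_ga subr0. Qed.
Lemma gv_stepeta m : gv stepG (stepeta m) = (0, prj_j m).
Proof. by rewrite /stepeta mklinE linearD gvu gva add0r. Qed.

Lemma stepeta_ghom : ghom g (mo M) (mo stepM) stepeta.
Proof.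
split=> [i m|i l m gil]; apply: (gext stepG).
- rewrite gb_stepeta gb_e // gb_stepeta; case: (eqVneq i j) => [->|n].
    by rewrite ga_ej linear0.
  by rewrite -etag.1 (ga_e (rpG M) (lin0 _ _) (rpq M)) // (negPf n).
- by rewrite gv_stepeta gv_e // gv_stepeta prj_e; case: ifP.
- have n : i != j by apply: contraTneq gil => ->; rewrite g_src.
  rewrite gb_stepeta gb_exe // gb_stepeta gv_stepeta (negPf n); case: (eqVneq l j) gil => [->|nl] gil.
    rewrite stepkaE !linear0 add0r inj_prj t_ej /eta_x -etag.1 (ga_e (rpG M) (lin0 _ _) (rpq M)) //.
    by rewrite (negPf n) e_nb // adj_sym -g_adj gil.
  by rewrite -etag.2 -?gg' // (ga_exe (rpG M) (lin0 _ _) (rpq M)).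
- have n : i != j by apply: contraTneq gil => ->; rewrite g_src.
  by rewrite gv_stepeta gv_exe // (negPf n) prj_e (negPf n).
Qed.

Lemma step_gen : gen stepeta.
Proof.
move=> D [D0 DP] De Dx Deta.
have DD a b : D a -> D b -> D (a + b) by move=> Da Db; rewrite -[a]scale1r; exact: DP.
have DZ c a : D a -> D (c *: a) by move=> Da; rewrite -[_ *: _]addr0; exact: DP.
have DB a b : D a -> D b -> D (a - b) by move=> Da Db; apply: DD => //; rewrite -scaleN1r; exact: DZ.
have Dsum (P : pred I) (F : I -> stepM) : (forall i, D (F i)) -> D (\sum_(i | P i) F i).
  by move=> DF; elim/big_ind: _.
have Dnb a : D a -> D (nbsum adj (mo stepM) j a) by move=> Da; rewrite /nbsum mklinE; apply: Dsum => i; exact: De.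
have Dz a : D a -> D (zeta u (mo stepM) a).
  by move=> Da; rewrite /zeta mklinE; apply: Dsum => i; apply/DZ/De/Dx/Dx/De.
(* Vectors of Y at j have no image in the new module, so [D'] records instead a b in [D] from which
   the maps into j reach the component at j. Then x applied to this component is [phi b] minus u_j z
   (nb b), and both terms are obtained from b by operations of the new module. *)
pose D' v := D (ga stepG v) /\ exists b, D (ga stepG b) /\ e Y j v = e Y j (x Y (nb Y b)).
have ga_j v : ga stepG (e Y j v) = 0.
  by apply: (gext stepG); rewrite ?gba ?gva ?linear0 // oee // subrr.
have D'P : forall v, D' v.
  apply: Ygen.
  - split; first by split; rewrite ?linear0 //; exists 0; rewrite !linear0.
    move=> c a b [Da [a' [Da' ea]]] [Db [b' [Db' eb]]]; split; first by rewrite linearP; exact: DP.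
    by exists (c *: a' + b'); split; [rewrite linearP; exact: DP|rewrite !linearP ea eb].
  - move=> i v [Dv [b [Db eb]]]; case: (eqVneq i j) => [->|n].
      by split; [rewrite ga_j|exists b; rewrite oee].
    split; last by exists 0; rewrite !linear0; split=> //; rewrite oe_neq // eq_sym.
    have -> : ga stepG (e Y i v) = oe (mo stepM) i (ga stepG v) by rewrite (ga_e stepG stepka stepq) // (negPf n).
    exact: De.
  - move=> v [Dv [b [Db eb]]]; split; last by exists v; rewrite Y_jx_nb.
    have -> : x Y v = x Y (v - e Y j v) + x Y (e Y j v) by rewrite -linearD subrK.
    rewrite linearD; apply: DD.
      have -> : ga stepG (x Y (v - e Y j v)) = ox (mo stepM) (ga stepG v) - oe (mo stepM) j (ox (mo stepM) (ga stepG v)).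
        apply: (gext stepG).
          rewrite [gb stepG (_ - _)]linearB (gb_e stepG stepka stepq) // eqxx subr0 (gb_x stepG stepka stepq) // !gba gva linear0 addr0.
          by [].
        by rewrite [gv stepG (_ - _)]linearB (gv_e stepG stepka stepq) // eqxx subrr gva.
      by apply: DB; [exact: Dx|exact/De/Dx].
    rewrite eb; have -> : x Y (e Y j (x Y (nb Y b))) = phi b - u j *: z (nb Y b).
      by rewrite phiE phi'E Y_nb_xj addrK.
    rewrite linearB linearZ_LR; apply: DB.
      have -> : ga stepG (phi b) = ox (mo stepM) (oe (mo stepM) j (ox (mo stepM) (nbsum adj (mo stepM) j (ga stepG b)))).
        apply: (gext stepG).
          rewrite (gb_x stepG stepka stepq) // (gb_e stepG stepka stepq) // eqxx linear0 add0r (gv_e stepG stepka stepq) // eqxx (gv_x stepG stepka stepq) // (gb_nb adj_irr stepG stepka stepq) // !gba.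
          by rewrite linearB nb_ej // subr0 stepq_nb stepka_stepq.
        by rewrite gva (gv_x stepG stepka stepq) // (gb_e stepG stepka stepq) // eqxx linear0.
      exact/Dx/De/Dx/Dnb.
    apply: DZ; have -> : ga stepG (z (nb Y b)) = zeta u (mo stepM) (nbsum adj (mo stepM) j (ga stepG b)).
      by rewrite step_zeta (gb_nb adj_irr stepG stepka stepq) // gba linearB nb_ej // subr0 (gv_nb adj_irr stepG stepka stepq) // !linear0 addr0.
    exact/Dz/Dnb.
  have Dm m : D (ga stepG (eta m)).
    have -> : ga stepG (eta m) = stepeta (gb (rpG M) m).
      apply: (gext stepG); rewrite ?gb_stepeta ?gv_stepeta ?gva ?gba.
        rewrite -etag.1 -linearB; congr (eta _).
        by rewrite (ga_gb (rpG M) (lin0 _ _) (rpq M)).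
      have := prj_e j (gb (rpG M) m); rewrite eqxx gb_j // linear0 => <-.
      by [].
    exact: Deta.
  move=> m; split=> //.
  have [m' mE] := rp_psurj adj_irr m.
  by exists (eta m'); split=> //; rewrite -etag.1 mE (ghom_xnb g'_adj etag).
move=> y; rewrite -(gdec stepG y); apply: (DD); first by case: (D'P (gb stepG y)).
case: (gv stepG y) => c1 c2.
have -> : gu stepG (c1, c2) = oe (mo stepM) j (ox (mo stepM) (ga stepG (rps Y c1))) + stepeta (inj_j c2).
  apply: (gext stepG); rewrite linearD.
    rewrite gbu (gb_e stepG stepka stepq) // eqxx add0r gb_stepeta.
    by rewrite -inj_jE ga_ej linear0.
  rewrite gvu (gv_e stepG stepka stepq) // eqxx (gv_x stepG stepka stepq) // gv_stepeta prj_inj gba stepqE linearB rpqs.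
  rewrite -[rpq Y (e Y j _)]rpq_nb nb_ej // linear0 subr0.
  by apply: (f_equal2 pair); rewrite /= ?addr0 ?add0r.
by apply: DD => //; apply/De/Dx; case: (D'P (rps Y c1)).
Qed.

Lemma step_form : form stepM.
Proof.
have [B [Bl Bs Bx Be Bn]] := Yform.
have BzE := form_0r Bl; have BZE := form_scaler Bl; have BDE := form_addr Bl.
have Kl : linear (fun c : vert_space => nb M (x M (inj_j c))) by move=> c a b; rewrite !linearP.
have [b [bl bs bn]] := subspace_form (lker (linfun (mklin Kl))).
have Kin c : c \in lker (linfun (mklin Kl)) <-> nb M (x M (inj_j c)) = 0.
  by rewrite memv_ker lfunE /= mklinE; split=> /eqP.
have bD v a a' : b v (a + a') = b v a + b v a'.
  by have := bl v 1 a a'; rewrite scale1r mul1r.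
have b0 v : b v 0 = 0.
  by have := bD v 0 0; rewrite addr0 => /eqP; rewrite -subr_eq0 opprD addNKr oppr_eq0 => /eqP.
(* Selfadjointness of x requires that BC (stepq v) c = B v (stepka c). With symmetry this determines
   every term except the pairing of the second factor with itself; there [b] is chosen,
   nondegenerate on the vectors that all arrows leaving j kill. *)
pose BC c d := B (rps Y c.1) (stepka d) + B (eta_x (inj_j c.2)) (rps Y d.1) + b c.2 d.2.
have BCs c d : BC c d = BC d c.
  have e1 : B (rps Y c.1) (phi (rps Y d.1)) = B (rps Y d.1) (phi (rps Y c.1)).
    by rewrite -(form_phi Bl Bs Bx Be) Bs.
  rewrite /BC !stepkaE !BDE e1 (bs c.2) (Bs (rps Y c.1) (eta_x _)) (Bs (eta_x (inj_j c.2)) (rps _ _)).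
  by congr (_ + _); rewrite addrAC.
have BCl c : linear_for *%R (BC c).
  move=> a d d'; rewrite /BC !linearP !BDE !BZE bl !mulrDr.
  rewrite [RHS]addrACA; congr (_ + _).
  by rewrite [RHS]addrACA.
have Bnbl v v' : B (nb Y v) v' = B v (nb Y v') by exact: (form_nb Bl Bs Be).
have Bdiff v c : B (rps Y (rpq Y v)) (stepka c) = B v (stepka c).
  rewrite -[stepka c]stepka_nb -!Bnbl; have [y ->] := rps_diff v.
  by rewrite (form_addl Bl Bs) Bx Be jx_stepka BzE addr0.
have BCq v c : BC (stepq v) c = B v (stepka c).
  by rewrite /BC stepqE [(_, _).1]/= [(_, _).2]/= (linear0 inj_j) eta_x0 (form_0l Bl Bs) bs b0 !addr0 Bdiff.
pose Bf (y y' : stepM) := B (gb stepG y) (gb stepG y') + BC (gv stepG y) (gv stepG y').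
have Bej v v' : e Y j v' = 0 -> B (v - e Y j v) v' = B v v'.
  by move=> e0; rewrite (form_addl Bl Bs) -scaleN1r (form_scalel Bl Bs) Be e0 BzE mulr0 addr0.
have BC0 c : BC c 0 = 0.
  by have := BCl c 1 0 0; rewrite scale1r addr0 mul1r => /eqP; rewrite -subr_eq0 opprD addNKr oppr_eq0 => /eqP.
exists Bf; split.
- move=> y a y1 y2; rewrite /Bf !linearP BDE BZE BCl.
  by rewrite [in RHS]mulrDr addrACA.
- by move=> y y'; rewrite /Bf Bs BCs.
- have E y y' : Bf (ox (mo stepM) y) y' = B (x Y (gb stepG y)) (gb stepG y') +
     (B (stepka (gv stepG y)) (gb stepG y') + B (gb stepG y) (stepka (gv stepG y'))).
    rewrite /Bf (gb_x stepG stepka stepq) // Bej ?gb_j // (gv_x stepG stepka stepq) BCq (form_addl Bl Bs).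
    by rewrite addrA.
  move=> y y'; rewrite E [RHS](_ : _ = Bf (ox (mo stepM) y') y); last by rewrite /Bf Bs BCs.
  by rewrite E Bx Bs (addrC (B (stepka _) _)) [B (gb stepG y) (stepka _)]Bs [B (stepka (gv stepG y)) _]Bs.
- move=> i y y'; rewrite /Bf !(gb_e stepG stepka stepq) // !(gv_e stepG stepka stepq) //.
  case: (i == j); first by rewrite BzE (form_0l Bl Bs).
  by rewrite Be BCs !BC0.
move=> y y0.
have b_0 : gb stepG y = 0.
  apply: Bn => v; have := y0 (ga stepG v); rewrite /Bf gva BC0 addr0 gba Bs Bej ?gb_j //.
  by rewrite Bs.
have cd d : BC (gv stepG y) d = 0.
  by have := y0 (gu stepG d); rewrite /Bf gbu gvu BzE add0r.
apply: (gext stepG); first by rewrite b_0 linear0.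
rewrite linear0; case: (gv stepG y) cd => c1 c2 cd.
(* An element of the radical is killed by [stepka]. The retraction then places c2 where [b] is
   nondegenerate. Finally c1 is orthogonal to the kernel of the maps into j, which [ker_im]
   describes, and [form_perp] makes its class zero. *)
have ka0 : stepka (c1, c2) = 0.
  by apply: Bn => v; rewrite Bs -BCq BCs cd.
have c2K : nb M (x M (inj_j c2)) = 0.
  by move: ka0; rewrite stepkaE => /phi_t_inj; rewrite inj_jE.
have tK c : nb M (x M (inj_j c)) = 0 -> eta_x (inj_j c) = 0.
  by move=> c0; rewrite /eta_x inj_jE c0 !linear0.
have phi0 : phi (rps Y c1) = 0 by move: ka0; rewrite stepkaE tK // addr0.
have c20 : c2 = 0.
  apply: bn; first exact/Kin.
  move=> d /Kin dK; have := cd (0, d); rewrite /BC stepkaE [(_, _).1]/= [(_, _).2]/=.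
  by rewrite !linear0 tK // addr0 !BzE !add0r.
have c10 : c1 = 0.
  rewrite -[c1]rpqs; apply: (form_perp Bl Bs Bx Be Bn) => v vn vx.
  have [v' [m ->]] := ker_im vn vx; rewrite BDE -(form_phi Bl Bs Bx Be) phi0 (form_0l Bl Bs) add0r.
  have := cd (0, prj_j m); rewrite /BC stepkaE [(_, _).1]/= [(_, _).2]/= inj_prj t_ej.
  by rewrite !linear0 add0r BzE addr0 c20 bs b0 addr0.
by rewrite c10 c20.
Qed.

Section Universal.
Variables (Z : lmodType k) (L : ops I Z) (LL : lam adj u L).
Variable f : {linear M -> Z}.
Hypothesis fg : ghom g (mo M) L f.
Local Notation zL := (zeta u L).
Local Notation nbL := (nbsum adj L j).
Local Notation eL := (oe L).
Local Notation xL := (ox L).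
Let LP : isops L. Proof. by case: LL. Qed.
Lemma L_x_zeta v : xL (zL v) = zL (xL v). Proof. by case: LL. Qed.
Lemma L_nb_zeta v : zL (nbL v) = nbL (zL v).
Proof. by apply: (@nb_hom _ _ adj _ _ L L j zL) => i y; rewrite e_zeta. Qed.
Lemma L_jx_nb v : eL j (xL (nbL v)) = eL j (xL v).
Proof. by rewrite (ejx_nb j LL). Qed.
Lemma L_nb_xj v : nbL (xL (eL j v)) = xL (eL j v).
Proof. by rewrite (nb_xej adj_sym j LL). Qed.

Fact phiL_lin : linear (fun v => xL (eL j (xL v)) - u j *: zL (nbL v)).
Proof.
by move=> c a b; rewrite !linearP addrACA -scalerDr.
Qed.
Definition phiL := mklin phiL_lin.
Lemma phiLE v : phiL v = xL (eL j (xL v)) - u j *: zL (nbL v).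
Proof. exact: (mklinE phiL_lin). Qed.
Lemma nb_phiL v : nbL (phiL v) = phiL v.
Proof. by rewrite phiLE linearB linearZ_LR L_nb_xj -L_nb_zeta nb_nb. Qed.
Lemma phiL_nb v : phiL (nbL v) = phiL v.
Proof. by rewrite !phiLE L_jx_nb nb_nb. Qed.
Lemma jx_phiL v : eL j (xL (phiL v)) = 0.
Proof.
rewrite phiLE linearB linearB [xL (_ *: _)]linearZ_LR [eL j (_ *: _)]linearZ_LR (exxe u0 LP).
by rewrite L_x_zeta (e_zeta u LP) L_jx_nb subrr.
Qed.
Lemma phiL_xj v : phiL (xL (eL j v)) = 0.
Proof. by rewrite phiLE (exxe u0 LP) L_nb_xj linearZ_LR L_x_zeta subrr. Qed.
Lemma phiL_z v : phiL (zL v) = zL (phiL v).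
Proof. by rewrite !phiLE !L_x_zeta (e_zeta u LP) L_x_zeta -L_nb_zeta [RHS]linearB [zL (_ *: _)]linearZ_LR. Qed.

Definition predL (v : Z) := nbL v = v /\ eL j (xL v) = 0.
Lemma predL_closed : closed_pred predL.
Proof.
split; first by rewrite /predL !linear0.
by move=> c a b [a1 a2] [b1 b2]; split; rewrite !linearP ?a1 ?b1 // a2 b2 scaler0 addr0.
Qed.

(** L is reflected back: its space at j is replaced by the kernel of the maps entering j, with
    [phiL] as the map into it. This has weight w and receives [rp M] through f, hence Y through
    [F']. Off j the map F is [F']; at j its values are dictated by compatibility with [stepq] and
    [stepeta]. *)
Lemma step_univ : exists F : {linear stepM -> Z}, fullhom (mo stepM) L F /\ forall m, F (stepeta m) = f m.
Proof.
have [CZ [kap [kinj kapP lift]]] := sub_lmod predL_closed.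
have [v|qZ qZE] := lift _ phiL; first by split; rewrite ?nb_phiL ?jx_phiL.
have zkl : linear (fun c => zL (kap c)) by move=> c a b; rewrite !linearP.
have [c|zC zCE] := lift _ (mklin zkl).
  rewrite mklinE; have [c1 c2] := kapP c; split; first by rewrite -L_nb_zeta c1.
  by rewrite L_x_zeta (e_zeta u LP) c2 linear0.
have {}zCE c : kap (zC c) = zL (kap c) by rewrite zCE [LHS]mklinE.
have [W [GZ]] := glue_lmod CZ (oee LP j).
have kap_nb c : nbL (kap c) = kap c by case: (kapP c).
have kap_x c : eL j (xL (kap c)) = 0 by case: (kapP c).
have qZ_nb v : qZ (nbL v) = qZ v by apply: kinj; rewrite !qZE phiL_nb.
have kq v : kap (qZ v) = nbL (xL (eL j (xL (nbL v)))) + (- u j) *: zL (nbL v).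
  by rewrite qZE phiLE L_nb_xj L_jx_nb scaleNr.
have qk c : qZ (kap c) = w j *: zC c.
  by apply: kinj; rewrite qZE linearZ_LR zCE phiLE kap_x linear0 sub0r kap_nb wE eqxx scaleNr.
have qz v : qZ (zL v) = zC (qZ v) by apply: kinj; rewrite zCE !qZE phiL_z.
have wu i : i != j -> w i = u i + (if adj j i then - u j else 0).
  by move=> n; rewrite wE (negPf n); case: ifP; rewrite ?subr0 ?addr0.
have zk c : zL (kap c) = kap (zC c) by rewrite zCE.
have WL := vr_lam adj_sym adj_irr GZ w0 u0 LL wu kap_nb qZ_nb kq qk qz zk.
have f'l : linear (fun m : rp M => ga GZ (f (gb (rpG M) m)) + gu GZ (qZ (f (rps M (gv (rpG M) m))))).
  by move=> c a b; rewrite !linearP scalerDr addrACA.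
have f'b m : gb GZ (mklin f'l m) = f (gb (rpG M) m).
  by rewrite mklinE linearD gba gbu addr0 -fg.1 gb_j // linear0 subr0.
have f'v m : gv GZ (mklin f'l m) = qZ (f (rps M (gv (rpG M) m))).
  by rewrite mklinE linearD gva gvu add0r.
have fxj m : f (nb M (x M (e M j m))) = xL (eL j (f m)).
  rewrite -L_nb_xj /nbsum !mklinE linear_sum; apply: eq_bigr => i a.
  by rewrite fg.2 // g_adj adj_sym.
have qf m : qZ (f (rps M (rpq M m))) = qZ (f m).
  apply/eqP; rewrite -subr_eq0 -!linearB; apply/eqP; rewrite -qZ_nb -(nb_hom adj j fg.1).
  have [y ->] : rp_pred adj j (rps M (rpq M m) - m).
    by apply/rpq0; rewrite linearB rpqs subrr.
  by rewrite fxj; apply: kinj; rewrite qZE phiL_xj linear0.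
have f'g : ghom g' (mo (rp M)) (vr GZ kap qZ) (mklin f'l).
  split=> [i m|i l m gil]; apply: (gext GZ).
  - rewrite f'b (gb_e (rpG M) (lin0 _ _) (rpq M)) // gb_e // f'b; case: (i == j); first by rewrite linear0.
    by rewrite fg.1.
  - rewrite f'v (gv_e (rpG M) (lin0 _ _) (rpq M)) // gv_e // f'v; case: (i == j) => //.
    by rewrite !linear0.
  - have nl : l != j by apply: contraTneq gil => ->; rewrite g'_snk.
    rewrite f'b (gb_exe (rpG M) (lin0 _ _) (rpq M)) // gb_exe // (negPf nl) f'b.
    case: (eqVneq i j) => [_|n]; first by rewrite linear0.
    by rewrite fg.2 // gg'.
  - have nl : l != j by apply: contraTneq gil => ->; rewrite g'_snk.
    rewrite f'v (gv_exe (rpG M) (lin0 _ _) (rpq M)) // gv_exe // nl andbT f'b.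
    by case: (i == j); rewrite ?linear0 ?qf ?fg.1 // !linear0.
have [F' [F'f F'E]] := Yuniv WL f'g.
pose G v := gb GZ (F' v).
have Gl : linear G by move=> c a b; rewrite /G !linearP.
have Gj v : eL j (G v) = 0 by rewrite /G gb_j.
have Ge i v : i != j -> G (e Y i v) = eL i (G v).
  by move=> n; rewrite /G F'f.1 gb_e // (negPf n).
have Gej v : G (e Y j v) = 0 by rewrite /G F'f.1 gb_e // eqxx.
have Gnb v : G (nb Y v) = nbL (G v) by rewrite /G (nb_hom adj j F'f.1) gb_nb.
have gvj v : e Y j v = 0 -> gv GZ (F' v) = 0.
  move=> v0; have := gv_e GZ kap qZ j (F' v); rewrite eqxx -F'f.1 v0 !linear0.
  by [].
have Gxj v : G (x Y (e Y j v)) = kap (gv GZ (F' v)).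
  rewrite /G F'f.2 F'f.1 gb_x // gb_e // eqxx linear0 add0r gv_e // eqxx.
  by rewrite -kap_nb ej_nb // subr0.
have GD a b : G (a + b) = G a + G b by rewrite -!(mklinE Gl) linearD.
have GZ' c a : G (c *: a) = c *: G a by rewrite -!(mklinE Gl) linearZ_LR.
have G0 : G 0 = 0 by rewrite -(mklinE Gl) linear0.
have GB a b : G (a - b) = G a - G b by rewrite -!(mklinE Gl) linearB.
have Gx v : e Y j v = 0 -> G (x Y v) = xL (G v) - eL j (xL (G v)).
  by move=> v0; rewrite /G F'f.2 gb_x // gvj // linear0 addr0.
have Gz v : G (z v) = zL (G v).
  rewrite /G (zeta_hom w F'f).
  exact: (gb_zeta adj_sym adj_irr GZ w0 u0 LL wu kap_nb kq qk).
have Grps v : eL j (xL (G (rps Y (rpq Y v)))) = eL j (xL (G v)).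
  rewrite -L_jx_nb -Gnb; have [y ->] := rps_diff v.
  by rewrite GD Gxj !linearD kap_x addr0 Gnb L_jx_nb.
have Gphi v : G (phi v) = xL (eL j (xL (G v))).
  rewrite phiE phi'E Y_nb_xj GD GZ' Gxj Gz Gnb F'f.2 gv_x // (nb_hom adj j F'f.1) gb_nb //.
  by rewrite qZE phiL_nb phiLE -/(G v) subrK.
have Gt m : G (eta_x m) = xL (eL j (f m)).
  rewrite /eta_x /G F'E f'b gba ej_nb // subr0.
  by rewrite fxj.
have Fl : linear (fun y : stepM => G (gb stepG y) + (eL j (xL (G (rps Y (gv stepG y).1))) + f (inj_j (gv stepG y).2))).
  move=> c a b; rewrite -!(mklinE Gl) !linearP.
  have e3 (p q r s y y' : Z) : y + y' + (p + q + (r + s)) = y + (p + r) + (y' + (q + s)).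
    by rewrite (addrACA p) [LHS]addrACA.
  by rewrite e3 [in RHS]scalerDr [c *: (_ + f _)]scalerDr.
exists (mklin Fl); split; last first.
  move=> m; rewrite mklinE gb_stepeta gv_stepeta [(_, _).1]/= [(_, _).2]/= !linear0 G0 !linear0 add0r inj_prj.
  by rewrite /G F'E f'b gba -linearD subrK.
split=> [i y|y]; rewrite !(mklinE Fl).
  rewrite (gb_e stepG stepka stepq) // (gv_e stepG stepka stepq) //; case: (eqVneq i j) => [->|n].
    rewrite G0 add0r !linearD Gj add0r oee // -fg.1.
    by rewrite inj_jE.
  rewrite [(0 : stepC).1]/= [(0 : stepC).2]/= !linear0 G0 !linear0 !addr0 Ge // !linearD -fg.1 oe_neq //.
  by rewrite -[inj_j _]inj_jE oe_neq // !linear0 !addr0.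
rewrite (gb_x stepG stepka stepq) // (gv_x stepG stepka stepq) stepqE [(_, _).1]/= [(_, _).2]/= !linear0 addr0.
rewrite GB Gej subr0 GD Gx ?gb_j // Grps stepkaE GD Gphi Gt !linearD -fg.1 inj_jE.
by rewrite addrAC subrK.
Qed.
End Universal.

Theorem step_good : good adj u g stepeta.
Proof.
split; [exact: step_lam|exact: stepeta_ghom| |exact: step_gen|exact: step_form].
by move=> Z L LL f fg; exact: step_univ.
Qed.

Theorem step_biprod (T : finType) (N : T -> mod) : biprod g' Y N ->
  biprod g stepM (fun a : 'I_(dm M j) + T =>
    match a with inl _ => simple k j | inr b => rm (N b) end).
Proof.
move=> Yb; apply: (split_biprod g_src g'_adj gg' (ka := stepka) stepq) Yb => //.
- by move=> c; split; [exact: stepka_nb|exact: jx_stepka].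
- move=> v [vn vx]; have [y [m ->]] := ker_im vn vx.
  by exists (rpq Y y, prj_j m); rewrite stepkaE /= phi_rps inj_prj t_ej.
(* The first factor of [stepC] has the dimension of the kernel at j, so the excess is dim M_j. *)
rewrite (rmC_rpC_dim Y_psurj Y_iinj) !dimvf.
by [].
Qed.

End Step.

(** * Induction along reflections *)

Section Sequences.
Variables (k : fieldType) (I : finType) (adj : rel I).
Hypotheses (adj_sym : symmetric adj) (adj_irr : irreflexive adj).
Local Notation mod := (mod k I).

(* The orientation in which arrows act from later to earlier entries of s. *)
Definition ori (s : seq I) (i l : I) : bool := adj i l && (index i s > index l s)%N.
Definition ordering (s : seq I) : bool := uniq s && all (mem s) (enum I).

Lemma ordering_mem s i : ordering s -> i \in s.
Proof. by move=> /andP [_ /allP h]; apply: h; rewrite mem_enum. Qed.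

Lemma ordering_rot n s : ordering (rot n s) = ordering s.
Proof.
rewrite /ordering rot_uniq; congr (_ && _); apply: eq_all => i.
by rewrite /= mem_rot.
Qed.

Lemma ori_sub s i l : ori s i l -> adj i l. Proof. by case/andP. Qed.
Lemma ori_asym s i l : ori s i l -> ~~ ori s l i.
Proof. by case/andP=> _ h; rewrite /ori negb_and -leqNgt (ltnW h) orbT. Qed.

Section Head.
Variables (j : I) (s : seq I).
Hypothesis js : ordering (j :: s).
Let jns : j \notin s. Proof. by case/andP: js => /= /andP []. Qed.
Let mem_s i : i != j -> i \in s.
Proof. by move=> n; have := ordering_mem i js; rewrite inE (negPf n). Qed.

Lemma ori_tojoin i : ori (j :: s) i j = adj i j.
Proof.
rewrite /ori; case a : (adj i j) => //=; rewrite eqxx eq_sym.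
by case: eqP a => // ->; rewrite adj_irr.
Qed.
Lemma ori_src l : ori (j :: s) j l = false.
Proof. by rewrite /ori /= eqxx andbF. Qed.
Lemma index_rot_j : index j (rot 1 (j :: s)) = size s.
Proof. by rewrite rot1_cons -cats1 index_cat (negPf jns) /= eqxx addn0. Qed.
Lemma index_rot_i i : i != j -> index i (rot 1 (j :: s)) = index i s.
Proof. by move=> n; rewrite rot1_cons -cats1 index_cat mem_s. Qed.
(** Moving the head j of the list to its end turns j from a source of structure maps into a sink and
    keeps the orientation of all edges away from j. *)
Lemma ori_rot_to l : ori (rot 1 (j :: s)) j l = adj j l.
Proof.
rewrite /ori index_rot_j; case: (eqVneq l j) => [->|n]; first by rewrite adj_irr.
by rewrite index_rot_i // index_mem mem_s // andbT.
Qed.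
Lemma ori_snk i : ori (rot 1 (j :: s)) i j = false.
Proof.
rewrite /ori index_rot_j; case: (eqVneq i j) => [->|n]; first by rewrite adj_irr.
by rewrite index_rot_i // ltnNge (ltnW _) ?andbF // index_mem mem_s.
Qed.
Lemma ori_same i l : i != j -> l != j -> ori (j :: s) i l = ori (rot 1 (j :: s)) i l.
Proof.
move=> ni nl; rewrite /ori !index_rot_i //= ![j == _]eq_sym (negPf ni) (negPf nl).
by [].
Qed.
End Head.

Variable j0 : I.

Definition refw (j : I) (u : I -> k) (i : I) : k :=
  if i == j then - u j else u i - (if adj j i then u j else 0).

Fixpoint regs (m : nat) (s : seq I) (u : I -> k) : Prop :=
  (forall i, u i != 0) /\
  if m is m'.+1 then regs m' (rot 1 s) (refw (head j0 s) u) else True.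

Fixpoint rps_ (m : nat) (s : seq I) (M : mod) : mod :=
  if m is m'.+1 then rps_ m' (rot 1 s) (rp adj (head j0 s) M) else M.

(* The indecomposables in the order in which the reflections reach them. *)
Fixpoint std (s : seq I) (t : nat) : mod :=
  if t is t'.+1 then rm adj (head j0 s) (std (rot 1 s) t') else simple k (head j0 s).

Lemma regs0 m s u : regs m s u -> forall i, u i != 0. Proof. by case: m => [|m] []. Qed.

Lemma good_zero s u (M : mod) : clean (ori s) (mo M) -> (forall v : M, v = 0) ->
  good adj u (ori s) (M := M) (Y := M) idfun.
Proof.
move=> cM M0; split.
- exact: (clean_lam u (mP M) cM (@ori_sub s) (@ori_asym s)).
- exact: ghom_id.
- move=> Z L _ f _; exists f; split=> //.
  by split=> [i v|v]; rewrite [in RHS](M0 v) [LHS](congr1 f (M0 _)) !linear0.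
- by move=> D [D0 _] _ _ _ v; rewrite (M0 v).
exists (fun _ _ => 0); split=> //.
by move=> v c a b; rewrite mulr0 addr0.
Qed.

(** Label 0 is the simple at the current source, occurring dim M_j = dim Hom(M, S_j) times; label
    t+1 comes from label t of the reflected module, and the adjunction matches the Hom dimensions.
    Labels are counted instead of isomorphism classes, since the modules [std s t] are shown to be
    distinct only in [std_distinct]. *)
Theorem good_ex m s u (M : mod) : ordering s -> regs m s u -> clean (ori s) (mo M) ->
  (forall v : rps_ m s M, v = 0) ->
  exists (Y : mod) (eta : {linear M -> Y}), good adj u (ori s) eta /\
    exists (T : finType) (lab : T -> nat), [/\ forall a, (lab a < m)%N,
      biprod (ori s) Y (fun a => std s (lab a)) &
      forall t, (t < m)%N -> #|[pred a | lab a == t]| = dhom (ori s) M (std s t)].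
Proof.
elim: m s u M => [|m IH] s u M os ru cM M0.
  exists M, idfun; split; first exact: good_zero.
  exists void, (of_void nat); split; [by case| |by []].
  unshelve eexists; first by case.
  unshelve eexists; first by case.
  split; try by case.
  by move=> y; rewrite [RHS]M0 big1 // => [[]].
case: s os ru cM M0 => [os|j s js] ru cM M0; first by have := ordering_mem j0 os.
set s' := rot 1 (j :: s).
have [u0 ru'] := ru.
have g_adj := ori_tojoin j s; have g_src := ori_src j s.
have g'_adj := ori_rot_to js; have g'_snk := ori_snk js; have gg' := ori_same js.
have os' : ordering s' by rewrite ordering_rot.
have cR : clean (ori s') (mo (rp adj j M)) := rp_clean g'_adj gg' cM.
have [Y [eta [[YL etag Yu Yg Yf] [T [lab [lt bip cnt]]]]]] := IH s' _ (rp adj j M) os' ru' cR M0.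
have w0 := regs0 ru'.
have wE i : refw j u i = if i == j then - u j else u i - (if adj j i then u j else 0) by [].
have Ng := step_good adj_sym adj_irr g_adj g_src g'_adj g'_snk gg' (@ori_sub s') (@ori_asym s')
  u0 w0 wE cM YL etag Yu Yg Yf.
have Nb := step_biprod adj_sym adj_irr g_src g'_adj g'_snk gg' u0 w0 wE YL etag Yu Yg Yf bip.
exists (stepM u (refw j u) eta), (stepeta u (refw j u) eta); split; first exact: Ng.
pose lab' (a : 'I_(dm M j) + T) : nat := match a with inl _ => 0%N | inr b => (lab b).+1 end.
exists ('I_(dm M j) + T)%type, lab'; split.
- by case=> [i|b] //=; rewrite ltnS.
- by rewrite (_ : (fun a => _) = (fun a : 'I_(dm M j) + T =>
    match a with inl _ => simple k j | inr b => rm adj j (std s' (lab b)) end)) //;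
     apply/funext; case.
case=> [|t] tm /=.
  rewrite (dhom_simple g_src) -[RHS](card_ord (dm M j)) -sum1_card big_sumType /=.
  by rewrite [X in (_ + X)%N]big1 ?addn0 ?sum1_card //; case.
rewrite (dhom_adj adj_sym adj_irr g_adj g_src g'_adj g'_snk gg') -(cnt t tm).
rewrite -!sum1_card big_sumType /= big_pred0 ?add0n //.
Qed.

End Sequences.

(** * The Cartan form *)

Section Cartan.
Variables (I : finType) (adj : rel I).
Hypotheses (adj_sym : symmetric adj) (adj_irr : irreflexive adj).

Definition cart (x : I -> rat) (i : I) : rat := 2 * x i - \sum_(l | adj i l) x l.
Definition sig (j : I) (x : I -> rat) (i : I) : rat := if i == j then x j - cart x j else x i.
Definition cform (x y : I -> rat) : rat := \sum_i x i * cart y i.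

Lemma cform_sym x y : cform x y = cform y x.
Proof.
have E a b : cform a b = 2 * \sum_i a i * b i - \sum_i \sum_l if adj i l then a i * b l else 0.
  rewrite /cform mulr_sumr -sumrB; apply: eq_bigr => i _.
  by rewrite -big_mkcond -mulr_sumr /cart mulrBr mulrCA.
rewrite !E; congr (_ - _); first by congr (2 * _); apply: eq_bigr => i _; rewrite mulrC.
by rewrite exchange_big; apply: eq_bigr => i _; apply: eq_bigr => l _; rewrite adj_sym mulrC.
Qed.

Lemma cart_ext x y : x =1 y -> cart x =1 cart y.
Proof. by move=> e i; rewrite /cart e; congr (_ - _); apply: eq_bigr => l _; rewrite e. Qed.

Lemma sig_sum j (r : seq nat) (f : nat -> I -> rat) i :
  sig j (fun l => \sum_(m <- r) f m l) i = \sum_(m <- r) sig j (f m) i.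
Proof.
rewrite /sig; case: eqP => // _; rewrite /cart exchange_big /= mulr_sumr -!sumrB.
by apply: eq_bigr => m _.
Qed.

Lemma sig_ext j x y : x =1 y -> sig j x =1 sig j y.
Proof. by move=> e i; rewrite /sig !e (cart_ext e). Qed.

Definition unitv (j i : I) : rat := (i == j)%:R.

Lemma sigE j x i : sig j x i = x i + - cart x j * unitv j i.
Proof. by rewrite /sig /unitv; case: eqP => [->|_]; rewrite ?mulr1 // mulr0 addr0. Qed.

Lemma cform_unit x j : cform (unitv j) x = cart x j.
Proof.
rewrite /cform (bigD1 j) //= big1 ?addr0 /unitv ?eqxx ?mul1r // => i /negPf ->.
by rewrite mul0r.
Qed.

Lemma cart_unit j : cart (unitv j) j = 2.
Proof.
rewrite /cart /unitv eqxx mulr1 big1 ?subr0 // => l a.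
by case: eqP a => // ->; rewrite adj_irr.
Qed.

Lemma cform_ext x x' y y' : x =1 x' -> y =1 y' -> cform x y = cform x' y'.
Proof.
move=> e e'; apply: eq_bigr => i _; rewrite e /cart e'; congr (_ * (_ - _)).
by apply: eq_bigr => l _; rewrite e'.
Qed.

Lemma cform_lin a x y v : cform (fun l => x l + a * y l) v = cform x v + a * cform y v.
Proof. by rewrite /cform mulr_sumr -big_split /=; apply: eq_bigr => i _; ring. Qed.

Lemma cform_sig j x : cform (sig j x) (sig j x) = cform x x.
Proof.
rewrite (cform_ext (sigE j x) (sigE j x)) cform_lin (cform_sym x) (cform_sym (unitv j)).
by rewrite !cform_lin (cform_sym x (unitv j)) !cform_unit cart_unit; ring.
Qed.

Lemma cform_unit_unit j : cform (unitv j) (unitv j) = 2.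
Proof. by rewrite cform_unit cart_unit. Qed.

(* Vinberg's criterion: a positive vector with positive image under the Cartan
   matrix makes the form positive definite. *)
Variable uu : I -> rat.
Hypotheses (uu0 : forall i, 0 < uu i) (cuu : forall i, 1 <= cart uu i).

Lemma cform_bound x i : x i ^+ 2 <= uu i * cform x x.
Proof.
(* The form equals A + R / 2, where R is a sum of weighted squares with weights uu i * uu l. The
   term of A at i alone is at least the bound, because [cart uu i] is at least 1. *)
pose A := \sum_i cart uu i / uu i * x i ^+ 2.
pose R := \sum_i \sum_l if adj i l then uu i * uu l * (x i / uu i - x l / uu l) ^+ 2 else 0.
pose P := \sum_i \sum_l if adj i l then uu l / uu i * x i ^+ 2 else 0.
pose X := \sum_i \sum_l if adj i l then x i * x l else 0.
have EA : A + P = 2 * \sum_i x i ^+ 2.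
  rewrite /A /P -big_split /= mulr_sumr; apply: eq_bigr => l _.
  have u0 : uu l != 0 by rewrite gt_eqF.
  rewrite -big_mkcond -mulr_suml -mulr_suml -mulrDl -mulrDl /cart subrK.
  by field.
have ER : R = 2 * P - 2 * X.
  have -> : 2 * P = P + \sum_i \sum_l if adj i l then uu i / uu l * x l ^+ 2 else 0.
    rewrite mulr2n mulrDl mul1r; congr (_ + _); rewrite /P exchange_big.
    by apply: eq_bigr => l _; apply: eq_bigr => m _; rewrite adj_sym.
  rewrite /R /P /X mulr_sumr -big_split -sumrB; apply: eq_bigr => l _ /=.
  rewrite mulr_sumr -big_split -sumrB; apply: eq_bigr => m _ /=.
  case: (adj l m); last by ring.
  have u0 : uu l != 0 by rewrite gt_eqF.
  have u1 : uu m != 0 by rewrite gt_eqF.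
  by field; rewrite u0 u1.
have EQ : cform x x = 2 * \sum_i x i ^+ 2 - X.
  rewrite /cform mulr_sumr /X -sumrB; apply: eq_bigr => l _.
  by rewrite -big_mkcond -mulr_sumr /cart /=; ring.
have R0 : 0 <= R.
  apply: sumr_ge0 => l _; apply: sumr_ge0 => m _; case: ifP => // _.
  by rewrite mulr_ge0 ?sqr_ge0 // mulr_ge0 // ltW.
have A1 : x i ^+ 2 / uu i <= A.
  rewrite /A (bigD1 i) //=; apply: ler_wpDr.
    apply: sumr_ge0 => l _; rewrite mulr_ge0 ?sqr_ge0 // divr_ge0 // ?ltW //.
    exact: lt_le_trans (cuu l).
  rewrite mulrC; apply: ler_wpM2r; first exact: sqr_ge0.
  by rewrite ler_pdivlMr // mulVf ?gt_eqF.
have : x i ^+ 2 / uu i <= cform x x by rewrite EQ; lra.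
by rewrite ler_pdivrMr // mulrC.
Qed.

(** Pairing with [uu] writes zero as a sum of nonnegative terms x i * cart uu i. *)
Lemma cart_eq0 x : (forall i, 0 <= x i) -> (forall i, cart x i = 0) -> forall i, x i = 0.
Proof.
move=> x0 cx i; have : cform uu x = 0 by rewrite /cform big1 // => l _; rewrite cx mulr0.
rewrite cform_sym /cform => /eqP; rewrite psumr_eq0; last first.
  by move=> l _; rewrite mulr_ge0 //; exact: le_trans (cuu l).
move/allP/(_ i); rewrite mem_index_enum => /(_ isT); rewrite mulf_eq0 => /orP [/eqP //|].
by rewrite gt_eqF //; exact: lt_le_trans (cuu i).
Qed.

Variable (j0 : I).
Variable K : nat.
Hypothesis KP : forall i, 2 * uu i < K%:R ^+ 2.
(** One turn through all vertices takes [#|I|] steps, and by [cform_bound] the vectors of norm 2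
    that can occur at the start of a turn have entries below K. *)
Definition chain_bound : nat := (#|I| * #|{ffun I -> 'I_K}|)%N.

(** The argument with the Coxeter transformation: among more turns than vectors, two start with the
    same vector. The sum over the period between them is fixed by the Coxeter transformation, hence
    by every simple reflection, so it lies in the radical of a definite form. Being a sum of
    nonnegative vectors it forces each of them to vanish, against norm 2. *)
Lemma no_long_chain s t (x : nat -> I -> nat) :
  uniq s -> (forall i, i \in s) ->
  (forall p, (p <= t)%N -> cform (fun i => (x p i)%:R) (fun i => (x p i)%:R) = 2) ->
  (forall p i, (p < t)%N -> (x p i)%:R = sig (head j0 (iter p (rot 1) s)) (fun l => (x p.+1 l)%:R) i) ->
  (t < chain_bound)%N.
Proof.
move=> us sI x2 xs; rewrite ltnNge; apply/negP => tb.
pose n := size s; have nI : #|I| = n.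
  by rewrite /n -(card_uniqP us); apply/esym/eq_card => i; rewrite sI.
have n0 : (0 < n)%N by rewrite lt0n size_eq0; apply/eqP => e; have := sI j0; rewrite e.
have irot p : (p <= n)%N -> iter p (rot 1) s = rot p s.
  elim: p => [|p IH] pn; first by rewrite rot0.
  rewrite /= IH ?(ltnW pn) // [RHS]rotS //.
have irotn m p : iter (n * m + p) (rot 1) s = iter p (rot 1) s.
  rewrite addnC iterD; congr (iter _ _ _); elim: m => [|m IH]; first by rewrite muln0.
  by rewrite mulnS iterD IH irot // rot_size.
have xK p i : (p <= t)%N -> (x p i < K)%N.
  move=> pt; have := cform_bound (fun i => (x p i)%:R) i; rewrite (x2 _ pt) => h.
  have := le_lt_trans h; rewrite mulrC => /(_ _ (KP i)).
  rewrite -!natrX ltr_nat ltn_exp2r //.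
set F := #|{ffun I -> 'I_K}| in tb.
have K0 : (0 < K)%N by exact: leq_ltn_trans (xK 0%N j0 (leq0n _)).
pose gam (r : 'I_F.+1) : {ffun I -> 'I_K} := [ffun i => insubd (Ordinal K0) (x (n * r)%N i)].
have rt (r : nat) : (r <= F)%N -> (n * r <= t)%N.
  by move=> rF; apply: leq_trans tb; rewrite /chain_bound nI leq_mul2l rF orbT.
have : ~~ injectiveb gam.
  apply/negP => /injectiveP /leq_card; rewrite card_ord.
  by rewrite ltnn.
move=> ninj.
have [a [b [ab bF E]]] : exists a b : nat,
    [/\ (a < b)%N, (b <= F)%N & forall i, x (n * a)%N i = x (n * b)%N i].
  have /injectivePn [a [b nab E]] := ninj.
  have E' i : x (n * a)%N i = x (n * b)%N i.
    have := congr1 (fun f : {ffun I -> 'I_K} => val (f i)) E.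
    by rewrite !ffunE !val_insubd !xK ?rt // -ltnS.
  case: (ltngtP a b) => [ab|ba|e].
  - by exists a, b; split=> //; rewrite -ltnS.
  - by exists b, a; split=> //; rewrite -ltnS.
  - by rewrite (val_inj e) eqxx in nab.
(* The sum over the period, at position p within a turn. A single vector is fixed only by a power of
   the Coxeter transformation, its sum over the period by the transformation itself. *)
pose dl p i : rat := \sum_(a <= m < b) (x (n * m + p)%N i)%:R.
have headE p : (p < n)%N -> head j0 (iter p (rot 1) s) = nth j0 s p.
  move=> pn; rewrite irot ?(ltnW pn) // /rot -nth0 nth_cat size_drop subn_gt0 pn.
  by rewrite nth_drop addn0.
have dsig p i : (p < n)%N -> dl p i = sig (nth j0 s p) (dl p.+1) i.
  move=> pn; rewrite /dl sig_sum !big_seq; apply: eq_bigr => m; rewrite mem_index_iota => /andP [_ mb].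
  rewrite xs ?irotn ?headE // ?addnS //.
  apply: leq_trans (rt b bF); apply: leq_trans (_ : n * m.+1 <= _)%N; last by rewrite leq_mul2l mb orbT.
  by rewrite mulnS addnC ltn_add2r.
have dn i : dl n i = dl 0%N i.
  have := @big_nat_recr _ 0 +%R _ _ (fun m => (x (n * m)%N i)%:R : rat) (ltnW ab).
  rewrite (@big_nat_recl _ 0 +%R _ _ (fun m => (x (n * m)%N i)%:R : rat) (ltnW ab)) E addrC => /addIr h.
  rewrite /dl; under eq_bigr do rewrite addnC -mulnS.
  by rewrite h; apply: eq_bigr => m _; rewrite addn0.
have dstep p i : (p < n)%N -> p != index i s -> dl p i = dl p.+1 i.
  move=> pn pi; rewrite dsig // /sig; case: eqP => // e.
  by rewrite e index_uniq ?eqxx in pi.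
(* Each vertex is reflected once per turn, so coordinate i can change only at its own position; as
   the turn ends where it began, it does not change there either. *)
have d0 p i : (p <= n)%N -> dl p i = dl 0%N i.
  have lo q : (q <= index i s)%N -> dl q i = dl 0%N i.
    elim: q => [//|q IH] qi; rewrite -IH 1?ltnW // -dstep ?(ltn_eqF qi) //.
    by apply: leq_trans qi _; rewrite index_size.
  have hi q : (q <= n)%N -> (index i s < n - q)%N -> dl (n - q)%N i = dl n i.
    elim: q => [|q IH] qn h; first by rewrite subn0.
    have nq : (n - q = (n - q.+1).+1)%N by lia.
    rewrite dstep; [|lia|lia].
    by rewrite -nq IH //; lia.
  move=> pn; case: (leqP p (index i s)) => h; first exact: lo.
  by have := hi (n - p)%N; rewrite subKn // => -> //; exact: leq_subr.
have c0 i : cart (dl 0%N) i = 0.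
  have pn : (index i s < n)%N by rewrite index_mem.
  have := dsig (index i s) i pn; rewrite nth_index // (sig_ext _ (fun l => d0 _ l pn)).
  rewrite d0 1?ltnW // /sig eqxx => /eqP; rewrite -subr_eq0 opprB addrC subrK => /eqP.
  by [].
have dge i : (0 : rat) <= dl 0%N i by apply: sumr_ge0 => m _; exact: ler0n.
have dz := cart_eq0 dge c0.
have xa0 i : (x (n * a)%N i)%:R = 0 :> rat.
  apply/eqP; rewrite eq_le ler0n andbT -(dz i) /dl (big_ltn ab) addn0.
  by rewrite lerDl; apply: sumr_ge0 => m _; exact: ler0n.
have := x2 _ (rt a (leq_trans (ltnW ab) bF)).
by rewrite /cform big1 // => i _; rewrite xa0 mul0r.
Qed.

End Cartan.

(** * The indecomposable representations *)

Section Standard.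
Variables (k : fieldType) (I : finType) (adj : rel I).
Hypotheses (adj_sym : symmetric adj) (adj_irr : irreflexive adj).
Local Notation mod := (mod k I).
Variable j0 : I.
Local Notation std := (std k adj j0).
Local Notation rps := (rps_ adj j0).
Local Notation ori := (ori adj).

Definition mzero (M : mod) : Prop := forall v : M, v = 0.

Lemma mzeroP (M : mod) : mzero M <-> forall i, dm M i = 0%N.
Proof.
split=> [M0 i|d0 v].
  apply/eqP; rewrite dimv_eq0 -subv0; apply/subvP => v _.
  by rewrite (M0 v) mem0v.
have : v \in (fullv : {vspace M}) by rewrite memvf.
have /eqP : \dim {: M} = 0%N by rewrite dim_dm big1.
by rewrite dimv_eq0 => /eqP ->; rewrite memv0 => /eqP.
Qed.

Lemma dm_simple (j i : I) : dm (simple k j) i = (i == j) :> nat.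
Proof.
have d0 l : l != j -> dm (simple k j) l = 0%N.
  move=> n; apply/eqP; rewrite dimv_eq0 -subv0; apply/subvP => v.
  by rewrite mem_limg_oe simple_eE (negPf n) => /eqP <-; rewrite mem0v.
case: (eqVneq i j) => [->|n]; last exact: d0.
have := dim_dm (simple k j); rewrite (dim_simple k j) (bigD1 j) //= big1 ?addn0 => [<- //|l n].
exact: d0.
Qed.

Lemma indec_nz g (M : mod) : indec g M -> ~ mzero M.
Proof. by move=> [[v v0] _] M0; apply: v0. Qed.

Lemma mzero_rm j (N : mod) : mzero N -> mzero (rm adj j N).
Proof.
move=> N0 w; apply: rm_ext; first by rewrite [LHS]N0 [RHS]N0.
by rewrite [LHS]N0 [RHS]N0.
Qed.

Lemma mzero_miso g (M N : mod) : miso g M N -> mzero M -> mzero N.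
Proof. by move=> [f [h [_ _ _ hf]]] M0 v; rewrite -(hf v) (M0 (h v)) linear0. Qed.

Lemma std_cases s t : ordering s -> mzero (std s t) \/ indec (ori s) (std s t).
Proof.
elim: t s => [|t IH] s os /=; first by right; exact: simple_indec.
case: s os => [os|j s os]; first by have := ordering_mem j0 os.
have os' : ordering (rot 1 (j :: s)) by rewrite ordering_rot.
case: (IH _ os') => [z|ind]; first by left; exact: mzero_rm.
have [ps|cc] := indec_psurj (ori_rot_to adj_irr os) (ori_snk adj_irr os) ind; last first.
  by left; exact: (concentrated_rm adj_irr cc).
right; apply: (rm_indec adj_sym adj_irr (ori_tojoin adj_irr j s) (ori_rot_to adj_irr os)
  (ori_snk adj_irr os) (ori_same adj os) ps ind).
Qed.

Lemma std_pred s t : ordering s -> ~ mzero (std s t.+1) ->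
  [/\ psurj adj (head j0 s) (std (rot 1 s) t), ~ mzero (std (rot 1 s) t) &
      indec (ori (rot 1 s)) (std (rot 1 s) t)].
Proof.
case: s => [os|j s os nz]; first by have := ordering_mem j0 os.
have os' : ordering (rot 1 (j :: s)) by rewrite ordering_rot.
case: (std_cases t os') => [z|ind]; first by case: nz; exact: mzero_rm.
have [ps|cc] := indec_psurj (ori_rot_to adj_irr os) (ori_snk adj_irr os) ind; last first.
  by case: nz; exact: (concentrated_rm adj_irr cc).
by split=> // z; apply: nz; exact: mzero_rm.
Qed.

Definition dimq (M : mod) (i : I) : rat := (dm M i)%:R.

Lemma dimq_rm j (N : mod) : psurj adj j N -> dimq (rm adj j N) =1 sig adj j (dimq N).
Proof.
move=> ps i; rewrite /dimq /sig; case: eqP => [->|/eqP n]; last by rewrite dm_rm_neq.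
have := congr1 (fun n : nat => n%:R : rat) (dm_rm_eq ps); rewrite natrD natr_sum /cart.
by move=> h; rewrite -h; ring.
Qed.

Lemma std_form s t : ordering s -> ~ mzero (std s t) ->
  cform adj (dimq (std s t)) (dimq (std s t)) = 2.
Proof.
elim: t s => [|t IH] s os nz.
  rewrite -(cform_unit_unit adj_irr (head j0 s)).
  by apply: cform_ext => i; rewrite /dimq dm_simple.
have [ps nz' _] := std_pred os nz.
rewrite -(IH (rot 1 s)) ?ordering_rot // -[RHS](cform_sig adj_sym adj_irr (head j0 s)).
by apply: cform_ext => i; exact: dimq_rm.
Qed.

Lemma ordering_iter p (s : seq I) : ordering s -> ordering (iter p (rot 1) s).
Proof. by move=> os; elim: p => [//|p IH]; rewrite iterS ordering_rot. Qed.

Lemma dm_rp_neq j (M : mod) i : i != j -> dm (rp adj j M) i = dm M i.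
Proof.
move=> n; apply/eqP; rewrite eqn_leq; apply/andP; split.
  apply: (@dim_sub k (rp adj j M) M (limg (linfun (oe (mo (rp adj j M)) i))) (limg (linfun (oe (mo M) i))) (gb (rpG adj j M))) => u; rewrite !mem_limg_oe.
    by move=> /eqP {2}<-; rewrite (gb_e (rpG adj j M) (lin0 _ _) (rpq adj j M)) // (negPf n).
  move=> /eqP <- h; apply: (gext (rpG adj j M)); rewrite linear0 //.
  by rewrite (gv_e (rpG adj j M) (lin0 _ _) (rpq adj j M)) (negPf n).
apply: (@dim_sub k M (rp adj j M) (limg (linfun (oe (mo M) i))) (limg (linfun (oe (mo (rp adj j M)) i))) (ga (rpG adj j M))) => u; rewrite !mem_limg_oe.
  by move=> /eqP {2}<-; rewrite (ga_e (rpG adj j M) (lin0 _ _) (rpq adj j M)) // (negPf n).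
move=> /eqP <- h; have := congr1 (gb (rpG adj j M)) h.
by rewrite gba linear0 [X in _ - X]oe_neq 1?eq_sym // subr0.
Qed.

(** The adjunction moves all reflections over to M and leaves morphisms into the simple at the
    current source. *)
Lemma dhom_std s t (M : mod) : ordering s ->
  dhom (ori s) M (std s t) = dm (rps t s M) (head j0 (iter t (rot 1) s)).
Proof.
elim: t s M => [|t IH] s M; case: s => [os|j s os]; try by have := ordering_mem j0 os.
  exact: (dhom_simple (ori_src adj j s)).
have os' : ordering (rot 1 (j :: s)) by rewrite ordering_rot.
rewrite iterSr -IH //.
exact: (dhom_adj adj_sym adj_irr (ori_tojoin adj_irr j s) (ori_src adj j s) (ori_rot_to adj_irr os)
  (ori_snk adj_irr os) (ori_same adj os)).
Qed.

Lemma dm_first p s i (M : mod) : ordering s -> (p <= index i s)%N -> dm (rps p s M) i = dm M i.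
Proof.
elim: p s M => [//|p IH] s M; case: s => [os|j s os]; first by have := ordering_mem j0 os.
move=> h; have n : i != j by apply: contraTneq h => ->; rewrite /= eqxx.
have os' : ordering (rot 1 (j :: s)) by rewrite ordering_rot.
rewrite [rps _ _ _]/= IH ?index_rot_i ?dm_rp_neq //.
by move: h; rewrite /= eq_sym (negPf n).
Qed.

Lemma head_iter (s : seq I) i : ordering s -> head j0 (iter (index i s) (rot 1) s) = i.
Proof.
move En : (index i s) => n; elim: n s En => [|n IH] s En; case: s En => [En os|j s En os];
  try by have := ordering_mem j0 os.
  by move: En => /=; case: eqP.
have ij : i != j by apply: contra_eq_neq En => ->; rewrite /= eqxx.
rewrite iterSr IH ?ordering_rot // index_rot_i //.
by move: En; rewrite /= eq_sym (negPf ij) => [[]].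
Qed.

Lemma rps_add a b s (M : mod) : rps (a + b) s M = rps b (iter a (rot 1) s) (rps a s M).
Proof. by elim: a s M => [//|a IH] s M; rewrite addSn /= IH -iterSr. Qed.

Lemma dhom_zero g (M N : mod) : mzero N -> dhom g M N = 0%N.
Proof.
move=> N0; apply/eqP; rewrite dimv_eq0 -subv0; apply/subvP => f _.
by rewrite memv0; apply/eqP/lfunP => v; rewrite zero_lfunE; exact: N0.
Qed.

(** The space at i stays the same until i is the next vertex to be reflected ([dm_first]). By
    [dhom_std] its dimension is then that of a space of morphisms into a zero module. *)
Lemma rps_zero L s (M : mod) : ordering s -> (forall t, (L <= t)%N -> mzero (std s t)) ->
  mzero (rps L s M).
Proof.
move=> os sz; apply/mzeroP => i; pose s' := iter L (rot 1) s.
have os' : ordering s' by exact: ordering_iter.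
rewrite -(@dm_first (index i s') s') // -rps_add.
have E : head j0 (iter (L + index i s') (rot 1) s) = i by rewrite addnC iterD head_iter.
have := dhom_std (L + index i s') M os; rewrite E => <-.
by rewrite dhom_zero //; apply: sz; exact: leq_addr.
Qed.

(** Stripping off common reflections leaves a simple at j against a reflection at j. In the latter
    the maps leaving j are jointly injective, being the inclusion of a kernel, so it is not
    concentrated at j unless it is zero. *)
Lemma std_distinct s t1 t2 : ordering s -> (t1 < t2)%N -> ~ mzero (std s t1) ->
  ~ miso (ori s) (std s t1) (std s t2).
Proof.
elim: t1 t2 s => [|t1 IH] [//|t2] s; case: s => [os|j s os lt nz iso]; try by have := ordering_mem j0 os.
  have [f [h [fg hg fh hf]]] := iso.
  have f1 : f 1 <> 0.
    by move=> e; have := fh 1; rewrite e linear0 => /eqP; rewrite eq_sym oner_eq0.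
  apply: f1; set w := f 1.
  have cj (v : std (j :: s) t2.+1) : oe (mo (std (j :: s) t2.+1)) j v = v.
    by rewrite -{1}(hf v) -fg.1 simple_eE eqxx hf.
  apply: rm_ext; rewrite linear0 ?linear0.
    by rewrite -(cj w) (gb_e (rmG adj j _) (rmk adj j _) (lin0 _ _)) // eqxx.
  rewrite -rmk_nb; apply: (oe_ext (mP _)) => i; rewrite linear0 e_nb //; case: ifP => // a.
  have n : i != j by apply: contraTneq a => ->; rewrite adj_irr.
  have gij : ori (j :: s) i j by rewrite (ori_tojoin adj_irr) adj_sym.
  have := fg.2 i j 1 gij; rewrite simple_xE !linear0 => /esym /(congr1 (gb (rmG adj j _))).
  by rewrite (gb_exe (rmG adj j _) (rmk adj j _) (lin0 _ _)) // (negPf n) eqxx linear0.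
have os' : ordering (rot 1 (j :: s)) by rewrite ordering_rot.
have nz2 : ~ mzero (std (j :: s) t2.+1).
  by move=> z; apply: nz; exact: (mzero_miso (miso_sym iso)).
have [ps1 nz1' _] := std_pred os nz; have [ps2 _ _] := std_pred os nz2.
apply: (IH t2 (rot 1 (j :: s))) => //.
apply: (rm_miso adj_sym adj_irr (ori_tojoin adj_irr j s) (ori_rot_to adj_irr os)
  (ori_snk adj_irr os) (ori_same adj os) ps1 ps2 iso).
Qed.

(** N stays indecomposable under reflections until it is concentrated at the current source, which
    must happen before step L; reflecting back from that simple recovers N. *)
Lemma std_exhaustive L s (N : mod) : ordering s -> indec (ori s) N -> mzero (rps L s N) ->
  exists t, (t < L)%N /\ miso (ori s) (std s t) N.
Proof.
elim: L s N => [|L IH] s N os Ni; first by move/(indec_nz Ni).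
case: s os Ni => [os|j s os] Ni z; first by have := ordering_mem j0 os.
have os' : ordering (rot 1 (j :: s)) by rewrite ordering_rot.
have [ij|cc] := indec_iinj adj_sym (ori_tojoin adj_irr j s) (ori_src adj j s) Ni; last first.
  exists 0%N; split=> //; apply: (concentrated_simple _ cc Ni).
  by rewrite ori_src.
have Ni' := rp_indec adj_sym adj_irr (ori_tojoin adj_irr j s) (ori_src adj j s)
  (ori_rot_to adj_irr os) (ori_same adj os) ij Ni.
have [t [tL iso]] := IH _ _ os' Ni' z.
exists t.+1; split=> //.
apply: miso_trans (miso_rm (ori_src adj j s) (ori_rot_to adj_irr os) (ori_same adj os) iso) _.
by apply: miso_sym; exact: (rm_rp adj_sym adj_irr (ori_tojoin adj_irr j s) (ori_src adj j s) ij).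
Qed.

Section Regular.
Variable c : I -> k.
Hypotheses (c0 : forall i, c i != 0) (cadj : forall i l, adj i l -> c l = - c i).

Definition regw (s : seq I) (u : I -> k) : Prop :=
  forall N : mod, indec (ori s) N -> \sum_i c i * u i * (dm N i)%:R != 0.

Lemma regw_neq0 s u : regw s u -> forall i, u i != 0.
Proof.
move=> ru i; have := ru _ (simple_indec k i (ori s)); rewrite (bigD1 i) //= dm_simple eqxx mulr1.
rewrite big1 ?addr0 => [|l /negPf n]; last by rewrite dm_simple n mulr0.
by apply: contraNneq => ->; rewrite mulr0.
Qed.

(** In terms of v = c u, [refw] sends v_j to -v_j and v_i to v_i + v_j at the neighbours i of j, the
    colouring turning the difference into a sum. This is dual to the reflection of dimension
    vectors, so the pairing is preserved. For N concentrated at j, [u j] being nonzero suffices. *)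
Lemma regw_rot j s u : ordering (j :: s) -> regw (j :: s) u -> regw (rot 1 (j :: s)) (refw adj j u).
Proof.
move=> os ru N Ni.
have [ps|cc] := indec_psurj (ori_rot_to adj_irr os) (ori_snk adj_irr os) Ni.
  have := ru _ (rm_indec adj_sym adj_irr (ori_tojoin adj_irr j s) (ori_rot_to adj_irr os)
    (ori_snk adj_irr os) (ori_same adj os) ps Ni).
  rewrite (_ : \sum_i _ = \sum_i c i * refw adj j u i * (dm N i)%:R) //.
  have E := congr1 (fun n : nat => n%:R : k) (dm_rm_eq ps); rewrite natrD natr_sum in E.
  rewrite (bigD1 j) //= [RHS](bigD1 j) //= {1}/refw eqxx.
  have -> : \sum_(i | i != j) c i * refw adj j u i * (dm N i)%:R =
    \sum_(i | i != j) c i * u i * (dm N i)%:R + c j * u j * \sum_(i | adj j i) (dm N i)%:R.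
    rewrite mulr_sumr [X in _ + X]big_mkcond [X in _ + X](bigD1 j) //= adj_irr add0r -big_split /=.
    apply: eq_bigr => i n; rewrite /refw (negPf n); case: ifP => a; last by rewrite subr0 addr0.
    by rewrite (cadj a); ring.
  rewrite -E; under [in LHS]eq_bigr => i n do rewrite dm_rm_neq //.
  by ring.
have iso := concentrated_simple (ori_snk adj_irr os j) cc Ni.
under eq_bigr do rewrite -(miso_dm _ iso) dm_simple.
rewrite (bigD1 j) //= eqxx mulr1 big1 ?addr0 => [|l /negPf ->]; last by rewrite mulr0.
rewrite /refw eqxx mulf_neq0 // oppr_eq0.
exact: regw_neq0 ru j.
Qed.

Lemma regw_regs m s u : ordering s -> regw s u -> regs adj j0 m s u.
Proof.
elim: m s u => [|m IH] s u os ru; split=> //; try exact: regw_neq0 ru.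
case: s os ru => [os|j s os] ru; first by have := ordering_mem j0 os.
by apply: IH; [rewrite ordering_rot|exact: regw_rot].
Qed.
End Regular.

Lemma dhom_miso g (M N N' : mod) : miso g N N' -> dhom g M N = dhom g M N'.
Proof.
have le N1 N2 : miso g N1 N2 -> (dhom g M N1 <= dhom g M N2)%N.
  move=> [f [h [fg hg fh hf]]].
  have Fl : linear (fun p : 'Hom(M, N1) => (linfun f \o p)%VF).
    by move=> a p q; apply/lfunP => v; rewrite comp_lfunE !add_lfunE !scale_lfunE linearP !comp_lfunE.
  apply: (@dim_sub k _ _ _ _ (mklin Fl)) => p.
    move/mem_homV => pg; apply/mem_homV; rewrite mklinE.
    have [e1 x1] := ghom_comp pg fg.
    by split=> [i v|i l v gil]; rewrite !comp_lfunE !lfunE; [exact: e1|exact: x1].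
  move=> _; rewrite mklinE => /lfunP e; apply/lfunP => v.
  by have := e v; rewrite comp_lfunE !zero_lfunE lfunE /= => e'; rewrite -[LHS]fh e' linear0.
by move=> h; apply/eqP; rewrite eqn_leq !le //; exact: miso_sym.
Qed.

Variable uu : I -> rat.
Hypotheses (uu0 : forall i, 0 < uu i) (cuu : forall i, 1 <= cart adj uu i).

Variable K : nat.
Hypothesis KP : forall i, 2 * uu i < K%:R ^+ 2.

(** A nonzero [std s t] makes all its t predecessors nonzero, with dimension vectors of norm 2
    linked by simple reflections. The bound is the same for all orderings. *)
Lemma std_zero : exists L, forall s t, ordering s -> (L <= t)%N -> mzero (std s t).
Proof.
exists (chain_bound I K) => s t os; rewrite leqNgt => /negP lt; apply: contrapT => nz.
apply: lt.
have /andP [us _] := os.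
have nzp p : (p <= t)%N -> ~ mzero (std (iter p (rot 1) s) (t - p)).
  elim: p => [|p IH] pt; first by rewrite subn0.
  have := IH (ltnW pt); rewrite -subnSK // => h.
  by have [_ h' _] := std_pred (ordering_iter p os) h.
apply: (no_long_chain adj_sym uu0 cuu (j0 := j0) KP us
  (x := fun p i => dm (std (iter p (rot 1) s) (t - p)) i)).
- by move=> i; exact: ordering_mem.
- by move=> p pt; apply: std_form; [exact: ordering_iter|exact: nzp].
move=> p i pt; have := nzp p (ltnW pt); rewrite -(subnSK pt) => h.
have [ps _ _] := std_pred (ordering_iter p os) h.
exact: dimq_rm.
Qed.

Theorem heisenberg_decomposition (c : I -> k) s u (M : mod) :
  (forall i, c i != 0) -> (forall i l, adj i l -> c l = - c i) ->
  ordering s -> regw c s u -> clean (ori s) (mo M) ->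
  exists (Y : mod) (eta : {linear M -> Y}), good adj u (ori s) eta /\
    exists (T : finType) (N : T -> mod), [/\ forall a, indec (ori s) (N a),
      biprod (ori s) Y N &
      forall X, indec (ori s) X -> #|[pred a | `[< miso (ori s) (N a) X >] ]| = dhom (ori s) M X].
Proof.
move=> c0 cadj os ru cM; have [L LP] := std_zero.
have [Y [eta [gd [T [lab [lt bip cnt]]]]]] :=
  good_ex adj_sym adj_irr (j0 := j0) os (regw_regs c0 cadj L os ru) cM (rps_zero (M := M) os (fun t => @LP s t os)).
exists Y, eta; split=> //; exists T, (fun a => std s (lab a)); split=> //.
  (* A label with zero module is counted by morphisms into zero, hence does not occur. *)
  move=> a; case: (std_cases (lab a) os) => // z.
  have := cnt _ (lt a); rewrite dhom_zero // => /card0_eq /(_ a).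
  by rewrite inE eqxx.
move=> X Xi.
have [t [tL iso]] := std_exhaustive os Xi (rps_zero (M := X) os (fun t => @LP s t os)).
rewrite -(dhom_miso M iso) -cnt //; apply: eq_card => a; rewrite !inE.
apply/asboolP/eqP => [h|->] //.
have h' : miso (ori s) (std s (lab a)) (std s t) by exact: miso_trans h (miso_sym iso).
have nz1 : ~ mzero (std s (lab a)).
  by move=> z; apply: (indec_nz Xi); exact: mzero_miso h z.
have nz2 : ~ mzero (std s t).
  by move=> z; apply: (indec_nz Xi); exact: mzero_miso iso z.
case: (ltngtP (lab a) t) => // l.
  by case: (std_distinct os l nz1).
by case: (std_distinct os l nz2); exact: miso_sym.
Qed.
End Standard.

(** * Dynkin diagrams *)

Section Labels.
Local Open Scope nat_scope.
Variable T : dynkin_type.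
Hypothesis TV : dynkin_valid T.
Local Notation n := (dynkin_rank T).
Local Notation dadj := (dynkin_adj T).

Lemma dadj_sym x y : dadj x y = dadj y x.
Proof. by rewrite /dynkin_adj orbC. Qed.

Lemma dadj_irr x : dadj x x = false.
Proof. by rewrite /dynkin_adj ltnn. Qed.

(** The numberings make each diagram a rooted tree: every vertex but 0 has exactly one smaller
    neighbour. Colourings and orderings are built along it, one vertex at a time. *)
Lemma dparent y : 0 < y < n -> exists p, [/\ p < y, dadj p y & forall x, x < y -> dadj x y -> x = p].
Proof.
move=> /andP [y0 yn].
have E x : x < y -> dadj x y = dynkin_edge T x y.
  by move=> xy; rewrite /dynkin_adj xy ltnNge (ltnW xy) /= orbF.
have [p [py pE pu]] : exists p, [/\ p < y, dynkin_edge T p y & forall x, dynkin_edge T x y -> x = p].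
  case: T TV yn => m /= mv ym.
  - by exists y.-1; split=> [||x /eqP ->]; rewrite ?prednK //; apply/eqP; lia.
  - case: (eqVneq y m.-1) => [e|ne].
      by exists (m - 3); split=> [||x /eqP //]; rewrite ?eqxx //; lia.
    by exists y.-1; split=> [||x /eqP ->]; rewrite ?prednK //; apply/eqP; lia.
  - case: (eqVneq y m.-1) => [e|ne].
      by exists 2; split=> [||x /eqP //]; rewrite ?eqxx //; lia.
    by exists y.-1; split=> [||x /eqP ->]; rewrite ?prednK //; apply/eqP; lia.
exists p; split=> //; first by rewrite E.
by move=> x xy; rewrite E //; exact: pu.
Qed.

Lemma dcolour m : m <= n -> exists c : nat -> bool,
  forall x y, x < m -> y < m -> dadj x y -> c y = ~~ c x.
Proof.
elim: m => [|m IH] mn; first by exists xpredT.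
have [c cP] := IH (ltnW mn).
case: (posnP m) => [m0|m0].
  exists xpredT => x y; rewrite m0 !ltnS !leqn0 => /eqP -> /eqP ->.
  by rewrite dadj_irr.
have [p [pm pa pu]] := dparent (introT andP (conj m0 mn)).
exists (fun x => if x == m then ~~ c p else c x) => x y.
rewrite !ltnS (leq_eqVlt x) (leq_eqVlt y) => /orP [/eqP ->|xm] /orP [/eqP ->|ym].
- by rewrite dadj_irr.
- by rewrite dadj_sym eqxx (ltn_eqF ym) => /(pu _ ym) ->; rewrite negbK.
- by rewrite eqxx (ltn_eqF xm) => /(pu _ xm) ->.
- by rewrite (ltn_eqF xm) (ltn_eqF ym); exact: cP.
Qed.

(** The vertex m has a single smaller neighbour, so putting it at the end or at the front of the
    list respects the one new condition. *)
Lemma dorder (before : rel nat) m : m <= n ->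
  (forall x y, x < n -> y < n -> dadj x y -> before x y = ~~ before y x) ->
  exists s : seq nat, [/\ uniq s, forall x, (x \in s) = (x < m) &
    forall x y, x < m -> y < m -> dadj x y -> before x y -> index x s < index y s].
Proof.
move=> mn bP; elim: m mn => [|m IH] mn; first by exists [::].
have [s [us sm so]] := IH (ltnW mn).
have ms : m \notin s by rewrite sm ltnn.
case: (posnP m) => [m0|m0].
  exists [:: m]; split=> // [x|x y]; rewrite m0 ?inE ?ltnS ?leqn0 //.
  by move=> /eqP -> /eqP ->; rewrite dadj_irr.
have [p [pm pa pu]] := dparent (introT andP (conj m0 mn)).
case bpm : (before p m).
  exists (rcons s m); split=> [|x|x y]; first by rewrite rcons_uniq ms.
    by rewrite mem_rcons inE sm ltnS (leq_eqVlt x).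
  rewrite !ltnS (leq_eqVlt x) (leq_eqVlt y) -cats1 !index_cat.
  move=> /orP [/eqP ->|xm] /orP [/eqP ->|ym].
  - by rewrite dadj_irr.
  - rewrite dadj_sym => /(pu _ ym) ->; rewrite bP ?(ltn_trans pm mn) //.
      by rewrite bpm.
    by rewrite dadj_sym.
  - by rewrite sm xm (negPf ms) /= eqxx addn0 index_mem sm xm.
  - by rewrite !sm xm ym; exact: so.
exists (m :: s); split=> [|x|x y]; first by rewrite /= ms.
  by rewrite inE sm ltnS (leq_eqVlt x).
rewrite !ltnS (leq_eqVlt x) (leq_eqVlt y) /=.
move=> /orP [/eqP ->|xm] /orP [/eqP ->|ym].
- by rewrite dadj_irr.
- by rewrite eqxx eq_sym (ltn_eqF ym).
- by move=> /(pu _ xm) ->; rewrite bpm.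
- by rewrite ![m == _]eq_sym (ltn_eqF xm) (ltn_eqF ym) ltnS; exact: so.
Qed.

End Labels.

Section SumRoot.
Local Open Scope nat_scope.

(* The sum of the positive coroots, in the numbering of the diagrams. *)
Definition dsumroot (T : dynkin_type) (i : nat) : nat :=
  match T with
  | TypeA m => i.+1 * (m - i)
  | TypeD m => if i < m - 2 then i.+1 * (2 * m - i - 2) else if i < m then (m * (m - 1)) %/ 2 else 0
  | TypeE m => nth 0 (if m == 6 then [:: 16; 30; 42; 30; 16; 22] else
      if m == 7 then [:: 34; 66; 96; 75; 52; 27; 49] else
      [:: 92; 182; 270; 220; 168; 114; 58; 136]) i
  end.

Lemma uniq_sum_le (s r : seq nat) (f : nat -> nat) :
  uniq s -> {subset s <= r} -> \sum_(x <- s) f x <= \sum_(x <- r) f x.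
Proof.
elim: s r => [|x s IH] r /=; first by rewrite big_nil.
move=> /andP [xs us] sr; have xr : x \in r by apply: sr; rewrite mem_head.
rewrite big_cons (perm_big _ (perm_to_rem xr)) big_cons leq_add2l.
apply: IH => // y ys; apply: rem_mem; first by apply: contraNneq xs => <-.
by apply: sr; rewrite inE ys orbT.
Qed.

(** A form of the sum that evaluates, so that type E is decided by computation. *)
Definition dsumnb (T : dynkin_type) (i : nat) : nat :=
  sumn [seq dsumroot T l | l <- iota 0 (dynkin_rank T) & dynkin_adj T i l].

Lemma dsumnbE T i : \sum_(l : 'I_(dynkin_rank T) | dynkin_adj T i l) dsumroot T l = dsumnb T i.
Proof. by rewrite /dsumnb sumnE big_map big_filter -(big_mkord (dynkin_adj T i) (dsumroot T)) /index_iota subn0. Qed.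

Lemma dsumnb_le T i r : (forall l, l < dynkin_rank T -> dynkin_adj T i l -> l \in r) ->
  dsumnb T i <= \sum_(x <- r) dsumroot T x.
Proof.
move=> h; rewrite /dsumnb sumnE big_map; apply: uniq_sum_le.
  by rewrite filter_uniq ?iota_uniq.
by move=> l; rewrite mem_filter mem_iota => /andP [a /andP [_ l0]]; exact: h.
Qed.

(** In all types twice the value at a vertex exceeds the sum over its neighbours by 2, the pairing
    of the sum of the positive coroots with a simple root. *)
Lemma dsumrootP T i : dynkin_valid T -> i < dynkin_rank T ->
  (0 < dsumroot T i) && (dsumnb T i < 2 * dsumroot T i).
Proof.
case: T => m mv im.
- apply/andP; split; first by rewrite muln_gt0 subn_gt0.
  have := @dsumnb_le (TypeA m) i (if i == 0 then [:: 1] else [:: i.-1; i.+1]).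
  move=> /(_ _)/leq_ltn_trans; apply.
    by move=> l lm; rewrite /dynkin_adj /= => h; case: eqP => ?; rewrite !inE; lia.
  rewrite /= in im; case: eqP => [->|/eqP i0]; rewrite !big_cons big_nil /=; first by lia.
  (* These substitutions remove the truncated subtractions, which leaves a polynomial inequality. *)
  have [p ip] : exists p, i = p.+1 by exists i.-1; lia.
  have [q mq] : exists q, m = p + q + 2 by exists (m - (p + 2)); lia.
  rewrite ip mq /=.
  have -> : p + q + 2 - p = q + 2 by lia.
  have -> : p + q + 2 - p.+2 = q by lia.
  have -> : p + q + 2 - p.+1 = q.+1 by lia.
  by nia.
- have H2 : 2 * ((m * (m - 1)) %/ 2) = m * (m - 1).
    by rewrite mulnC divnK // dvdn2 oddM; case: (m) mv => // m' _; rewrite subn1 /=; case: (odd m').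
  set H := (m * (m - 1)) %/ 2 in H2.
  rewrite /= in mv im.
  have fE l : dsumroot (TypeD m) l = if l < m - 2 then l.+1 * (2 * m - l - 2) else if l < m then H else 0.
    by [].
  have [q mq] : exists q, m = q + 4 by exists (m - 4); lia.
  apply/andP; split.
    rewrite fE; case: ifP => h; last by rewrite im; nia.
    by rewrite muln_gt0 /=; lia.
  have nb r := @dsumnb_le (TypeD m) i r.
  have nbP l : dynkin_adj (TypeD m) i l -> l < m -> [/\ (i < l -> (l == m.-1) && (i == m - 3) || (l != m.-1) && (l == i.+1))
     & l < i -> (i == m.-1) && (l == m - 3) || (i != m.-1) && (i == l.+1)] /\ (i != l) && (l < m).
    rewrite /dynkin_adj /= => h lm; split; last by rewrite lm andbT; apply: contraTneq h => ->; rewrite ltnn.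
    by split=> il; move: h; rewrite il [_ < _]ltnNge (ltnW il) /= ?orbF; case: (_ == m.-1) => /= ->.
  have tri (r : seq nat) (h : forall l, [/\ i < l -> (l == m.-1) && (i == m - 3) || (l != m.-1) && (l == i.+1)
     & l < i -> (i == m.-1) && (l == m - 3) || (i != m.-1) && (i == l.+1)] /\ (i != l) && (l < m) -> l \in r) :
     dsumnb (TypeD m) i <= \sum_(x <- r) dsumroot (TypeD m) x.
    by apply: nb => l lm a; apply: h; exact: nbP.
  case: (leqP (m - 2) i) => h.
    apply: leq_ltn_trans (tri [:: m - 3] _) _ => [l [[h1 h2] h3]|]; first by rewrite inE; lia.
    rewrite big_cons big_nil !fE im (_ : (i < m - 2) = false); last by lia.
    have -> : (m - 3 < m - 2) = true by lia.
    by rewrite mq in H2 *; nia.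
  case: (eqVneq i (m - 3)) => [e|ne].
    apply: leq_ltn_trans (tri [:: m - 4; m - 2; m - 1] _) _ => [l [[h1 h2] h3]|].
      by rewrite !inE; lia.
    rewrite !big_cons big_nil !fE h.
    have -> : (m - 4 < m - 2) = true by lia.
    have -> : (m - 2 < m - 2) = false by lia.
    have -> : (m - 1 < m - 2) = false by lia.
    have -> : (m - 2 < m) = true by lia.
    have -> : (m - 1 < m) = true by lia.
    rewrite e mq in H2 *; nia.
  case: (posnP i) => i0.
    apply: leq_ltn_trans (tri [:: 1] _) _ => [l [[h1 h2] h3]|].
      by rewrite !inE; lia.
    rewrite !big_cons big_nil !fE h.
    have -> : (1 < m - 2) = true by lia.
    by rewrite i0 mq; nia.
  apply: leq_ltn_trans (tri [:: i.-1; i.+1] _) _ => [l [[h1 h2] h3]|].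
    by rewrite !inE; lia.
  rewrite !big_cons big_nil !fE h.
  have -> : (i.-1 < m - 2) = true by lia.
  have -> : (i.+1 < m - 2) = true by lia.
  have [p ip] : exists p, i = p.+1 by exists i.-1; lia.
  have [d md] : exists d, m = p + d + 5 by exists (m - (p + 5)); lia.
  rewrite ip md /=.
  have -> : 2 * (p + d + 5) - p - 2 = p + 2 * d + 8 by lia.
  have -> : 2 * (p + d + 5) - p.+2 - 2 = p + 2 * d + 6 by lia.
  have -> : 2 * (p + d + 5) - p.+1 - 2 = p + 2 * d + 7 by lia.
  by nia.
move: mv => /andP [m6 m8]; have : m \in [:: 6; 7; 8] by rewrite !inE; lia.
pose ok M := all (fun i => (0 < dsumroot (TypeE M) i) && (dsumnb (TypeE M) i < 2 * dsumroot (TypeE M) i)) (iota 0 M).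
have okP M : ok M -> i < M -> (0 < dsumroot (TypeE M) i) && (dsumnb (TypeE M) i < 2 * dsumroot (TypeE M) i).
  by move=> /allP h iM; apply: h; rewrite mem_iota.
rewrite !inE => /or3P [] /eqP me; rewrite me in im *; by apply: okP im; vm_compute.
Qed.
End SumRoot.

Section DynkinQuiver.
Local Open Scope nat_scope.
Variable Q : quiver.

Definition qadj (i l : vert Q) : bool :=
  0 < #|[set a : arrow Q | ((qtail a == i) && (qhead a == l)) || ((qtail a == l) && (qhead a == i))]|.

Lemma qadj_arrow a : qadj (qtail a) (qhead a).
Proof. by apply/card_gt0P; exists a; rewrite inE !eqxx. Qed.

Lemma qadj_sym : symmetric qadj.
Proof.
by move=> i l; rewrite /qadj; congr (0 < _); apply: eq_card => a; rewrite !inE orbC.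
Qed.

Lemma qadj_ex i l : qadj i l ->
  exists a : arrow Q, (qtail a == i) && (qhead a == l) || (qtail a == l) && (qhead a == i).
Proof. by case/card_gt0P => a; rewrite inE; exists a. Qed.

Hypothesis HQ : dynkin Q.

Lemma dynkin_labels : exists (T : dynkin_type) (phi : vert Q -> 'I_(dynkin_rank T)),
  [/\ dynkin_valid T, bijective phi, forall i l, qadj i l = dynkin_adj T (phi i) (phi l) &
   forall a b : arrow Q, (qtail a == qtail b) && (qhead a == qhead b)
                         || (qtail a == qhead b) && (qhead a == qtail b) -> a = b].
Proof.
have [T [TV [phi pb pc]]] := HQ; exists T, phi; split=> // [i l|a b ab].
  by rewrite /qadj pc; case: dynkin_adj.
have := pc (qtail b) (qhead b); set S := [set _ | _] => cS.
have /card_le1P h : (#|S| <= 1)%N by rewrite cS; case: dynkin_adj.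
have bS : b \in S by rewrite inE !eqxx.
have := h b bS a; rewrite [a \in S]inE inE.
by rewrite ab => /esym/eqP.
Qed.

Lemma qadj_irr : irreflexive qadj.
Proof. by have [T [phi [_ _ E _]]] := dynkin_labels; move=> i; rewrite E dadj_irr. Qed.

Lemma qarrow_uniq (a b : arrow Q) : qtail a = qtail b -> qhead a = qhead b -> a = b.
Proof.
have [T [phi [_ _ _ U]]] := dynkin_labels.
by move=> e1 e2; apply: U; rewrite e1 e2 !eqxx.
Qed.

Lemma qarrow_asym (a b : arrow Q) : qtail a = qhead b -> qhead a = qtail b -> False.
Proof.
have [T [phi [_ _ _ U]]] := dynkin_labels.
move=> e1 e2; have e : a = b by apply: U; rewrite e1 e2 !eqxx orbT.
by have := qadj_arrow a; rewrite {1}e1 e qadj_irr.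
Qed.

Lemma dynkin_colour : exists c : vert Q -> bool, forall i l, qadj i l -> c l = ~~ c i.
Proof.
have [T [phi [TV _ E _]]] := dynkin_labels.
have [c cP] := dcolour TV (leqnn _).
by exists (fun i => c (phi i)) => i l; rewrite E; apply: cP.
Qed.

(** On a left module an arrow acts from the space at its head to the space at its tail. With heads
    first, the first vertex is a source of structure maps. *)
Lemma dynkin_order : exists s : seq (vert Q), ordering s /\
  forall a : arrow Q, index (qhead a) s < index (qtail a) s.
Proof.
have [T [phi [TV pb E U]]] := dynkin_labels; have [psi pK Kp] := pb.
pose before x y := [exists a : arrow Q, (val (phi (qhead a)) == x) && (val (phi (qtail a)) == y)].
have bP x y : x < dynkin_rank T -> y < dynkin_rank T -> dynkin_adj T x y -> before x y = ~~ before y x.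
  move=> xn yn xy; have : qadj (psi (Ordinal xn)) (psi (Ordinal yn)) by rewrite E !Kp.
  case/qadj_ex => a /orP [] /andP [/eqP ta /eqP ha].
    have -> : before y x by apply/existsP; exists a; rewrite ta ha !Kp !eqxx.
    apply: negbTE; apply/negP => /existsP [b /andP [/eqP hb /eqP tb]].
    apply: (@qarrow_asym a b); apply: (can_inj pK); apply: val_inj; rewrite ?ta ?ha Kp /= ?hb ?tb //.
  have -> : before x y by apply/existsP; exists a; rewrite ta ha !Kp !eqxx.
  apply: esym; apply/negP => /existsP [b /andP [/eqP hb /eqP tb]].
  apply: (@qarrow_asym a b); apply: (can_inj pK); apply: val_inj; rewrite ?ta ?ha Kp /= ?hb ?tb //.
have [s [us sm so]] := dorder TV (leqnn _) bP.
pose s' := [seq psi i | i <- pmap (insub : nat -> option 'I_(dynkin_rank T)) s].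
have vs : [seq val (phi i) | i <- s'] = s.
  rewrite /s' -map_comp (eq_map (g := val)) ?pmap_filter; last by move=> i /=; rewrite Kp.
    by apply/all_filterP/allP => i; rewrite sm => im; rewrite /= (insubT (fun j => j < dynkin_rank T)%N im).
  by move=> i /=; case: insubP.
have idx i : index i s' = index (val (phi i)) s.
  rewrite -vs; apply: esym; apply: (index_map (f := fun i => val (phi i))).
  by move=> x y /val_inj /(can_inj pK).
exists s'; split.
  apply/andP; split; first by rewrite -(map_inj_uniq (f := fun i => val (phi i))) ?vs // => x y /val_inj /(can_inj pK).
  apply/allP => i _; have : val (phi i) \in s by rewrite sm ltn_ord.
  by rewrite -vs => /mapP [l ls /val_inj /(can_inj pK) ->].
move=> a; rewrite !idx; apply: so; rewrite ?ltn_ord //.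
by have := qadj_arrow a; rewrite qadj_sym E.
by apply/existsP; exists a; rewrite !eqxx.
Qed.

Lemma dynkin_positive : exists uu : vert Q -> nat,
  forall i, 0 < uu i /\ \sum_(l | qadj i l) uu l < 2 * uu i.
Proof.
have [T [phi [TV [psi pK Kp] E _]]] := dynkin_labels.
exists (fun i => dsumroot T (phi i)) => i.
have /andP [h1 h2] := dsumrootP TV (ltn_ord (phi i)); split=> //.
rewrite (reindex psi) /=; last by exists phi => l _; [exact: Kp|exact: pK].
under eq_bigl => l do rewrite E Kp.
by under eq_bigr => l _ do rewrite Kp; rewrite dsumnbE.
Qed.

Lemma dynkin_nonempty : exists i : vert Q, true.
Proof.
have [T [phi [TV [psi pK Kp] _ _]]] := dynkin_labels.
have h : 0 < dynkin_rank T by move: TV; case: T {phi psi pK Kp} => m /=; lia.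
by exists (psi (Ordinal h)).
Qed.
End DynkinQuiver.

(** * Path algebras *)

Section PathInduction.
Variables (k : fieldType) (P : quiver).
Local Notation pa := (pathalg k P).

Lemma pelt_nil (p : qpath P) : parrows p = [::] -> pelt k p = idem k (psrc p).
Proof. by move=> e; congr pelt; apply: qpathP. Qed.

Lemma pelt_cons (p : qpath P) a s : parrows p = a :: s ->
  exists p' : qpath P, [/\ psrc p' = qhead a, parrows p' = s, psrc p = qtail a &
    pelt k p = arr k a * pelt k p'].
Proof.
move=> e; have w : walk (psrc p) (parrows p) := valP p.
move: w; rewrite e /= => /andP [/eqP ta ws].
exists (exist _ (qhead a, s) ws); split=> //.
rewrite -[RHS]/(pa_mul _ _) /arr pa_mulUU /pmul; case: eqP => [h|[]] //=.
by congr pelt; apply: qpathP.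
Qed.

Lemma pa_rect (D : pa -> Prop) : D 0 -> (forall c f g, D f -> D g -> D (c *: f + g)) ->
  (forall i, D (idem k i)) -> (forall a f, D f -> D (arr k a * f)) -> forall f, D f.
Proof.
move=> D0 DP Di Da f.
have Dp p : D (pelt k p).
  move En : (parrows p) => s; elim: s p En => [|a s IH] p En.
    by rewrite pelt_nil.
  by have [p' [_ /IH Dp' _ ->]] := pelt_cons En; exact: Da.
have -> : f = \sum_(p <- finmap.enum_fset (monalg.msupp (f : monalg.malg _ _))) fm_coef p f *: pelt k p.
  exact: (fm_sum (finmap.fsubset_refl _)).
elim/big_ind: _ => // [g h Dg Dh|p _]; first by rewrite -[g]scale1r; exact: DP.
by rewrite -[_ *: _]addr0; exact: DP.
Qed.

Lemma idemM i l : idem k i * idem k l = if i == l then idem k l else 0 :> pa.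
Proof.
rewrite -[LHS]/(pa_mul _ _) /idem pa_mulUU pmul_idl /psrc /=.
by case: eqP.
Qed.

Lemma sum_idem : \sum_i idem k i = 1 :> pa.
Proof. by []. Qed.

Lemma idem_arr a : idem k (qtail a) * arr k a = arr k a :> pa.
Proof. by rewrite -[LHS]/(pa_mul _ _) /idem /arr pa_mulUU pmul_idl /psrc /= eqxx. Qed.

Lemma arr_idem a : arr k a * idem k (qhead a) = arr k a :> pa.
Proof. by rewrite -[LHS]/(pa_mul _ _) /idem /arr pa_mulUU pmul_idr /ptgt /= eqxx. Qed.

Lemma idem_arr_idem i l a : idem k i * arr k a * idem k l =
  if (i == qtail a) && (l == qhead a) then arr k a else 0 :> pa.
Proof.
rewrite -{1}(idem_arr a) -{1}(arr_idem a) !mulrA idemM -!mulrA idemM.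
case: (eqVneq i (qtail a)) => [_|n] /=; last by rewrite mul0r.
rewrite eq_sym; case: (eqVneq l (qhead a)) => [->|n]; last by rewrite !mulr0.
by rewrite mulrA idem_arr arr_idem.
Qed.

Lemma pa_scaleE (c : k) (f : pa) : c *: f = (c *: (1 : pa) : pa) * f.
Proof. by rewrite -pa_scaleAl mul1r. Qed.

End PathInduction.

Section PathAction.
Variables (k : fieldType) (P : quiver) (W : lmodType k).
Variables (e : vert P -> {linear W -> W}) (A : arrow P -> {linear W -> W}).
Local Notation pa := (pathalg k P).

Fixpoint pact (i : vert P) (s : seq (arrow P)) (w : W) : W :=
  if s is a :: s' then A a (pact (qhead a) s' w) else e i w.

Definition act (f : pa) (w : W) : W := linext (fun p => pact (psrc p) (parrows p) w) f.

Lemma act_linl w : linear (fun f => act f w).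
Proof. exact: linext_linear. Qed.

Lemma pact_lin i s : linear (pact i s).
Proof. by elim: s i => [|a s IH] i c u v; rewrite /= ?IH linearP. Qed.

Lemma act_linr f : linear (act f).
Proof.
move=> c u v; rewrite /act /linext scaler_sumr -big_split /=; apply: eq_bigr => p _.
by rewrite pact_lin scalerDr !scalerA mulrC.
Qed.

Lemma act0l w : act 0 w = 0. Proof. exact: linear0 (linext _). Qed.
Lemma actDl f g w : act (f + g) w = act f w + act g w.
Proof. by have := act_linl w 1 f g; rewrite !scale1r. Qed.
Lemma actZl c f w : act (c *: f) w = c *: act f w.
Proof. by have := act_linl w c f 0; rewrite !addr0 act0l addr0. Qed.
Lemma act_suml (J : Type) (r : seq J) (R : pred J) (F : J -> pa) w :
  act (\sum_(i <- r | R i) F i) w = \sum_(i <- r | R i) act (F i) w.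
Proof. by apply: (big_morph (act^~ w)) => [f g|]; [exact: actDl|exact: act0l]. Qed.

Lemma act_pelt p w : act (pelt k p) w = pact (psrc p) (parrows p) w.
Proof. exact: linextU. Qed.

Lemma act_idem i w : act (idem k i) w = e i w.
Proof. exact: act_pelt. Qed.

Hypotheses (eP : forall i l v, e i (e l v) = if i == l then e l v else 0)
  (eS : forall v, \sum_i e i v = v)
  (Ae : forall a v, A a (e (qhead a) v) = A a v) (eA : forall a v, e (qtail a) (A a v) = A a v).

Lemma act_arr a w : act (arr k a) w = A a w.
Proof. by rewrite act_pelt /= Ae. Qed.

Lemma pact_src (p : qpath P) w : e (psrc p) (pact (psrc p) (parrows p) w) = pact (psrc p) (parrows p) w.
Proof.
case En : (parrows p) => [|a s] /=; first by rewrite eP eqxx.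
by have [_ [_ _ -> _]] := pelt_cons k En; rewrite eA.
Qed.

Lemma act_arrM a f w : act (arr k a * f) w = A a (act f w).
Proof.
move: f; apply: (@lin_ext k _ W) => [c f g|c f g|p].
- by rewrite -[arr k a * _]/(pa_mul _ _) pa_mul_linearr act_linl.
- by rewrite act_linl linearP.
rewrite -/(pelt k p) -[arr k a * _]/(pa_mul _ _) /arr pa_mulUU act_pelt /pmul.
case: eqP => [h|h] /=.
  by rewrite act_pelt; change (A a (pact (qhead a) (parrows p) w) = A a (pact (psrc p) (parrows p) w)); congr (A a (pact _ _ _)); exact: h.
rewrite act0l -pact_src -Ae eP; case: eqP => [h'|_]; last by rewrite linear0.
by case: h.
Qed.

Lemma act_idemM i f w : act (idem k i * f) w = e i (act f w).
Proof.
move: f; apply: (@lin_ext k _ W) => [c f g|c f g|p].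
- by rewrite -[idem k i * _]/(pa_mul _ _) pa_mul_linearr act_linl.
- by rewrite act_linl linearP.
rewrite -/(pelt k p) -[idem k i * _]/(pa_mul _ _) /idem pa_mulUU act_pelt pmul_idl.
by rewrite -[in RHS]pact_src eP; case: (i == psrc p) => /=; rewrite ?act0l ?act_pelt ?pact_src.
Qed.

Lemma actM f g w : act (f * g) w = act f (act g w).
Proof.
move: f; apply: pa_rect => [|c f f' Ef Ef'|i|a f Ef].
- by rewrite mul0r !act0l.
- by rewrite mulrDl -pa_scaleAl !actDl !actZl Ef Ef'.
- by rewrite act_idemM act_idem.
- by rewrite -mulrA !act_arrM Ef.
Qed.

Lemma act1 w : act 1 w = w.
Proof. by rewrite -sum_idem act_suml -[RHS]eS; apply: eq_bigr => i _; rewrite act_idem. Qed.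

Lemma act_unique (H : pa -> W -> W) w :
  (forall c f g, H (c *: f + g) w = c *: H f w + H g w) ->
  (forall i, H (idem k i) w = e i w) ->
  (forall a f, H (arr k a * f) w = A a (H f w)) -> forall f, H f w = act f w.
Proof.
move=> HP Hi Ha; have H0 : H 0 w = 0.
  by have := HP (-1) 0 0; rewrite scaleN1r addNr scaleN1r addNr.
apply: pa_rect => [|c f g Ef Eg|i|a f Ef].
- by rewrite H0 act0l.
- by rewrite HP act_linl Ef Eg.
- by rewrite Hi act_idem.
- by rewrite Ha act_arrM Ef.
Qed.

End PathAction.

Lemma act_hom (k : fieldType) (P : quiver) (W W' : lmodType k)
  (e : vert P -> {linear W -> W}) (A : arrow P -> {linear W -> W})
  (e' : vert P -> {linear W' -> W'}) (A' : arrow P -> {linear W' -> W'}) (F : {linear W -> W'}) :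
  (forall i w, F (e i w) = e' i (F w)) -> (forall a w, F (A a w) = A' a (F w)) ->
  forall f w, F (act e A f w) = act e' A' f (F w).
Proof.
move=> Fe FA f w; rewrite /act /linext linear_sum; apply: eq_bigr => p _; rewrite linearZ_LR.
congr (_ *: _); move: (psrc p) (parrows p) => i s.
by elim: s i => [|a s IH] i /=; rewrite ?Fe // FA IH.
Qed.

Lemma linear_pack (R : pzRingType) (U V : lmodType R) (f : U -> V) :
  linear f -> exists F : {linear U -> V}, F =1 f.
Proof.
move=> H; pose F : {linear U -> V} := HB.pack f (GRing.isLinear.Build R U V _ f H).
by exists F.
Qed.

(** * Modules over the path algebra as representations *)

Section Modules.
Variables (k : fieldType) (Q : quiver).
Hypothesis HQ : dynkin Q.
Variable s : seq (vert Q).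
Hypothesis sP : forall a : arrow Q, (index (qhead a) s < index (qtail a) s)%N.
Local Notation I := (vert Q).
Local Notation adj := (@qadj Q).
Local Notation g := (ori adj s).
Local Notation pa := (pathalg k Q).

Lemma ori_arrow (a : arrow Q) : g (qtail a) (qhead a).
Proof. by rewrite /ori qadj_arrow sP. Qed.

Lemma ori_ex i l : g i l -> exists a : arrow Q, qtail a = i /\ qhead a = l.
Proof.
move=> /andP [/qadj_ex [a /orP [] /andP [/eqP ta /eqP ha]] h]; exists a => //.
by move: (sP a); rewrite ta ha ltnNge (ltnW h).
Qed.

Section Acting.
Variables (Z : lmodType k) (L : ops I Z) (LP : isops L).

Definition arrmap (a : arrow Q) : {linear Z -> Z} := oe L (qtail a) \o (ox L \o oe L (qhead a)).
Definition actL : pa -> Z -> Z := act (oe L) arrmap.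

Lemma arrmapE a v : arrmap a v = oe L (qtail a) (ox L (oe L (qhead a) v)). Proof. by []. Qed.
Lemma arrmap_e a v : arrmap a (oe L (qhead a) v) = arrmap a v.
Proof. by rewrite !arrmapE oee. Qed.
Lemma e_arrmap a v : oe L (qtail a) (arrmap a v) = arrmap a v.
Proof. by rewrite !arrmapE oee. Qed.

Lemma actL_idem i v : actL (idem k i) v = oe L i v. Proof. exact: act_idem. Qed.
Lemma actL_arr a v : actL (arr k a) v = arrmap a v. Proof. exact: (act_arr arrmap_e). Qed.
Lemma actLM f h v : actL (f * h) v = actL f (actL h v).
Proof. exact: (actM (oeE LP) arrmap_e e_arrmap). Qed.
Lemma actL1 v : actL 1 v = v. Proof. exact: (act1 _ (sum_oe LP)). Qed.
Lemma actL_unique (H : pa -> Z -> Z) w :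
  (forall c f g, H (c *: f + g) w = c *: H f w + H g w) ->
  (forall i, H (idem k i) w = oe L i w) ->
  (forall a f, H (arr k a * f) w = arrmap a (H f w)) -> forall f, H f w = actL f w.
Proof. exact: (act_unique (oeE LP) arrmap_e e_arrmap). Qed.
End Acting.

Lemma ghom_act (Z Z' : lmodType k) (L : ops I Z) (L' : ops I Z') (f : {linear Z -> Z'}) :
  ghom g L L' f -> forall a v, f (actL L a v) = actL L' a (f v).
Proof.
move=> fg; apply: act_hom => [i v|a v]; first by rewrite fg.1.
by rewrite !arrmapE fg.2 // ori_arrow.
Qed.

Lemma act_ghom (Z Z' : lmodType k) (L : ops I Z) (L' : ops I Z') (f : {linear Z -> Z'}) :
  isops L -> isops L' -> (forall a v, f (actL L a v) = actL L' a (f v)) -> ghom g L L' f.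
Proof.
move=> LP LP' h; split=> [i v|i l v /ori_ex [a [<- <-]]]; first by rewrite -!actL_idem h.
by rewrite -[X in f X]arrmapE -[RHS]arrmapE -(actL_arr LP) -(actL_arr LP') h.
Qed.

Section ToMod.
Variable N : fdmod k Q.
Local Notation A := (fd_act N).
Lemma fdD f h : A (f + h) = A f + A h.
Proof. by have := fd_act_linear N 1 f h; rewrite !scale1r. Qed.
Lemma fd0 : A 0 = 0.
Proof. by have := fdD 0 0; rewrite addr0 => /eqP; rewrite -subr_eq0 opprD addNKr oppr_eq0 => /eqP. Qed.
Lemma fdZ c f : A (c *: f) = c *: A f.
Proof. by have := fd_act_linear N c f 0; rewrite fd0 !addr0. Qed.
Lemma fd_sum (J : finType) (R : pred J) (F : J -> pa) : A (\sum_(i | R i) F i) = \sum_(i | R i) A (F i).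
Proof. by apply: (big_morph A); [exact: fdD|exact: fd0]. Qed.
Lemma fdM f h v : A (f * h) v = A f (A h v).
Proof. by rewrite fd_actM comp_lfunE. Qed.

Definition tomod_ops : ops I (fd_space N) :=
  Ops (fun i => A (idem k i) : {linear _ -> _}) (A (\sum_a arr k a) : {linear _ -> _}).
Lemma tomod_isops : isops tomod_ops.
Proof.
split=> [i l v|v] /=.
  by rewrite -fdM idemM; case: eqP; rewrite // fd0 zero_lfunE.
by rewrite -sum_lfunE -fd_sum sum_idem fd_act1 id_lfunE.
Qed.
Definition tomod : mod k I := Mod tomod_isops.

Lemma tomod_exe i l v : oe (mo tomod) i (ox (mo tomod) (oe (mo tomod) l v)) =
  \sum_(a | (qtail a == i) && (qhead a == l)) A (arr k a) v.
Proof.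
have E : idem k i * ((\sum_a arr k a) * idem k l) = \sum_a idem k i * (arr k a * idem k l) :> pa.
  have -> : (\sum_a arr k a) * idem k l = \sum_a arr k a * idem k l :> pa by exact: pa_mul_suml.
  exact: pa_mul_sumr.
have -> : oe (mo tomod) i (ox (mo tomod) (oe (mo tomod) l v)) = A (idem k i * ((\sum_a arr k a) * idem k l)) v.
  by rewrite !fdM.
rewrite E fd_sum sum_lfunE [RHS]big_mkcond; apply: eq_bigr => a _.
rewrite mulrA idem_arr_idem ![_ == i]eq_sym ![_ == l]eq_sym.
by case: ifP; rewrite // fd0 zero_lfunE.
Qed.

(** There is at most one arrow between two vertices, so the arrow is recovered as a component of the
    sum of all arrows; hence a single operator [ox] carries the whole representation. *)
Lemma tomod_arr a v : arrmap (mo tomod) a v = A (arr k a) v.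
Proof.
rewrite arrmapE tomod_exe (bigD1 a) ?eqxx //= big1 ?addr0 // => b /andP [/andP [/eqP tb /eqP hb]].
by rewrite (qarrow_uniq HQ tb hb) eqxx.
Qed.

Lemma tomod_act f v : actL (mo tomod) f v = A f v.
Proof.
apply: esym; apply: (actL_unique (mP tomod) (H := fun f v => A f v)) => [c f' h|//|a f'].
  by rewrite fdD fdZ add_lfunE scale_lfunE.
by rewrite fdM tomod_arr.
Qed.
End ToMod.

Section OfMod.
Variable X : mod k I.
Definition ofmod : fdmod k Q.
Proof.
apply: (@FdMod k Q X (fun f => linfun (mklin (act_linr (oe (mo X)) (arrmap (mo X)) f)))).
- move=> c f h; apply/lfunP => v; rewrite add_lfunE scale_lfunE !lfunE !mklinE.
  exact: act_linl.
- apply/lfunP => v; rewrite id_lfunE lfunE mklinE; exact: (actL1 (mP X)).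
- move=> f h; apply/lfunP => v; rewrite comp_lfunE !lfunE !mklinE; exact: (actLM (mP X)).
Defined.

Lemma ofmod_act f v : fd_act ofmod f v = actL (mo X) f v.
Proof. by rewrite lfunE mklinE. Qed.

Lemma ofmod_miso : miso g X (tomod ofmod).
Proof.
have h a v : actL (mo (tomod ofmod)) a v = actL (mo X) a v by rewrite tomod_act ofmod_act.
exists idfun, idfun; split=> //.
  by apply: act_ghom => [||a v]; rewrite ?h //; exact: mP.
by apply: act_ghom => [||a v]; rewrite ?h //; exact: mP.
Qed.
End OfMod.

Lemma mod_scaleE (N : fdmod k Q) (a : pa) (v : mod_of N) : a *: v = fd_act N a v.
Proof. by []. Qed.

Lemma lmod_iso_miso (N N' : fdmod k Q) :
  lmod_iso (mod_of N) (mod_of N') <-> miso g (tomod N) (tomod N').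
Proof.
split=> [[f [h fh hf]]|[f [h [fg hg fh hf]]]].
  have fl : linear (f : fd_space N -> fd_space N').
    move=> c u v; have E (N1 : fdmod k Q) (y : fd_space N1) : c *: y = fd_act N1 (c *: (1 : pa)) y.
      by rewrite fdZ fd_act1 scale_lfunE id_lfunE.
    rewrite !E; exact: (linearP f (c *: (1 : pa)) u v).
  have fi v : mklin fl v = f v by exact: (mklinE fl).
  apply: (@miso_bij _ _ g (tomod N) (tomod N') (mklin fl)).
  - apply: act_ghom => [||a v]; [exact: mP|exact: mP|rewrite !fi !tomod_act].
    exact: (linearZ_LR f a v).
  - by move=> v; rewrite fi => e; rewrite -(fh v) e -(linear0 f) fh.
  - by move=> w; exists (h w); rewrite fi hf.
have [|F FE] := @linear_pack pa (mod_of N) (mod_of N') f.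
  move=> a u v; rewrite !mod_scaleE -!tomod_act -(ghom_act fg).
  exact: (linearD f).
exists F, h => v; rewrite ?FE.
- exact: fh.
- exact: hf.
Qed.

Lemma indecomposable_indec (N : fdmod k Q) : indecomposable N <-> indec g (tomod N).
Proof.
split=> [[N0 h]|[[v v0] h]].
  split.
    apply: contrapT => n; move/eqP: N0; apply; apply/eqP; rewrite -subv0; apply/subvP => v _.
    rewrite memv0; apply/eqP; apply: contrapT => v0; apply: n; by exists v.
  move=> f fg ff.
  have fA a v : f (fd_act N a v) = fd_act N a (f v) by rewrite -!tomod_act (ghom_act fg).
  have [||||U0|W0] := h (limg (linfun f)) (lker (linfun f)).
  - move=> a; apply/subvP => _ /memv_imgP [_ /memv_imgP [v _ ->] ->].
    by rewrite lfunE /= -fA -[X in X \in _]lfunE memv_img ?memvf.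
  - move=> a; apply/subvP => _ /memv_imgP [v vK ->].
    by move: vK; rewrite !memv_ker !lfunE /= fA => /eqP ->; rewrite linear0.
  - apply/vspaceP => v; rewrite memvf; apply/memv_addP.
    exists (f v); first by rewrite -[f v]lfunE memv_img ?memvf.
    exists (v - f v); last by rewrite addrC subrK.
    by rewrite memv_ker lfunE /= linearB ff subrr.
  - apply/eqP; rewrite -subv0; apply/subvP => _ /memv_capP [/memv_imgP [v _ ->]].
    by rewrite memv_ker !lfunE /= ff memv0.
  - left=> v; have : f v \in limg (linfun f) by rewrite -[f v]lfunE memv_img ?memvf.
    by rewrite U0 memv0 => /eqP.
  right=> v; have : v - f v \in lker (linfun f) by rewrite memv_ker lfunE /= linearB ff subrr.
  by rewrite W0 memv0 subr_eq0 => /eqP.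
split.
  by apply: contra_notN v0 => /eqP e; apply/eqP; rewrite -memv0 -e memvf.
move=> U W Us Ws UW1 UW0.
have WU0 : (W :&: U)%VS = 0%VS by rewrite capvC.
pose p := daddv_pi U W; pose p' := daddv_pi W U.
have pp y : p y + p' y = y by apply: daddv_pi_add => //; rewrite UW1 memvf.
have pU y : p y \in U by exact: memv_pi.
have pW y : p' y \in W by exact: memv_pi.
have pid u : u \in U -> p u = u by exact: daddv_pi_id.
have p0 w : w \in W -> p w = 0.
  by move=> wW; have := pp w; rewrite (daddv_pi_id WU0 wW) => /eqP; rewrite -subr_eq0 addrK => /eqP.
have pA a y : p (fd_act N a y) = fd_act N a (p y).
  have aU : fd_act N a (p y) \in U by apply: (subvP (Us a)); exact: memv_img.
  have aW : fd_act N a (p' y) \in W by apply: (subvP (Ws a)); exact: memv_img.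
  by rewrite -[in LHS](pp y) !linearD [X in X + _](pid _ aU) [X in _ + X](p0 _ aW) addr0.
have [||z|z] := h (p : {linear _ -> _}).
- apply: act_ghom => [||a y]; [exact: mP|exact: mP|by rewrite !tomod_act; exact: pA].
- by move=> y; apply: pid; exact: pU.
- by left; apply/eqP; rewrite -subv0; apply/subvP => u uU; rewrite -(pid u uU) [p u]z mem0v.
by right; apply/eqP; rewrite -subv0; apply/subvP => w wW; rewrite -(z w) [X in X \in _]p0 ?mem0v.
Qed.

Lemma regular_regw (v c : I -> k) : (forall i, c i * c i = 1) -> regular_weight v ->
  regw (k := k) adj c s (fun i => c i * v i).
Proof.
move=> c1 vr X Xi; have iso := ofmod_miso X.
have /vr : indecomposable (ofmod X) by apply/indecomposable_indec; exact: miso_indec iso Xi.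
rewrite (_ : \sum_i _ = \sum_i c i * (c i * v i) * (dm X i)%:R) //.
apply: eq_bigr => i _; rewrite mulrA c1 mul1r (miso_dm i iso); congr (_ * _%:R).
by congr (\dim (limg _)); apply/lfunP => w; rewrite [RHS]lfunE.
Qed.
End Modules.

(** * The regular representation *)

Section Regular.
Variables (k : fieldType) (Q : quiver).
Hypothesis HQ : dynkin Q.
Variable s : seq (vert Q).
Hypothesis sP : forall a : arrow Q, (index (qhead a) s < index (qtail a) s)%N.
Local Notation I := (vert Q).
Local Notation g := (ori (@qadj Q) s).
Local Notation pa := (pathalg k Q).

Fixpoint words (m : nat) : seq (seq (arrow Q)) :=
  if m is m'.+1 then [::] :: [seq a :: t | a <- enum (arrow Q), t <- words m'] else [:: [::]].

Lemma mem_words m t : (size t <= m)%N -> t \in words m.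
Proof.
elim: m t => [|m IH] [|a t] //= tm; rewrite inE; apply/orP; right.
by apply: allpairs_f; rewrite ?mem_enum // IH.
Qed.

(** Every arrow decreases the position in s, so Q has no oriented cycles and finitely many paths. *)
Lemma walk_size i t : walk i t -> (size t <= index i s)%N.
Proof.
elim: t i => [//|a t IH] i /= /andP [/eqP <- /IH h].
exact: leq_ltn_trans h (sP a).
Qed.

Definition qpaths : seq (qpath Q) :=
  pmap insub [seq (i, t) | i <- enum I, t <- words (size s)].

Lemma mem_qpaths p : p \in qpaths.
Proof.
rewrite mem_pmap_sub (surjective_pairing (val p)); apply: (allpairs_f pair); first by rewrite mem_enum.
by apply: mem_words; apply: leq_trans (index_size (psrc p) s); apply: walk_size; exact: (valP p).
Qed.

(** A copy of kQ on a [vectType], as required of the space of a [mod]. *)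
Definition regV : vectType k := {ffun seq_sub qpaths -> k^o}.
Fact to_reg_lin : linear (fun f : pa => [ffun p : seq_sub qpaths => fm_coef (val p) f] : regV).
Proof. by move=> c f h; apply/ffunP => p; rewrite !ffunE linearP. Qed.
Definition to_reg : {linear pa -> regV} := mklin to_reg_lin.
Fact of_reg_lin : linear (fun w : regV => \sum_(p : seq_sub qpaths) (w p : k) *: pelt k (val p)).
Proof.
move=> c w w'; rewrite scaler_sumr -big_split /=; apply: eq_bigr => p _.
by rewrite !ffunE scalerA -scalerDl.
Qed.
Definition of_reg : {linear regV -> pa} := mklin of_reg_lin.

Lemma to_regK f : of_reg (to_reg f) = f.
Proof.
move: f; apply: (@lin_ext k _ pa) => [c f h|//|p]; first by rewrite !linearP.
rewrite /of_reg mklinE (bigD1 (SeqSub (mem_qpaths p))) //= /to_reg mklinE ffunE fm_coefU eqxx scale1r.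
rewrite big1 ?addr0 // => q n; rewrite ffunE fm_coefU.
case: eqP => [e|_]; last by rewrite scale0r.
by case/eqP: n; apply: val_inj; rewrite /= e.
Qed.

Lemma of_regK w : to_reg (of_reg w) = w.
Proof.
have S (p : seq_sub qpaths) : fm_coef (val p) (\sum_(q : seq_sub qpaths) (w q : k) *: pelt k (val q)) =
    \sum_(q : seq_sub qpaths) (w q : k) * (val q == val p)%:R.
  rewrite linear_sum; apply: eq_bigr => q _; rewrite linearZ_LR; congr (_ * _); exact: fm_coefU.
apply/ffunP => p; rewrite /to_reg mklinE ffunE /of_reg mklinE S (bigD1 p) //= eqxx mulr1.
rewrite big1 ?addr0 // => q n; rewrite (_ : (_ == _) = false) ?mulr0 //.
by apply: contraNF n => /eqP e; apply/eqP/val_inj.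
Qed.

Fact reg_mul_lin (f : pa) : linear (fun w : regV => to_reg (f * of_reg w)).
Proof.
move=> c w w'; rewrite -linearP; congr (to_reg _); rewrite linearP.
exact: pa_mul_linearr.
Qed.
Definition reg_mul f : {linear regV -> regV} := mklin (reg_mul_lin f).
Lemma reg_mulE f w : reg_mul f w = to_reg (f * of_reg w). Proof. exact: (mklinE (reg_mul_lin f)). Qed.
Lemma reg_mulM f h w : reg_mul f (reg_mul h w) = reg_mul (f * h) w.
Proof. by rewrite !reg_mulE to_regK mulrA. Qed.
Lemma reg_mulP c f h w : reg_mul (c *: f + h) w = c *: reg_mul f w + reg_mul h w.
Proof.
by rewrite !reg_mulE -linearP; congr (to_reg _); exact: (pa_mul_linearl (of_reg w) c f h).
Qed.
Lemma reg_mul0 w : reg_mul 0 w = 0. Proof. by rewrite reg_mulE mul0r linear0. Qed.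

Definition reg_ops : ops I regV := Ops (fun i => reg_mul (idem k i)) (reg_mul (\sum_a arr k a)).

Lemma reg_isops : isops reg_ops.
Proof.
split=> [i l w|w] /=.
  by rewrite reg_mulM idemM; case: eqP; rewrite ?reg_mul0.
have E (J : finType) (F : J -> pa) : \sum_i reg_mul (F i) w = reg_mul (\sum_i F i) w.
  apply: esym; apply: (big_morph (fun f => reg_mul f w)) => [f h|]; last exact: reg_mul0.
  by have := reg_mulP 1 f h w; rewrite !scale1r.
by rewrite E sum_idem reg_mulE mul1r of_regK.
Qed.
Definition regM : mod k I := Mod reg_isops.

Lemma sum_arr_idem (i l : I) : idem k i * ((\sum_a arr k a) * idem k l) =
  \sum_(a | (qtail a == i) && (qhead a == l)) arr k a :> pa.
Proof.
have -> : (\sum_a arr k a) * idem k l = \sum_a arr k a * idem k l :> pa by exact: pa_mul_suml.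
have -> : idem k i * (\sum_a arr k a * idem k l) = \sum_a idem k i * (arr k a * idem k l) :> pa.
  exact: pa_mul_sumr.
rewrite [RHS]big_mkcond; apply: eq_bigr => a _.
by rewrite mulrA idem_arr_idem ![_ == i]eq_sym ![_ == l]eq_sym.
Qed.

Lemma sum_arr_arr (a : arrow Q) :
  idem k (qtail a) * ((\sum_a arr k a) * idem k (qhead a)) = arr k a :> pa.
Proof.
rewrite sum_arr_idem (bigD1 a) ?eqxx //= big1 ?addr0 // => b /andP [/andP [/eqP tb /eqP hb]].
by rewrite (qarrow_uniq HQ tb hb) eqxx.
Qed.

Lemma reg_exe i l w : oe reg_ops i (ox reg_ops (oe reg_ops l w)) =
  reg_mul (\sum_(a | (qtail a == i) && (qhead a == l)) arr k a) w.
Proof. by rewrite /= !reg_mulM -?mulrA sum_arr_idem. Qed.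

Lemma reg_clean : clean g (mo regM).
Proof.
move=> i l w nil; rewrite reg_exe big_pred0 ?reg_mul0 // => a.
by apply: contraNF nil => /andP [/eqP <- /eqP <-]; exact: ori_arrow.
Qed.

Lemma reg_act f w : actL (mo regM) f w = reg_mul f w.
Proof.
apply: esym; apply: (actL_unique (mP regM) (H := fun f w => reg_mul f w)) => [c f' h|//|a f'].
  exact: reg_mulP.
by rewrite arrmapE /= -{1}(sum_arr_arr a) !reg_mulM -!mulrA.
Qed.

Definition reg1 : regM := to_reg 1.

Lemma reg_gen w : w = actL (mo regM) (of_reg w) reg1.
Proof. by rewrite reg_act reg_mulE to_regK mulr1 of_regK. Qed.

Lemma ghom_reg (Z : lmodType k) (L : ops I Z) (f : {linear regM -> Z}) :
  ghom g (mo regM) L f -> forall w, f w = actL L (of_reg w) (f reg1).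
Proof. by move=> fg w; rewrite {1}(reg_gen w) (ghom_act sP fg). Qed.

Section Free.
Variables (Z : lmodType k) (L : ops I Z) (LP : isops L) (z : Z).
Fact freehom_lin : linear (fun w : regM => actL L (of_reg w) z).
Proof. by move=> c w w'; rewrite linearP; exact: act_linl. Qed.
Definition freehom : {linear regM -> Z} := mklin freehom_lin.
Lemma freehomE w : freehom w = actL L (of_reg w) z. Proof. exact: (mklinE freehom_lin). Qed.
Lemma freehom1 : freehom reg1 = z. Proof. by rewrite freehomE to_regK actL1. Qed.
Lemma freehom_ghom : ghom g (mo regM) L freehom.
Proof.
apply: (act_ghom sP) => [||f w]; [exact: mP|exact: LP|].
by rewrite reg_act !freehomE reg_mulE to_regK actLM.
Qed.
End Free.

Lemma dhom_reg (X : mod k I) : dhom g regM X = \dim {: X}.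
Proof.
apply/eqP; rewrite eqn_leq; apply/andP; split.
  have el : linear (fun f : 'Hom(regM, X) => f reg1) by move=> c f h; rewrite add_lfunE scale_lfunE.
  apply: (@dim_sub k _ _ _ _ (mklin el)) => f; first by rewrite memvf.
  move=> /mem_homV fg; rewrite mklinE => f1; apply/lfunP => w; rewrite zero_lfunE.
  rewrite (ghom_reg (f := (f : {linear _ -> _})) fg) [X in actL _ _ X]f1.
  by rewrite /actL -(mklinE (act_linr _ _ _)) linear0.
have il : linear (fun x : X => linfun (freehom (mo X) x)).
  move=> c x y; apply/lfunP => w; rewrite add_lfunE scale_lfunE !lfunE !freehomE.
  exact: act_linr.
apply: (@dim_sub k _ _ _ _ (mklin il)) => x.
  by move=> _; rewrite mklinE; apply: ghom_linfun; apply: freehom_ghom; exact: mP.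
by move=> _; rewrite mklinE => /lfunP /(_ reg1); rewrite lfunE zero_lfunE freehom1 //; exact: mP.
Qed.
End Regular.

(** * The quiver Heisenberg algebra *)

Section HeisenbergSpace.
Variables (k : fieldType) (Q : quiver) (v : vert Q -> k).
Local Notation dpa := (pathalg k (qdouble Q)).

(** An alias of the Heisenberg algebra that carries its structure of k-space; a scalar acts as
    multiplication by its multiple of 1. *)
Definition qhak : Type := qha v.
HB.instance Definition _ := GRing.Zmodule.on qhak.

Definition qhpi (f : dpa) : qha v := qpi _ f.
Definition qhak_scale (c : k) (x : qhak) : qhak := qhpi (c *: (1 : dpa)) * (x : qha v).
Lemma qhpiM f h : qhpi (f * h) = qhpi f * qhpi h. Proof. exact: rmorphM. Qed.
Lemma qhpiD f h : qhpi (f + h) = qhpi f + qhpi h. Proof. exact: raddfD. Qed.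
Lemma qhak_scaleA a b x : qhak_scale a (qhak_scale b x) = qhak_scale (a * b) x.
Proof. by rewrite /qhak_scale mulrA -qhpiM -pa_scaleE scalerA. Qed.
Lemma qhak_scale1 : left_id 1 qhak_scale.
Proof. by move=> x; rewrite /qhak_scale scale1r (_ : qhpi 1 = 1) ?mul1r //; exact: rmorph1. Qed.
Lemma qhak_scaleDr : right_distributive qhak_scale +%R.
Proof. by move=> a x y; exact: mulrDr. Qed.
Lemma qhak_scaleDl x : {morph qhak_scale^~ x : a b / a + b}.
Proof. by move=> a b; rewrite /qhak_scale scalerDl qhpiD mulrDl. Qed.
HB.instance Definition _ := GRing.Zmodule_isLmodule.Build k qhak
  qhak_scaleA qhak_scale1 qhak_scaleDr qhak_scaleDl.

Lemma qhak_scaleE (a : k) (x : qhak) : a *: x = qhpi (a *: (1 : dpa)) * (x : qha v) :> qha v.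
Proof. by []. Qed.

Fact lmulq_lin f : linear (fun x : qhak => qhpi f * (x : qha v) : qhak).
Proof.
move=> c x y; rewrite !qhak_scaleE [LHS]mulrDr !mulrA -!qhpiM -pa_scaleE -pa_scaleAr mulr1.
by [].
Qed.
Definition lmulq f : {linear qhak -> qhak} := mklin (lmulq_lin f).
Lemma lmulqE f x : lmulq f x = qhpi f * (x : qha v). Proof. exact: (mklinE (lmulq_lin f)). Qed.
Lemma lmulqM f h x : lmulq f (lmulq h x) = lmulq (f * h) x.
Proof. by rewrite !lmulqE mulrA -qhpiM. Qed.
Lemma lmulqP c f h x : lmulq (c *: f + h) x = c *: lmulq f x + lmulq h x.
Proof.
rewrite !lmulqE qhpiD [LHS]mulrDl; congr (_ + _).
by rewrite qhak_scaleE (pa_scaleE c f) qhpiM mulrA.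
Qed.
Lemma lmulq0 x : lmulq 0 x = 0. Proof. by rewrite lmulqE /qhpi raddf0 mul0r. Qed.
Lemma lmulqD f h x : lmulq (f + h) x = lmulq f x + lmulq h x.
Proof. by have := lmulqP 1 f h x; rewrite !scale1r. Qed.
Lemma lmulqZ c f x : lmulq (c *: f) x = c *: lmulq f x.
Proof. by have := lmulqP c f 0 x; rewrite lmulq0 !addr0. Qed.
Lemma lmulqB f h x : lmulq (f - h) x = lmulq f x - lmulq h x.
Proof. by have := lmulqD (f - h) h x; rewrite subrK => ->; rewrite addrK. Qed.
Lemma lmulq_sum (J : finType) (R : pred J) (F : J -> dpa) x :
  lmulq (\sum_(i | R i) F i) x = \sum_(i | R i) lmulq (F i) x.
Proof. by apply: (big_morph (fun f => lmulq f x)) => [f h|]; [exact: lmulqD|exact: lmulq0]. Qed.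
Lemma lmulq1 x : lmulq 1 x = x. Proof. by rewrite lmulqE /qhpi rmorph1 mul1r. Qed.

Lemma lmulq_veta b x : lmulq (veta v b) x = 0.
Proof.
rewrite lmulqE (_ : qhpi _ = 0) ?mul0r //; apply/eqP; rewrite -(raddf0 (qpi _)) qpi_eq subr0.
apply/idealP; exists 1%N, (fun=> 1), (fun=> veta v b), (fun=> 1); split.
  by move=> _; exists b.
by rewrite big_ord1 mul1r mulr1.
Qed.
End HeisenbergSpace.

Section DoubleAction.
Variables (k : fieldType) (Q : quiver).
Hypothesis HQ : dynkin Q.
Variable s : seq (vert Q).
Hypothesis sP : forall a : arrow Q, (index (qhead a) s < index (qtail a) s)%N.
Variables (v c : vert Q -> k).
Local Notation I := (vert Q).
Local Notation adj := (@qadj Q).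
Local Notation g := (ori adj s).
Local Notation pa := (pathalg k Q).
Local Notation dpa := (pathalg k (qdouble Q)).
Hypotheses (cc : forall i, c i * c i = 1) (cadj : forall i l, adj i l -> c l = - c i).
Local Notation u := (fun i => c i * v i).

Lemma sign_neq0 i : c i != 0.
Proof. by apply/eqP => e; have := cc i; rewrite e mul0r => /eqP; rewrite eq_sym oner_eq0. Qed.
Lemma weightV i : (u i)^-1 = (v i)^-1 * c i.
Proof. by rewrite invfM mulrC (mulr1_eq (cc i)). Qed.

Lemma sum_adj (W : lmodType k) (F : I -> W) i :
  \sum_(l | adj i l) F l = \sum_(a | qtail a == i) F (qhead a) + \sum_(a | qhead a == i) F (qtail a).
Proof.
rewrite (partition_big (@qhead Q) predT) //= [X in _ + X](partition_big (@qtail Q) predT) //=.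
rewrite -big_split /= [LHS]big_mkcond; apply: eq_bigr => l _.
case: ifPn => [/qadj_ex [a /orP [] /andP [/eqP ta /eqP ha]]|n].
- rewrite (bigD1 a) ?ta ?ha ?eqxx //= big1 ?addr0 => [|b /andP [/andP [/eqP tb /eqP hb]]].
    rewrite big_pred0 ?addr0 // => b; apply/negP => /andP [/eqP hb /eqP tb].
    by apply: (@qarrow_asym _ HQ a b); rewrite ?ta ?ha ?hb ?tb.
  by rewrite (@qarrow_uniq _ HQ b a) ?eqxx ?tb ?hb.
- rewrite [X in _ + X](bigD1 a) ?ta ?ha ?eqxx //= [X in _ + (_ + X)]big1 ?addr0 => [|b /andP [/andP [/eqP hb /eqP tb]]].
    rewrite big_pred0 ?add0r // => b; apply/negP => /andP [/eqP tb /eqP hb].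
    by apply: (@qarrow_asym _ HQ a b); rewrite ?ta ?ha ?hb ?tb.
  by rewrite (@qarrow_uniq _ HQ b a) ?eqxx ?tb ?hb.
rewrite !big_pred0 ?addr0 // => b; apply: contraNF n => /andP [/eqP <- /eqP <-].
  by rewrite qadj_sym qadj_arrow.
exact: qadj_arrow.
Qed.

Section Ops.
Variables (Z : lmodType k) (L : ops I Z) (LP : isops L).

(** x contains the reverse of a with coefficient [c (qtail a)], a square root of 1, so multiplying
    the component by the same sign recovers the reversed arrow. *)
Fact dstar_lin a : linear (fun z => c (qtail a) *: oe L (qhead a) (ox L (oe L (qtail a) z))).
Proof. by move=> b y z; rewrite !linearP. Qed.
Definition darr (b : arrow (qdouble Q)) : {linear Z -> Z} :=
  match b with inl a => arrmap L a | inr a => mklin (dstar_lin a) end.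
Definition dact : dpa -> Z -> Z := @act k (qdouble Q) Z (oe L) darr.

Lemma darr_l a z : darr (inl a) z = oe L (qtail a) (ox L (oe L (qhead a) z)). Proof. by []. Qed.
Lemma darr_r a z : darr (inr a) z = c (qtail a) *: oe L (qhead a) (ox L (oe L (qtail a) z)).
Proof. exact: (mklinE (dstar_lin a)). Qed.
Lemma darr_e b z : darr b (oe L (@qhead (qdouble Q) b) z) = darr b z.
Proof. by case: b => a; rewrite ?darr_l ?darr_r oee. Qed.
Lemma e_darr b z : oe L (@qtail (qdouble Q) b) (darr b z) = darr b z.
Proof. by case: b => a; rewrite ?darr_l ?darr_r ?linearZ_LR oee. Qed.

Lemma dact_idem i z : dact (@idem k (qdouble Q) i) z = oe L i z. Proof. exact: act_idem. Qed.
Lemma dact_arr b z : dact (@arr k (qdouble Q) b) z = darr b z. Proof. exact: (act_arr darr_e). Qed.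
Lemma dactM f h z : dact (f * h) z = dact f (dact h z).
Proof. exact: (actM (P := qdouble Q) (oeE LP) darr_e e_darr). Qed.
Lemma dactZ a f z : dact (a *: f) z = a *: dact f z. Proof. exact: actZl. Qed.
Lemma dactD f h z : dact (f + h) z = dact f z + dact h z. Proof. exact: actDl. Qed.
Lemma dactB f h z : dact (f - h) z = dact f z - dact h z.
Proof. by have := dactD (f - h) h z; rewrite subrK => ->; rewrite addrK. Qed.
Lemma dact_sum (J : finType) (R : pred J) (F : J -> dpa) z :
  dact (\sum_(i | R i) F i) z = \sum_(i | R i) dact (F i) z.
Proof. exact: act_suml. Qed.
Lemma dact_lin f : linear (dact f). Proof. exact: act_linr. Qed.
Lemma dact_0r f : dact f 0 = 0. Proof. by rewrite -(mklinE (dact_lin f)) linear0. Qed.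
Lemma dact_unique (H : dpa -> Z -> Z) w :
  (forall c f g, H (c *: f + g) w = c *: H f w + H g w) ->
  (forall i, H (@idem k (qdouble Q) i) w = oe L i w) ->
  (forall a f, H (@arr k (qdouble Q) a * f) w = darr a (H f w)) -> forall f, H f w = dact f w.
Proof. exact: (act_unique (P := qdouble Q) (oeE LP) darr_e e_darr). Qed.

Lemma dact_dincl f z : dact (dincl f) z = actL L f z.
Proof.
have Ei i : dincl (idem k i) = @idem k (qdouble Q) i :> dpa.
  by rewrite /idem dinclU; congr (pelt k _); exact: qpathP.
have Ea a : dincl (arr k a) = @arr k (qdouble Q) (inl a) :> dpa.
  by rewrite /arr dinclU; congr (pelt k _); exact: qpathP.
apply: (actL_unique LP (H := fun f z => dact (dincl f) z)) => [b f' h|i|a f'].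
- by rewrite linearP dactD dactZ.
- by rewrite Ei dact_idem.
have -> : dincl (arr k a * f') = dincl (arr k a) * dincl f' :> dpa by exact: rmorphM.
by rewrite Ea dactM dact_arr.
Qed.

Definition dbl_sum : dpa := \sum_a (@arr k (qdouble Q) (inl a) + c (qtail a) *: @arr k (qdouble Q) (inr a)).

Hypothesis cL : clean adj L.

Lemma dact_dbl_sum z : dact dbl_sum z = ox L z.
Proof.
rewrite /dbl_sum dact_sum -[RHS](sum_oe LP); under [RHS]eq_bigr do rewrite (clean_x LP cL) sum_adj.
rewrite [RHS]big_split; under [LHS]eq_bigr do rewrite dactD dactZ !dact_arr darr_l darr_r scalerA cc scale1r.
rewrite [LHS]big_split; congr (_ + _).
  rewrite (partition_big (@qtail Q) predT) //=; apply: eq_bigr => i _.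
  by apply: eq_bigr => a /eqP ->.
rewrite (partition_big (@qhead Q) predT) //=; apply: eq_bigr => i _.
by apply: eq_bigr => a /eqP ->.
Qed.

(** The colouring absorbs the signs of [rho]: an arrow with head i enters with the colour of its
    tail, which is the negative of [c i]. *)
Lemma dact_rho i z : dact (@rho k Q i) z = c i *: oe L i (ox L (ox L (oe L i z))).
Proof.
rewrite [oe L i (ox L (ox L _))](clean_x LP cL) sum_adj scalerDr /rho dactB !dact_sum.
rewrite !scaler_sumr -[X in _ + X = _]sumrN; congr (_ + _); apply: eq_bigr => a /eqP ai.
  by rewrite /dbl_arr /dbl_star dactM !dact_arr darr_l darr_r ai !linearZ_LR oee.
rewrite /dbl_arr /dbl_star dactM !dact_arr darr_l darr_r oee // -scaleNr ai.
by have := cadj (qadj_arrow a); rewrite ai => ->.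
Qed.

Lemma dact_vrho z : dact (vrho v) z = zeta u L z.
Proof.
rewrite /vrho dact_sum /zeta mklinE; apply: eq_bigr => i _.
by rewrite dactZ dact_rho scalerA weightV.
Qed.
End Ops.

Lemma dact_fullhom (Z Z' : lmodType k) (L : ops I Z) (L' : ops I Z') (F : {linear Z -> Z'}) :
  fullhom L L' F -> forall f z, F (dact L f z) = dact L' f (F z).
Proof.
move=> [Fe Fx]; apply: act_hom => [i z|[a|a] z]; first exact: Fe.
  by rewrite !darr_l Fe Fx Fe.
by rewrite !darr_r linearZ_LR Fe Fx Fe.
Qed.

Section Lam.
Variables (Z : lmodType k) (L : ops I Z) (LL : lam adj u L).
Let LP : isops L. Proof. by case: LL. Qed.
Let cL : clean adj L. Proof. by case: LL. Qed.

Lemma dact_veta b z : dact L (veta v b) z = 0.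
Proof.
have xz y : ox L (zeta u L y) = zeta u L (ox L y) by case: LL.
rewrite /veta dactB !dactM // !dact_vrho // !dact_arr //; apply/eqP; rewrite subr_eq0; apply/eqP.
case: b => a; rewrite ?darr_l ?darr_r; first by rewrite !(e_zeta u LP, xz).
by rewrite linearZ_LR !(e_zeta u LP, xz).
Qed.

Lemma dact_ideal f h z : qhpi v f = qhpi v h -> dact L f z = dact L h z.
Proof.
move=> /eqP; rewrite /qhpi qpi_eq => /idealP [n [a [t [b [ht E]]]]].
apply/eqP; rewrite -subr_eq0 -dactB E dact_sum big1 // => i _.
have [d _ <-] := ht i.
by rewrite !dactM // dact_veta dact_0r.
Qed.
End Lam.

Local Notation Zq := (qhak v).
Definition qh_ops : ops I Zq :=
  Ops (fun i => lmulq v (@idem k (qdouble Q) i)) (lmulq v dbl_sum).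
Local Notation didem i := (@idem k (qdouble Q) i).
Local Notation darw b := (@arr k (qdouble Q) b).

Lemma qh_isops : isops qh_ops.
Proof.
split=> [i l x|x] /=; first by rewrite lmulqM idemM; case: eqP; rewrite ?lmulq0.
by rewrite -lmulq_sum -[RHS]lmulq1; congr (lmulq v _ x); exact: sum_idem.
Qed.

Lemma qh_exe i l x : oe qh_ops i (ox qh_ops (oe qh_ops l x)) =
  \sum_(a | (qtail a == i) && (qhead a == l)) lmulq v (darw (inl a)) x +
  \sum_(a | (qhead a == i) && (qtail a == l)) c (qtail a) *: lmulq v (darw (inr a)) x.
Proof.
rewrite /= /dbl_sum lmulq_sum linear_sum [X in X + _]big_mkcond [X in _ + X]big_mkcond -big_split.
apply: eq_bigr => a _; rewrite lmulqD lmulqZ linearD linearZ_LR !lmulqM ?mulrA !idem_arr_idem /=.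
rewrite ![_ == i]eq_sym ![_ == l]eq_sym; congr (_ + _); case: ifP => //; rewrite lmulq0 // scaler0.
by [].
Qed.

Lemma qh_clean : clean adj qh_ops.
Proof.
move=> i l x nil; rewrite qh_exe !big_pred0 ?addr0 // => a; apply: contraNF nil => /andP [/eqP <- /eqP <-].
  by rewrite qadj_sym qadj_arrow.
exact: qadj_arrow.
Qed.

Lemma qh_darr b x : darr qh_ops b x = lmulq v (darw b) x.
Proof.
case: b => a; rewrite ?darr_l ?darr_r qh_exe.
  rewrite (bigD1 a) ?eqxx //= big1 ?addr0 => [|b /andP [/andP [/eqP tb /eqP hb]]]; last first.
    by rewrite (qarrow_uniq HQ tb hb) eqxx.
  rewrite big_pred0 ?addr0 // => b; apply/negP => /andP [/eqP hb /eqP tb].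
  exact: (@qarrow_asym _ HQ a b).
rewrite big_pred0 ?add0r => [|b]; last first.
  apply/negP => /andP [/eqP tb /eqP hb]; exact: (@qarrow_asym _ HQ a b).
rewrite (bigD1 a) ?eqxx //= big1 ?addr0 => [|b /andP [/andP [/eqP hb /eqP tb]]]; last first.
  by rewrite (qarrow_uniq HQ tb hb) eqxx.
by rewrite scalerA cc scale1r.
Qed.

Lemma qh_act f x : dact qh_ops f x = lmulq v f x.
Proof.
apply: esym; apply: (dact_unique qh_isops (H := fun f x => lmulq v f x)) => [b f' h|//|b f'].
  exact: lmulqP.
by rewrite qh_darr lmulqM.
Qed.

Lemma qh_lam : lam adj u qh_ops.
Proof.
split; [exact: qh_isops|exact: qh_clean|move=> x].
rewrite -!(dact_vrho qh_isops qh_clean) -!(dact_dbl_sum qh_isops qh_clean) !qh_act !lmulqM.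
have E b : lmulq v (darw b) (lmulq v (vrho v) x) = lmulq v (vrho v) (lmulq v (darw b) x).
  by apply/eqP; rewrite -subr_eq0 !lmulqM -lmulqB; apply/eqP; exact: lmulq_veta.
rewrite -!lmulqM; move: (vrho v) E => r E; rewrite /dbl_sum !lmulq_sum linear_sum; apply: eq_bigr => a _.
by rewrite !lmulqD !lmulqZ !E linearD linearZ_LR.
Qed.
End DoubleAction.

(** * The algebra as the module induced from the regular representation *)

Section Assembly.
Variables (k : fieldType) (Q : quiver) (v : vert Q -> k).
Hypotheses (HQ : dynkin Q) (Hv : regular_weight v).
Local Notation adj := (@qadj Q).
Local Notation I0 := (vert Q).

Lemma qha_decomposition : exists s : seq I0, ordering s /\
  (forall a : arrow Q, (index (qhead a) s < index (qtail a) s)%N) /\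
  exists (Y : mod k I0) (psi : qha v -> Y) (T : finType) (NN : T -> mod k I0),
  [/\ (forall x y, psi (x + y) = psi x + psi y) /\
        (forall f x, psi (qha_map v f * x) = actL (mo Y) f (psi x)),
      (forall x, psi x = 0 -> x = 0) /\ (forall y, exists x, psi x = y),
      forall a, indec (ori adj s) (NN a), biprod (ori adj s) Y NN &
      forall X, indec (ori adj s) X ->
        #|[pred a | `[< miso (ori adj s) (NN a) X >] ]| = \dim {: X}].
Proof.
have [s [os sP]] := dynkin_order HQ; exists s; split=> //; split=> //.
have [col colP] := dynkin_colour HQ.
pose c i : k := (-1) ^+ col i.
have cc i : c i * c i = 1 by rewrite -expr2 sqrr_sign.
have cadj i l : adj i l -> c l = - c i.
  by move=> /colP e; rewrite /c e; case: (col i); rewrite /= ?expr0 ?expr1 ?opprK.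
have [uu uuP] := dynkin_positive HQ.
have [j0 _] := dynkin_nonempty HQ.
pose uq i : rat := (uu i)%:R.
have uq0 i : 0 < uq i by rewrite ltr0n; case: (uuP i).
have cuq i : 1 <= cart adj uq i.
  have [_ h] := uuP i; rewrite /cart /uq lerBrDl -natr_sum -natrM natr1 ler_nat.
  exact: h.
(* K exceeds each 2 * uu i and is at most its own square. *)
pose K := (2 * \sum_i uu i).+1.
have KP i : 2 * uq i < K%:R ^+ 2.
  rewrite /uq -natrM -natrX ltr_nat; apply: leq_trans (_ : K <= _)%N.
    by rewrite ltnS leq_mul2l /= (bigD1 i) //= leq_addr.
  by rewrite -{1}[K]expn1 leq_pexp2l.
have [Y [eta [[YL etag Yu Yg _] [T [NN [Ni bip cnt]]]]]] :=
  heisenberg_decomposition (@qadj_sym Q) (qadj_irr HQ) j0 uq0 cuq KP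
   (fun i => sign_neq0 cc i) cadj os (regular_regw HQ sP cc Hv) (M := regM k sP) (@reg_clean k Q s sP).
have YP : isops (mo Y) := mP Y.
set y1 := eta (reg1 k sP).
pose psi (x : qha v) := dact c (mo Y) (repr x) y1.
have psiE f : psi (qhpi v f) = dact c (mo Y) f y1.
  rewrite /psi; apply: (dact_ideal HQ cc cadj YL); exact: qpi_repr.
have reprE x : exists f, x = qhpi v f by exists (repr x); rewrite /qhpi qpi_repr.
exists Y, psi, T, NN; split=> //.
- split=> [x y|f x].
    have [f ->] := reprE x; have [h ->] := reprE y.
    by rewrite -qhpiD !psiE dactD.
  have [h ->] := reprE x.
  rewrite -[qha_map v f]/(qhpi v (dincl f)) -qhpiM !psiE dactM //.
  by rewrite dact_dincl.
- split.
    have QL := qh_lam HQ v cc cadj.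
    have QP := qh_isops v c.
    (* Injectivity: the algebra is a Heisenberg module, so Y maps to it with [y1] going to 1, and
       this map undoes [psi]. *)
    have [F [Ff FE]] := Yu _ _ QL _ (freehom_ghom HQ sP QP (1 : qha v)).
    move=> x; have [f ->] := reprE x; rewrite psiE => /(congr1 F).
    rewrite (dact_fullhom c Ff) FE freehom1 // linear0 qh_act // lmulqE mulr1.
    by [].
  have xE y : ox (mo Y) y = dact c (mo Y) (dbl_sum c) y.
    by case: YL => _ cY _; rewrite dact_dbl_sum.
  (* Surjectivity: the multiples of [y1] are stable under all operations and contain the image of
     [eta]. *)
  have D : forall y, exists f, dact c (mo Y) f y1 = y.
    apply: Yg.
    + split; first by exists 0; rewrite /dact act0l.
      by move=> b y y' [f <-] [f' <-]; exists (b *: f + f'); rewrite dactD dactZ.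
    + by move=> i y [f <-]; exists (@idem k (qdouble Q) i * f); rewrite dactM // dact_idem.
    + by move=> y [f <-]; exists (dbl_sum c * f); rewrite dactM // xE.
    + move=> m; exists (dincl (of_reg k s m)); rewrite dact_dincl //.
      by rewrite (ghom_reg HQ etag).
  by move=> y; have [f <-] := D y; exists (qhpi v f); rewrite psiE.
move=> X Xi; rewrite cnt // dhom_reg //.
Qed.

Variables (I : Type) (N : I -> fdmod k Q).
Hypothesis HN : is_ind N.

Theorem qha_iso : lmod_iso (restr (@qha_map k Q v))
           (dsum (fun i : I => {ffun 'I_(fdim (N i)) -> mod_of (N i)})).
Proof.
have [s [os [sP [Y [psi [T [NN [[psiD psiA] [psi0 psis] Ni bip cnt]]]]]]]] := qha_decomposition.
have [inn [out [ig og oi oi0 io]]] := bip.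
have [Nind Nuniq Nex] := HN.
pose Ai i := [pred a : T | `[< miso (ori adj s) (NN a) (tomod (N i)) >] ].
have cA i : #|Ai i| = fdim (N i).
  by rewrite cnt //; apply/(indecomposable_indec HQ sP).
(* The summands of Y isomorphic to [N i] are exactly as many as dim [N i], so the pairs (i, r)
   enumerate T without repetition. *)
pose aa i (r : 'I_(fdim (N i))) : T := enum_val (cast_ord (esym (cA i)) r).
have aaP i r : miso (ori adj s) (NN (@aa i r)) (tomod (N i)).
  by have /asboolP := enum_valP (cast_ord (esym (cA i)) r).
have aa_i i i' r r' : @aa i r = @aa i' r' -> i = i'.
  move=> e; apply: Nuniq; apply/(lmod_iso_miso HQ sP).
  by apply: miso_trans (miso_sym (aaP i r)) _; rewrite e.
have aa_inj i r r' : @aa i r = @aa i r' -> r = r'.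
  by move=> /enum_val_inj /cast_ord_inj.
have aa_ex a : exists i r, @aa i r = a.
  have iso := ofmod_miso HQ sP (NN a).
  have /Nex [i iiso] : indecomposable (ofmod (NN a)).
    by apply/(indecomposable_indec HQ sP); exact: miso_indec iso (Ni a).
  have aA : a \in Ai i.
    rewrite inE; apply/asboolP; apply: asboolT.
    exact: (miso_trans iso ((lmod_iso_miso HQ sP _ _).1 iiso)).
  exists i, (cast_ord (cA i) (enum_rank_in aA a)).
  by rewrite /aa cast_ordK enum_rankK_in.
have isoP i r : exists f : {linear NN (@aa i r) -> tomod (N i)}, exists h : {linear tomod (N i) -> NN (@aa i r)},
    [/\ ghom (ori adj s) (mo (NN (@aa i r))) (mo (tomod (N i))) f, cancel f h & cancel h f].
  by have [f [h [fg _ fh hf]]] := aaP i r; exists f, h.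
pose fi i r := sval (cid (isoP i r)).
have fiP i r : exists h : {linear tomod (N i) -> NN (@aa i r)},
    [/\ ghom (ori adj s) (mo (NN (@aa i r))) (mo (tomod (N i))) (fi i r), cancel (fi i r) h & cancel h (fi i r)].
  exact: svalP (cid (isoP i r)).
pose comp (x : qha v) i (r : 'I_(fdim (N i))) : mod_of (N i) := fi i r (out (@aa i r) (psi x)).
have comp0 x : (forall i r, comp x i r = 0) -> x = 0.
  move=> x0; apply: psi0; rewrite -(io (psi x)) big1 // => a _.
  have [i [r <-]] := aa_ex a; have [h [_ fh _]] := fiP i r.
  by rewrite -[out _ _]fh [fi i r _](x0 i r) !linear0.
have comp_ex (y : forall i, 'I_(fdim (N i)) -> mod_of (N i)) :
    exists x, forall i r, comp x i r = y i r.
  (* The prescribed component [y i r] has to be placed in [NN a] for the a that equals [aa i r].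
     Since a determines i and r, the transport along this equation is harmless. *)
  have yyP a : exists z : NN a, forall i r (e : @aa i r = a),
      fi i r (eq_rect_r (fun b : T => NN b : Type) z e) = y i r.
    have [i [r <-]] := aa_ex a; have [h [_ fh hf]] := fiP i r.
    exists (h (y i r)) => i' r' e.
    have ei := aa_i _ _ _ _ e; subst i'; have er := aa_inj _ _ _ e; subst r'.
    by rewrite (Prop_irrelevance e erefl) /=; exact: hf.
  pose yy a := sval (cid (yyP a)).
  have [x xE] := psis (\sum_a inn a (yy a)); exists x => i r.
  rewrite /comp xE linear_sum (bigD1 (aa i r)) //= oi big1 ?addr0 => [|b n]; last first.
    by rewrite oi0 // eq_sym.
  exact: (svalP (cid (yyP (aa i r))) i r erefl).
have compP f x y i r : comp (qha_map v f * x + y) i r = f *: comp x i r + comp y i r.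
  have [_ [fg _ _]] := fiP i r.
  by rewrite /comp psiD psiA !linearD (ghom_act sP (og _)) (ghom_act sP fg) (tomod_act HQ).
pose NF i : lmodType (pathalg k Q) := {ffun 'I_(fdim (N i)) -> mod_of (N i)}.
(* An index with a nonzero component belongs to some summand in the finite set T, so every family is
   finitely supported, whatever the type I is. *)
have fin_sup (y : dprod NF) : y \in @fin_supported _ _ NF.
  pose iota a := sval (cid (aa_ex a)).
  have iotaP a : exists r, @aa (iota a) r = a by exact: svalP (cid (aa_ex a)).
  apply/asboolP; apply: sub_finite_set (finite_image iota (@finite_finset T setT)) => i /= ne.
  have [r _] : exists r : 'I_(fdim (N i)), True.
    by apply: contrapT => n; apply: ne; apply/ffunP => r; case: n; exists r.
  by exists (aa i r) => //; have [r' /aa_i] := iotaP (aa i r).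
pose G (x : qha v) : dprod NF := fun i => [ffun r => comp x i r].
pose Gs (x : restr (@qha_map k Q v)) : dsum NF := Sub (G x) (fin_sup (G x)).
have Glin : linear Gs.
  move=> f x y; apply: val_inj; apply: functional_extensionality_dep => i; apply/ffunP => r.
  change (G (qha_map v f * x + y) i r = (f *: G x i + G y i) r).
  by rewrite !ffunE compP.
have [F FE] := linear_pack Glin; exists F.
have Finj : injective F.
  move=> x y e; apply/eqP; rewrite -subr_eq0; apply/eqP; apply: comp0 => i r.
  have E z : val (F z) i r = comp z i r by rewrite FE; exact: ffunE.
  have := compP 1 (x - y) y i r; rewrite rmorph1 mul1r subrK scale1r -!E e => /eqP.
  by rewrite -subr_eq0 opprD addrCA subrr addr0 oppr_eq0 E => /eqP.
have Fsurj y : exists x, F x = y.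
  have [x xE] := comp_ex (fun i r => val y i r).
  exists x; rewrite FE; apply: val_inj; apply: functional_extensionality_dep => i.
  by apply/ffunP => r; rewrite ffunE xE.
exists (fun y => sval (cid (Fsurj y))) => [x|y].
  by apply: Finj; exact: svalP (cid (Fsurj (F x))).
exact: svalP (cid (Fsurj y)).
Qed.
End Assembly.

Theorem corollary1p13 (k : fieldType) (Q : quiver) (v : vert Q -> k)
  (HQ : dynkin Q) (Hv : regular_weight v)
  (I : Type) (N : I -> fdmod k Q) (HN : is_ind N) :
  lmod_iso (restr (@qha_map k Q v))
           (dsum (fun i : I => {ffun 'I_(fdim (N i)) -> mod_of (N i)})).
Proof. exact: qha_iso HN. Qed.
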